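(* Let $f$ be a non-vanishing holomorphic function on some open neighbourhood of $\partial\mathcal{D}_1$ such that $\ln f$ is also holomorphic on this neighbourhood. Let $n=n_-+n_+$, $r=r_-+r_+$ and let $$p_a=1-p_a^-,\quad h_a=h_a^-\quad(a=1,\dots,n_-),\qquad p_{a+n_-}=p_a^++N,\quad h_{a+n_-}=N+1-h_a^+\quad(a=1,\dots,n_+),$$ $$k_a=1-k_a^-,\quad t_a=t_a^-\quad(a=1,\dots,r_-),\qquad k_{a+r_-}=k_a^++N,\quad t_{a+r_-}=N+1-t_a^+\quad(a=1,\dots,r_+),$$ where $p_a^\pm,h_a^\pm,k_a^\pm,t_a^\pm\ge 1$ are integers independent of $N$, such that each of the families $(p_a)$, $(h_a)$, $(k_a)$, $(t_a)$ consists of pairwise distinct integers. Define $\ell_a=a$ for $a\in\{1,\dots,N\}\setminus\{h_1,\dots,h_n\}$, $\ell_{h_a}=p_a$ for $a=1,\dots,n$, and $m_a=a$ for $a\in\{1,\dots,N\}\setminus\{t_1,\dots,t_r\}$, $m_{t_a}=k_a$ for $a=1,\dots,r$. Let the sets $\{h_a^+\}_1^{n_+}$ and $\{t_a^+\}_1^{r_+}$ (resp. $\{h_a^-\}_1^{n_-}$ and $\{t_a^-\}_1^{r_-}$) be well-ordered with overlap $c_+$ (resp. $c_-$). Put $$\mathcal{J}^{(+)}=\Big\{\{p_a^+\}_1^{n_+};\{h_a^+\}_1^{n_+};\{k_a^+\}_1^{r_+};\{t_a^+\}_1^{r_+}\Big\},\qquad \mathcal{J}^{(-)}=\Big\{\{p_a^--1\}_1^{n_-};\{h_a^--1\}_1^{n_-};\{k_a^--1\}_1^{r_-};\{t_a^--1\}_1^{r_-}\Big\}.$$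 Then, provided that the matrices $\mathcal{N}^{(\pm)}(\mathcal{J}^{(\pm)};c_\pm)$ (of sizes $(n_\pm+r_\pm)\times(n_\pm+r_\pm)$, defined in the context) have maximal rank, one has, as $N\to\infty$, $$\det_N\big[c_{\ell_a-m_b}[f]\big]\cdot\Big(\det_N\big[c_{a-b}[f]\big]\Big)^{-1}=\det_{n_++r_+}\big[\mathcal{N}^{(+)}(\mathcal{J}^{(+)};c_+)\big]\cdot\det_{n_-+r_-}\big[\mathcal{N}^{(-)}(\mathcal{J}^{(-)};c_-)\big]\cdot\Big(1+O\big(N^{-\infty}\big)\Big).$$
   Context: $\mathcal{D}_1$ is the open unit disc, $\partial\mathcal{D}_1$ the counter-clockwise oriented unit circle, $c_m[g]=\oint_{\partial\mathcal{D}_1}\frac{g(z)}{z^{m+1}}\frac{dz}{2i\pi}$. $O(N^{-\infty})$ denotes a quantity that is $O(N^{-m})$ as $N\to\infty$ for every $m>0$. Families $(h_a)_1^n$ and $(t_b)_1^r$ of positive integers are well-ordered with overlap $c\in\{0,\dots,\min(r,n)\}$ if $h_a=t_a$ for $a=1,\dots,c$ and $\{h_{c+1},\dots,h_n\}\cap\{t_{c+1},\dots,t_r\}=\emptyset$. Let $\alpha(z)=\exp\{-\sum_{m\ge0}c_m[\ln f]z^m\}$ for $|z|<1$ and $\alpha(z)=\exp\{\sum_{m\ge1}c_{-m}[\ln f]z^{-m}\}$ for $|z|>1$; $\alpha_+$ (resp. $\alpha_-$) denotes its boundary value on $\partial\mathcal{D}_1$ from inside (resp. outside) the unit disc. For $\epsilon\in\{+1,-1\}$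 (also written $\pm$), a collection $\mathcal{J}=\{\{p_a\}_1^{n};\{h_a\}_1^{n};\{k_a\}_1^{r};\{t_a\}_1^{r}\}$ of families of integers, and $c\in\{0,\dots,\min(n,r)\}$, the $(n+r)\times(n+r)$ matrix $$\mathcal{N}^{(\epsilon)}(\mathcal{J};c)=\begin{pmatrix}\mathcal{N}^{(\epsilon)}_{I;I}&\mathcal{N}^{(\epsilon)}_{I;II}\\ \mathcal{N}^{(\epsilon)}_{II;I}&\mathcal{N}^{(\epsilon)}_{II;II}\end{pmatrix}(\mathcal{J};c)$$ has blocks (indices attached to $I$ run over $1,\dots,n$, those attached to $II$ over $1,\dots,r$; all integrals are double integrals over $(z,s)\in\partial\mathcal{D}_1\times\partial\mathcal{D}_1$): $$(\mathcal{N}^{(\epsilon)}_{I;I})_{ab}=-\epsilon\oint\frac{1}{z(1-\epsilon0^+)-s}\Big\{\delta_{b\le c}\delta_{a\le c}\Big(\tfrac{\alpha_{-\epsilon}(z)}{\alpha_{-\epsilon}(s)}\Big)^{\epsilon}s^{\epsilon h_a-1}z^{\epsilon k_b-1}+\delta_{b>c}\Big(\tfrac{\alpha_{\epsilon}(z)}{\alpha_{\epsilon}(s)}\Big)^{\epsilon}s^{-\epsilon p_a}z^{-\epsilon h_b}-\delta_{b>c}\delta_{a\le c}\Big(\tfrac{\alpha_{\epsilon}(z)}{\alpha_{-\epsilon}(s)}\Big)^{\epsilon}s^{\epsilon h_a-1}z^{-\epsilon h_b}\Big\}\frac{ds\,dz}{(2i\pi)^2}$$ $$\qquad+\epsilon\,\delta_{b\le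 c}\oint\frac{s^{-\epsilon p_a}z^{\epsilon k_b-1}}{z(1+\epsilon0^+)-s}\Big(\tfrac{\alpha_{-\epsilon}(z)}{\alpha_{\epsilon}(s)}\Big)^{\epsilon}\frac{ds\,dz}{(2i\pi)^2},$$ $$(\mathcal{N}^{(\epsilon)}_{I;II})_{ab}=-\epsilon\oint\frac{1}{z(1-\epsilon0^+)-s}\Big\{\delta_{b\le c}\delta_{a\le c}\Big(\tfrac{\alpha_{\epsilon}(z)}{\alpha_{-\epsilon}(s)}\Big)^{\epsilon}s^{\epsilon h_a-1}z^{-\epsilon t_b}+\delta_{b>c}\delta_{a\le c}\Big(\tfrac{\alpha_{-\epsilon}(z)}{\alpha_{-\epsilon}(s)}\Big)^{\epsilon}s^{\epsilon h_a-1}z^{\epsilon k_b-1}-\delta_{b\le c}\Big(\tfrac{\alpha_{\epsilon}(z)}{\alpha_{\epsilon}(s)}\Big)^{\epsilon}s^{-\epsilon p_a}z^{-\epsilon t_b}\Big\}\frac{ds\,dz}{(2i\pi)^2}$$ $$\qquad+\epsilon\,\delta_{b>c}\oint\frac{s^{-\epsilon p_a}z^{\epsilon k_b-1}}{z(1+\epsilon0^+)-s}\Big(\tfrac{\alpha_{-\epsilon}(z)}{\alpha_{\epsilon}(s)}\Big)^{\epsilon}\frac{ds\,dz}{(2i\pi)^2},$$ $$(\mathcal{N}^{(\epsilon)}_{II;I})_{ab}=-\epsilon\oint\frac{s^{\epsilon t_a-1}}{z(1-\epsilon0^+)-s}\Big\{\delta_{b\le c}\Big(\tfrac{\alpha_{-\epsilon}(z)}{\alpha_{-\epsilon}(s)}\Big)^{\epsilon}z^{\epsilon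 k_b-1}-\delta_{b>c}\Big(\tfrac{\alpha_{\epsilon}(z)}{\alpha_{-\epsilon}(s)}\Big)^{\epsilon}z^{-\epsilon h_b}\Big\}\frac{ds\,dz}{(2i\pi)^2},$$ $$(\mathcal{N}^{(\epsilon)}_{II;II})_{ab}=-\epsilon\oint\frac{s^{\epsilon t_a-1}}{z(1-\epsilon0^+)-s}\Big\{\delta_{b\le c}\Big(\tfrac{\alpha_{\epsilon}(z)}{\alpha_{-\epsilon}(s)}\Big)^{\epsilon}z^{-\epsilon t_b}+\delta_{b>c}\Big(\tfrac{\alpha_{-\epsilon}(z)}{\alpha_{-\epsilon}(s)}\Big)^{\epsilon}z^{\epsilon k_b-1}\Big\}\frac{ds\,dz}{(2i\pi)^2}.$$ Here $\delta_{b\le c}$, $\delta_{b>c}$ equal $1$ if the indicated inequality holds and $0$ otherwise. The notation $\frac{1}{z(1-\epsilon0^+)-s}$ means that the integral is the limit $\eta\to0^+$ of the one with $\frac{1}{z(1-\epsilon\eta)-s}$, i.e. $z$ approaches the unit circle from inside for $\epsilon=+1$ and from outside for $\epsilon=-1$; similarly $\frac{1}{z(1+\epsilon0^+)-s}$ is the limit of $\frac{1}{z(1+\epsilon\eta)-s}$. *)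

(* Defs.v *)
From HB Require Import structures.
From mathcomp Require Import all_boot all_order all_algebra.
From mathcomp Require Import all_classical all_reals all_analysis.
From mathcomp Require Import complex.

Set Implicit Arguments.
Unset Strict Implicit.
Unset Printing Implicit Defensive.

Import Order.TTheory GRing.Theory Num.Theory.
Import numFieldNormedType.Exports.

Local Open Scope classical_set_scope.
Local Open Scope ring_scope.
Local Open Scope complex_scope.

(* R[i] carries its field structure; its topology is that of the regular
   module R[i]^o, hence the ascriptions wherever a limit is taken. *)

Definition cexp (R : realType) (z : R[i]) : R[i] :=
  (expR (complex.Re z))%:C *
    (cos (complex.Im z) +i* sin (complex.Im z)).

Definition holomorphic_on (R : realType) (U : set (R[i])^o)
    (f : R[i] -> R[i]) : Prop :=
  forall z, U z -> derivable (f : (R[i])^o -> (R[i])^o) z 1.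

Definition unit_circle (R : realType) : set (R[i])^o :=
  [set z : R[i] | `|z| = 1].

Definition integral02pi (R : realType) (g : R -> R[i]) : R[i] :=
  (\int[lebesgue_measure]_(x in `[0, 2 * pi]) complex.Re (g x))%R +i*
  (\int[lebesgue_measure]_(x in `[0, 2 * pi]) complex.Im (g x))%R.

(* The counter-clockwise contour integral of g(z) dz over the unit circle. *)
Definition oint (R : realType) (g : R[i] -> R[i]) : R[i] :=
  integral02pi (fun x : R =>
    let z := cos x +i* sin x in g z * ('i%C * z)).

(* The Laurent coefficient c_m[g]. *)
Definition fourier (R : realType) (g : R[i] -> R[i]) (m : int) : R[i] :=
  oint (fun z => g z / z ^ (m + 1)) / (2 * 'i%C * pi%:C).

(* lf stands for ln f; the value on the unit circle itself is junk. *)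
Definition alpha (R : realType) (lf : R[i] -> R[i]) (z : R[i]) : R[i] :=
  if `|z| < 1 then
    cexp (- limn (series (fun m : nat =>
                    fourier lf m%:Z * z ^+ m : (R[i])^o)))
  else
    cexp (limn (series (fun m : nat =>
                    fourier lf (- m.+1%:Z) * z ^- m.+1 : (R[i])^o))).

(* alpha_+ (boundary value from inside the disc) for e = 1 and
   alpha_- (boundary value from outside) for e = -1. *)
Definition alpha_bv (R : realType) (lf : R[i] -> R[i]) (e : int)
    (z : R[i]) : R[i] :=
  if 0 < e then
    lim ((alpha lf w : (R[i])^o)
           @[w --> within [set w : R[i] | `|w| < 1] (nbhs (z : (R[i])^o))])
  else
    lim ((alpha lf w : (R[i])^o)
           @[w --> within [set w : R[i] | 1 < `|w|] (nbhs (z : (R[i])^o))]).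

(* The integral of G z s / (z (1 - e 0^+) - s) ds dz / (2 i pi)^2 over the
   product of two unit circles. *)
Definition reg_dint (R : realType) (e : int) (G : R[i] -> R[i] -> R[i])
    : R[i] :=
  lim ((oint (fun z => oint (fun s =>
          (z * (1 - e%:~R * eta%:C) - s)^-1 * G z s))
        / (2 * 'i%C * pi%:C) ^+ 2 : (R[i])^o) @[eta --> (0 : R)^'+]).

(* Value of a family at a (0-based) position given as a natural number. The
   default is only reached for k_b with b > r, in terms whose prefactor
   delta_{b <= c} vanishes since c <= r. *)
Definition fam_at (r : nat) (k : 'I_r -> int) (b : nat) : int :=
  if insub b is Some j then k j else 0.

(* Indices being 0-based, the Kronecker symbol delta_{a <= c} is
   (a < c)%N%:R and delta_{a > c} is (c <= a)%N%:R. *)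
Definition N_I_I (R : realType) (lf : R[i] -> R[i]) (e : int) (n r : nat)
    (p h : 'I_n -> int) (k t : 'I_r -> int) (c : nat) : 'M[R[i]]_(n, n) :=
  \matrix_(a < n, b < n)
    (- e%:~R * reg_dint e (fun z s =>
         (b < c)%N%:R * (a < c)%N%:R
           * (alpha_bv lf (- e) z / alpha_bv lf (- e) s) ^ e
           * s ^ (e * h a - 1) * z ^ (e * fam_at k b - 1)
       + (c <= b)%N%:R
           * (alpha_bv lf e z / alpha_bv lf e s) ^ e
           * s ^ (- e * p a) * z ^ (- e * h b)
       - (c <= b)%N%:R * (a < c)%N%:R
           * (alpha_bv lf e z / alpha_bv lf (- e) s) ^ e
           * s ^ (e * h a - 1) * z ^ (- e * h b))
     + e%:~R * (b < c)%N%:R * reg_dint (- e) (fun z s =>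
         s ^ (- e * p a) * z ^ (e * fam_at k b - 1)
           * (alpha_bv lf (- e) z / alpha_bv lf e s) ^ e)).

Definition N_I_II (R : realType) (lf : R[i] -> R[i]) (e : int) (n r : nat)
    (p h : 'I_n -> int) (k t : 'I_r -> int) (c : nat) : 'M[R[i]]_(n, r) :=
  \matrix_(a < n, b < r)
    (- e%:~R * reg_dint e (fun z s =>
         (b < c)%N%:R * (a < c)%N%:R
           * (alpha_bv lf e z / alpha_bv lf (- e) s) ^ e
           * s ^ (e * h a - 1) * z ^ (- e * t b)
       + (c <= b)%N%:R * (a < c)%N%:R
           * (alpha_bv lf (- e) z / alpha_bv lf (- e) s) ^ e
           * s ^ (e * h a - 1) * z ^ (e * k b - 1)
       - (b < c)%N%:R
           * (alpha_bv lf e z / alpha_bv lf e s) ^ e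
           * s ^ (- e * p a) * z ^ (- e * t b))
     + e%:~R * (c <= b)%N%:R * reg_dint (- e) (fun z s =>
         s ^ (- e * p a) * z ^ (e * k b - 1)
           * (alpha_bv lf (- e) z / alpha_bv lf e s) ^ e)).

Definition N_II_I (R : realType) (lf : R[i] -> R[i]) (e : int) (n r : nat)
    (p h : 'I_n -> int) (k t : 'I_r -> int) (c : nat) : 'M[R[i]]_(r, n) :=
  \matrix_(a < r, b < n)
    (- e%:~R * reg_dint e (fun z s =>
       s ^ (e * t a - 1) *
       ( (b < c)%N%:R
           * (alpha_bv lf (- e) z / alpha_bv lf (- e) s) ^ e
           * z ^ (e * fam_at k b - 1)
       - (c <= b)%N%:R
           * (alpha_bv lf e z / alpha_bv lf (- e) s) ^ e
           * z ^ (- e * h b)))).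

Definition N_II_II (R : realType) (lf : R[i] -> R[i]) (e : int) (n r : nat)
    (p h : 'I_n -> int) (k t : 'I_r -> int) (c : nat) : 'M[R[i]]_(r, r) :=
  \matrix_(a < r, b < r)
    (- e%:~R * reg_dint e (fun z s =>
       s ^ (e * t a - 1) *
       ( (b < c)%N%:R
           * (alpha_bv lf e z / alpha_bv lf (- e) s) ^ e
           * z ^ (- e * t b)
       + (c <= b)%N%:R
           * (alpha_bv lf (- e) z / alpha_bv lf (- e) s) ^ e
           * z ^ (e * k b - 1)))).

Definition Nmx (R : realType) (lf : R[i] -> R[i]) (e : int) (n r : nat)
    (p h : 'I_n -> int) (k t : 'I_r -> int) (c : nat) : 'M[R[i]]_(n + r) :=
  block_mx (N_I_I lf e p h k t c) (N_I_II lf e p h k t c)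
           (N_II_I lf e p h k t c) (N_II_II lf e p h k t c).

Definition well_ordered_overlap (n r : nat) (h : 'I_n -> int)
    (t : 'I_r -> int) (c : nat) : Prop :=
  [/\ (c <= minn r n)%N,
      forall (a : 'I_n) (b : 'I_r), a = b :> nat -> (a < c)%N -> h a = t b
    & forall (a : 'I_n) (b : 'I_r), (c <= a)%N -> (c <= b)%N -> h a <> t b].

(* (p_a): first the 1 - p_a^-, then the p_a^+ + N; also used for (k_a). *)
Definition particles (nm np : nat) (pm : 'I_nm -> int) (pp : 'I_np -> int)
    (N : nat) (a : 'I_(nm + np)) : int :=
  match fintype.split a with inl i => 1 - pm i | inr i => pp i + N%:Z end.

(* (h_a): first the h_a^-, then the N + 1 - h_a^+; also used for (t_a). *)
Definition holes (nm np : nat) (hm : 'I_nm -> int) (hp : 'I_np -> int)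
    (N : nat) (a : 'I_(nm + np)) : int :=
  match fintype.split a with inl i => hm i | inr i => N%:Z + 1 - hp i end.

(* x |-> x, except that h_a |-> p_a: the sequences (ell_a) and (m_a). *)
Definition excite (n : nat) (p h : 'I_n -> int) (x : int) : int :=
  if [pick a | h a == x] is Some a then p a else x.

Definition toeplitz_det (R : realType) (f : R[i] -> R[i]) (N : nat)
    (l m : int -> int) : R[i] :=
  \det (\matrix_(a < N, b < N) fourier f (l a.+1%:Z - m b.+1%:Z)).

(* Main.v *)
Require Import Defs.
From HB Require Import structures.
From mathcomp Require Import all_boot all_order all_algebra.
From mathcomp Require Import all_classical all_reals all_analysis.
From mathcomp Require Import complex.
From mathcomp Require Import ring lra zify.
From mathcomp Require Import perm.

(** Let T be the N x N Toeplitz matrix of the Fourier coefficients of f. The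
    excited matrix differs from T in the n rows h_a and in the r columns t_b, so by
    Sylvester's identity the ratio of the two determinants is a determinant of the
    fixed size n + r (det_excite). Its entries pair T^-1 with unit vectors, for the
    holes h_a and t_b, and with rows or columns of Fourier coefficients, for the
    particles p_a and k_b.

    The inverse of T is approximated explicitly. As ln f is holomorphic near the
    circle, f = phi_+ phi_-, where phi_+ and phi_- are the exponentials of the two
    halves of the Laurent series of ln f. The half-infinite Toeplitz matrix of f
    then has the inverse T(1/phi_+) T(1/phi_-), whose action on a unit vector and
    on the column of a particle is a finite sum (hole_sol, part_sol). Truncated to
    size N, these vectors solve the equations for T up to an error O(r^N) with
    r < 1 (hole_sol_eq, part_sol_eq), because the coefficients of 1/phi_+ and
    1/phi_- decay geometrically. The last end of the matrix is the first end of the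
    transposed problem, with the two factors exchanged (mirror). Solving for each
    unit vector from the nearer end shows that T is invertible for large N, with an
    inverse whose entries grow at most linearly (toep_inverse); the true and the
    explicit solutions are then geometrically close. Since the explicit solutions
    decay away from their end, the limiting matrix of size n + r decouples into one
    block per end, the error being geometrically small (approx_excited,
    det_excited_lim). This is O(N^-m) for every m, also relatively to the limit
    when the latter is nonzero, which is the rank condition.

    It remains to identify the two blocks with the matrices N^(+) and N^(-).
    Expanding the kernel of a regularised double integral in a geometric series
    turns the integral of g(z) h(s) into a sum of products of Fourier coefficients
    of g and h (reg_dint_eval). This sum is finite since the boundary values of
    alpha are 1/phi_+ and phi_-, which have coefficients of one sign only, and it
    is one of the finite sums above (det_Nmx). The terms with indices at most c,
    which count common holes once, arise by adding rows and exchanging columns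
    (det_overlap).

    The analytic input is the geometric decay and the convergence of Laurent
    expansions near the circle (annulus_expand). It rests on Goursat's theorem,
    used in the logarithmic coordinate to shift contours, and on Bessel's
    inequality. *)

Set Implicit Arguments.
Unset Strict Implicit.
Unset Printing Implicit Defensive.

Import Order.TTheory GRing.Theory Num.Theory.
Import numFieldNormedType.Exports.

Local Open Scope classical_set_scope.
Local Open Scope ring_scope.
Local Open Scope complex_scope.

(** * The modulus of a complex number *)

Section ComplexNorm.
Variable R : realType.
Implicit Types z w : R[i].

Definition cn z : R := Normc.normc z.

Lemma cnE z : `|z| = (cn z)%:C. Proof. by rewrite normc_def; case: z. Qed.
Lemma cn_ge0 z : 0 <= cn z. Proof. by rewrite -lecR -cnE normr_ge0. Qed.
Lemma cn0 : cn 0 = 0. Proof. exact: Normc.normc0. Qed.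
Lemma cn1 : cn 1 = 1. Proof. exact: Normc.normc1. Qed.
Lemma cnM z w : cn (z * w) = cn z * cn w. Proof. exact: Normc.normcM. Qed.
Lemma cnV z : cn z^-1 = (cn z)^-1. Proof. exact: Normc.normcV. Qed.
Lemma cnN z : cn (- z) = cn z. Proof. exact: normcN. Qed.
Lemma cnD z w : cn (z + w) <= cn z + cn w. Proof. exact: le_normcD. Qed.
Lemma cnB z w : cn (z - w) <= cn z + cn w. Proof. by rewrite -(cnN w) cnD. Qed.
Lemma cnBC z w : cn (z - w) = cn (w - z). Proof. by rewrite -cnN opprB. Qed.
Lemma cn_eq0 z : (cn z == 0) = (z == 0).
Proof. by rewrite -(inj_eq (@complexI R)) -cnE normr_eq0. Qed.
Lemma cn_gt0 z : (0 < cn z) = (z != 0).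
Proof. by rewrite lt_neqAle cn_ge0 andbT eq_sym cn_eq0. Qed.
Lemma cnX z n : cn (z ^+ n) = cn z ^+ n.
Proof. by elim: n => [|n IH]; rewrite ?cn1 // !exprS cnM IH. Qed.
Lemma cn_real (x : R) : cn x%:C = `|x|.
Proof. by rewrite /cn /= expr0n /= addr0 sqrtr_sqr. Qed.
Lemma cn_nat n : cn (n%:R) = n%:R.
Proof. by rewrite -(rmorph_nat (real_complex R)) cn_real normr_nat. Qed.
Lemma cn_i : cn 'i%C = 1 :> R.
Proof. by rewrite /cn /= expr0n expr1n /= add0r sqrtr1. Qed.
Lemma cn_Re z : `|complex.Re z| <= cn z.
Proof. by rewrite -lecR -cnE; apply: normc_ge_Re. Qed.
Lemma cn_Im z : `|complex.Im z| <= cn z.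
Proof.
rewrite -(normrN (complex.Im z)) -ReiNIm; apply: le_trans (cn_Re _) _.
by rewrite cnM cn_i mulr1.
Qed.
Lemma cn_le_ReIm z : cn z <= `|complex.Re z| + `|complex.Im z|.
Proof.
rewrite {1}(complexE z); apply: le_trans (cnD _ _) _.
by rewrite cnM cn_i mul1r !cn_real.
Qed.
Lemma cn_sum (I : Type) (r : seq I) (P : pred I) (F : I -> R[i]) :
  cn (\sum_(i <- r | P i) F i) <= \sum_(i <- r | P i) cn (F i).
Proof.
apply: (big_ind2 (fun x y => cn x <= y)) => //; first by rewrite cn0.
by move=> x1 x2 y1 y2 h1 h2; apply: le_trans (cnD _ _) (lerD h1 h2).
Qed.
Lemma cn_exprz z (m : int) : cn (z ^ m) = cn z ^ m.
Proof. by case: m => n; rewrite ?NegzE -?exprnP -?exprnN ?cnV cnX. Qed.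

(** Convergence in the complex plane, tested with real radii. *)
Lemma cvgcP {T : Type} (F : set_system T) {FF : Filter F} (f : T -> R[i]) (l : R[i]) :
  (f : T -> (R[i])^o) @ F --> (l : (R[i])^o) <->
  forall e : R, 0 < e -> \forall x \near F, cn (f x - l) < e.
Proof.
split=> [/cvgrPdist_lt H e e0|H].
  have e0' : (0 : R[i]) < e%:C by rewrite ltcR.
  near=> x; have : `|(l : (R[i])^o) - f x| < e%:C by near: x; apply: H.
  by rewrite cnE ltcR cnBC.
apply/cvgrPdist_lt => e e0.
have ee : e = (complex.Re e)%:C by rewrite RRe_real // gtr0_real.
have e0' : 0 < complex.Re e by rewrite -ltcR -ee.
near=> x; rewrite cnE ee ltcR cnBC; near: x; exact: H.
Unshelve. all: by end_near. Qed.

Lemma near_cP z (P : R[i] -> Prop) :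
  (\forall w \near (z : (R[i])^o), P w) <->
  exists2 dl : R, 0 < dl & forall w, cn (w - z) < dl -> P w.
Proof.
split=> [/(@nbhs_normP R[i] (R[i])^o) [dl /= dl0 H]|[dl dl0 H]].
  have dlE := RRe_real (gtr0_real dl0).
  exists (complex.Re dl) => [|w wz]; first by rewrite -ltcR dlE.
  by apply: H; rewrite /= cnE cnBC -dlE ltcR.
apply/(@nbhs_normP R[i] (R[i])^o); exists dl%:C => [|w /=]; first by rewrite /= ltcR.
by rewrite cnE cnBC ltcR; exact: H.
Qed.

Lemma cvg_atP (f : R[i] -> R[i]) z l :
  (f : (R[i])^o -> (R[i])^o) @ (z : (R[i])^o) --> (l : (R[i])^o) <->
  forall e : R, 0 < e -> exists2 dl : R, 0 < dl &
    forall w, cn (w - z) < dl -> cn (f w - l) < e.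
Proof.
split=> [/(@cvgcP _ (nbhs (z : (R[i])^o))) H e e0|H].
  exact/near_cP/H.
by apply/(@cvgcP _ (nbhs (z : (R[i])^o))) => e e0; apply/near_cP/H.
Qed.

End ComplexNorm.

(** * Integrals of complex-valued functions over a segment *)

Section ComplexIntegral.
Variable R : realType.
Implicit Types (a b c d : R) (g h : R -> R[i]) (z w : R[i]).

Local Notation mu := (@lebesgue_measure R).

(** An inductive wrapper keeps the definition from being unfolded when such
    side conditions are discharged by assumption. *)
Variant ccont a b g : Prop :=
  Ccont of forall x, a <= x <= b -> {for x, continuous (g : R -> (R[i])^o)}.

Lemma ccontP a b g : ccont a b g ->
  forall x, a <= x <= b -> {for x, continuous (g : R -> (R[i])^o)}.
Proof. by case. Qed.

(** The integrals in the definition of oint, over an arbitrary segment. *)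
Definition cint a b g : R[i] :=
  (\int[mu]_(x in `[a, b]) complex.Re (g x))%R +i*
  (\int[mu]_(x in `[a, b]) complex.Im (g x))%R.

Lemma ReB z w : complex.Re (z - w) = complex.Re z - complex.Re w.
Proof. by case: z w => [? ?] [? ?]. Qed.
Lemma ImB z w : complex.Im (z - w) = complex.Im z - complex.Im w.
Proof. by case: z w => [? ?] [? ?]. Qed.

Lemma lipschitz_cvg (p : R[i] -> R) (T : Type) (F : set_system T) (FF : Filter F)
    (f : T -> R[i]) (l : R[i]) : (forall z w, `|p z - p w| <= cn (z - w)) ->
  (f : T -> (R[i])^o) @ F --> (l : (R[i])^o) -> (fun t => p (f t)) @ F --> p l.
Proof.
move=> pL /cvgcP fl; apply/cvgrPdist_lt => e e0.
near=> x; rewrite distrC; apply: le_lt_trans (pL _ _) _.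
by near: x; apply: fl.
Unshelve. all: by end_near. Qed.

Lemma ReIm_cvg (T : Type) (F : set_system T) (FF : Filter F) (f : T -> R[i]) (l : R[i]) :
  (fun t => complex.Re (f t)) @ F --> complex.Re l ->
  (fun t => complex.Im (f t)) @ F --> complex.Im l ->
  (f : T -> (R[i])^o) @ F --> (l : (R[i])^o).
Proof.
move=> /cvgrPdist_lt Hr /cvgrPdist_lt Hi; apply/cvgcP => e e0.
have e2 : 0 < e / 2 by rewrite divr_gt0.
near=> x; apply: le_lt_trans (cn_le_ReIm _) _.
rewrite (splitr e); apply: ltrD.
  have : `|complex.Re l - complex.Re (f x)| < e / 2 by near: x; apply: Hr.
  by rewrite distrC ReB.
have : `|complex.Im l - complex.Im (f x)| < e / 2 by near: x; apply: Hi.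
by rewrite distrC ImB.
Unshelve. all: by end_near. Qed.

Lemma ccont_Re a b g : ccont a b g ->
  {within `[a, b], continuous (fun x => complex.Re (g x))}.
Proof.
move=> cg; apply: continuous_in_subspaceT => x; rewrite inE /= in_itv /= => xab.
apply: lipschitz_cvg (ccontP cg xab) => z w; rewrite -ReB; exact: cn_Re.
Qed.

Lemma ccont_Im a b g : ccont a b g ->
  {within `[a, b], continuous (fun x => complex.Im (g x))}.
Proof.
move=> cg; apply: continuous_in_subspaceT => x; rewrite inE /= in_itv /= => xab.
apply: lipschitz_cvg (ccontP cg xab) => z w; rewrite -ImB; exact: cn_Im.
Qed.

Lemma ccont_int_Re a b g : ccont a b g ->
  mu.-integrable `[a, b] (EFin \o (fun x => complex.Re (g x))).
Proof.
move=> cg; apply: continuous_compact_integrable; first exact: segment_compact.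
exact: ccont_Re.
Qed.

Lemma ccont_int_Im a b g : ccont a b g ->
  mu.-integrable `[a, b] (EFin \o (fun x => complex.Im (g x))).
Proof.
move=> cg; apply: continuous_compact_integrable; first exact: segment_compact.
exact: ccont_Im.
Qed.

Lemma ccontD a b g h : ccont a b g -> ccont a b h -> ccont a b (fun x => g x + h x).
Proof. by case=> cg [ch]; split=> x xab; apply: cvgD; [exact: cg|exact: ch]. Qed.
Lemma ccontB a b g h : ccont a b g -> ccont a b h -> ccont a b (fun x => g x - h x).
Proof. by case=> cg [ch]; split=> x xab; apply: cvgB; [exact: cg|exact: ch]. Qed.
Lemma ccontM a b g h : ccont a b g -> ccont a b h -> ccont a b (fun x => g x * h x).
Proof. by case=> cg [ch]; split=> x xab; apply: cvgM; [exact: cg|exact: ch]. Qed.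
Lemma ccont_cst a b z : ccont a b (fun=> z).
Proof. by split=> x xab; apply: cvg_cst. Qed.
Lemma ccontV a b g : ccont a b g -> (forall x, a <= x <= b -> g x != 0) ->
  ccont a b (fun x => (g x)^-1).
Proof. by case=> cg g0; split=> x xab; apply: cvgV; [exact: g0|exact: cg]. Qed.
Lemma ccont_sum a b (I : Type) (r : seq I) (F : I -> R -> R[i]) :
  (forall i, ccont a b (F i)) -> ccont a b (fun x => \sum_(i <- r) F i x).
Proof.
move=> cF; elim: r => [|i r IH].
  rewrite (_ : (fun _ => _) = fun=> 0); first exact: ccont_cst.
  by apply/funext => x; rewrite big_nil.
rewrite (_ : (fun _ => _) = fun x => F i x + \sum_(j <- r) F j x).
  exact: (ccontD (cF i) IH).
by apply/funext => x; rewrite big_cons.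
Qed.
Lemma ccont_sub a b c d g : a <= c -> d <= b -> ccont a b g -> ccont c d g.
Proof.
move=> ac db [cg]; split=> x /andP[cx xd]; apply: cg.
by rewrite (le_trans ac cx) (le_trans xd db).
Qed.

Lemma eq_cint a b g h : (forall x, a <= x <= b -> g x = h x) -> cint a b g = cint a b h.
Proof.
move=> gh; congr (_ +i* _); apply: eq_Rintegral => x;
  by rewrite inE /= in_itv /= => /gh ->.
Qed.

Lemma cintD a b g h : ccont a b g -> ccont a b h ->
  cint a b (fun x => g x + h x) = cint a b g + cint a b h.
Proof.
move=> cg ch; rewrite /cint.
have -> : forall x1 x2 y1 y2 : R, (x1 +i* y1) + (x2 +i* y2) = (x1 + x2) +i* (y1 + y2).
  by [].
congr (_ +i* _); rewrite -RintegralD //.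
- by apply: eq_Rintegral => x _; case: (g x) (h x) => [? ?] [? ?].
- exact: ccont_int_Re.
- exact: ccont_int_Re.
- by apply: eq_Rintegral => x _; case: (g x) (h x) => [? ?] [? ?].
- exact: ccont_int_Im.
- exact: ccont_int_Im.
Qed.

Lemma cintZ a b z g : ccont a b g -> cint a b (fun x => z * g x) = z * cint a b g.
Proof.
move=> cg; case: z => u v; rewrite /cint /=.
have iR := ccont_int_Re cg; have iI := ccont_int_Im cg.
have mab : measurable (`[a, b]%classic : set R) by [].
have Z r f : mu.-integrable `[a, b] (EFin \o f) ->
    mu.-integrable `[a, b] (EFin \o (fun x => r * f x)).
  move=> fi; rewrite (_ : _ \o _ = (fun x => (r%:E * (f x)%:E)%E)); last first.
    by apply/funext => x; rewrite /= EFinM.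
  exact: integrableZl.
have -> : forall x y x' y' : R,
  (x +i* y) * (x' +i* y') = (x * x' - y * y') +i* (x * y' + y * x') by [].
congr (_ +i* _).
  transitivity (\int[mu]_(x in `[a, b]) (u * complex.Re (g x) - v * complex.Im (g x)))%R.
    by apply: eq_Rintegral => x _; case: (g x).
  by rewrite RintegralB ?RintegralZl //; exact: Z.
transitivity (\int[mu]_(x in `[a, b]) (u * complex.Im (g x) + v * complex.Re (g x)))%R.
  by apply: eq_Rintegral => x _; case: (g x).
by rewrite RintegralD ?RintegralZl //; exact: Z.
Qed.

Lemma cintB a b g h : ccont a b g -> ccont a b h ->
  cint a b (fun x => g x - h x) = cint a b g - cint a b h.
Proof.
move=> cg ch; transitivity (cint a b (fun x => g x + (-1) * h x)).
  by apply: eq_cint => x _; rewrite mulN1r.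
have ch' : ccont a b (fun x => -1 * h x) by apply: ccontM ch; exact: ccont_cst.
by rewrite (cintD cg ch') (cintZ _ ch) mulN1r.
Qed.

(** The factor 2 comes from estimating the real and the imaginary part
    separately. *)
Lemma cint_le a b g M : a <= b -> ccont a b g ->
  (forall x, a <= x <= b -> cn (g x) <= M) -> cn (cint a b g) <= 2 * M * (b - a).
Proof.
move=> ab cg gM; apply: le_trans (cn_le_ReIm _) _ => /=.
have mab : measurable (`[a, b]%classic : set R) by [].
have fab : fine (mu `[a, b]) = b - a.
  rewrite lebesgue_measure_itv /= lte_fin; move: ab.
  by rewrite le_eqVlt => /predU1P[->|->]; rewrite ?ltxx ?subrr.
have icst : mu.-integrable `[a, b] (EFin \o (cst M : R -> R)).
  apply: continuous_compact_integrable; first exact: segment_compact.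
  by apply: continuous_subspaceT => x; exact: cvg_cst.
have H f : mu.-integrable `[a, b] (EFin \o f) -> 
    (forall x, a <= x <= b -> `|f x| <= M) ->
    `|\int[mu]_(x in `[a, b]) f x|%R <= M * (b - a).
  move=> fi fM; apply: (@le_trans _ _ (\int[mu]_(x in `[a, b]) `|f x|)%R).
    exact: le_normr_Rintegral.
  rewrite -fab -(Rintegral_cst mu) //; apply: le_Rintegral => //.
  exact: integrable_norm.
have -> : 2 * M * (b - a) = M * (b - a) + M * (b - a) by ring.
apply: lerD; apply: H.
- exact: ccont_int_Re.
- by move=> x xab; apply: le_trans (cn_Re _) (gM _ xab).
- exact: ccont_int_Im.
- by move=> x xab; apply: le_trans (cn_Im _) (gM _ xab).
Qed.

Lemma cint_cat a b c g : a <= b <= c -> ccont a c g ->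
  cint a c g = cint a b g + cint b c g.
Proof.
move=> /andP[ab bc] cg.
have H f : mu.-integrable `[a, c] (EFin \o f) ->
   (\int[mu]_(x in `[a, c]) f x = \int[mu]_(x in `[a, b]) f x +
    \int[mu]_(x in `[b, c]) f x)%R.
  move=> fi; apply/eqP; rewrite addrC -subr_eq; apply/eqP.
  rewrite Rintegral_itvB // ?bnd_simp ?(ltW _) //.
  apply: Rintegral_itv_obnd_cbnd.
  apply: integrableS fi => // x /=; rewrite !in_itv /= => /andP[bx ->].
  by rewrite (le_trans ab (ltW bx)).
have -> : forall x1 x2 y1 y2 : R, (x1 +i* y1) + (x2 +i* y2) = (x1 + x2) +i* (y1 + y2).
  by [].
congr (_ +i* _); apply: H.
  exact: ccont_int_Re.
exact: ccont_int_Im.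
Qed.

Lemma cint_FTC a b g (F : R -> R[i]) : a <= b -> ccont a b g ->
  (forall x : R, is_derive x 1 (fun y : R => complex.Re (F y)) (complex.Re (g x))) ->
  (forall x : R, is_derive x 1 (fun y : R => complex.Im (F y)) (complex.Im (g x))) ->
  cint a b g = F b - F a.
Proof.
move=> ab cg FR FI.
have H (f G : R -> R) : {within `[a, b], continuous f} ->
    (forall x : R, is_derive x 1 G (f x)) -> (\int[mu]_(x in `[a, b]) f x = G b - G a)%R.
  move=> cf dG; move: ab; rewrite le_eqVlt => /predU1P[<-|ab].
    by rewrite set_itv1 Rintegral_set1 subrr.
  rewrite /Rintegral (continuous_FTC2 ab cf (F := G)) //.
  - have cG x : {for x, continuous G}.
      apply: differentiable_continuous; apply/derivable1_diffP.
      by case: (dG x).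
    split => [x _||]; first by case: (dG x).
    + exact/cvg_at_right_filter/cG.
    + exact/cvg_at_left_filter/cG.
  - by move=> x _; rewrite derive1E; apply: derive_val.
rewrite /cint (H _ _ (ccont_Re cg) FR) (H _ _ (ccont_Im cg) FI).
by case: (F a) (F b) => [? ?] [? ?].
Qed.

Lemma ccont_bounded a b g : a <= b -> ccont a b g ->
  exists2 M, 0 <= M & forall x, a <= x <= b -> cn (g x) <= M.
Proof.
move=> ab cg.
have c : {within `[a, b], continuous (fun x => cn (g x))}.
  apply: continuous_in_subspaceT => x; rewrite inE /= in_itv /= => xab.
  apply: lipschitz_cvg (ccontP cg xab) => z w.
  have h1 := cnD (z - w) w; have h2 := cnD (w - z) z; rewrite !subrK (cnBC w) in h1 h2.
  by rewrite ler_norml; lra.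
have [x0 _ H] := EVT_max ab c.
exists (cn (g x0)); first exact: cn_ge0.
by move=> x xab; apply: H; rewrite in_itv.
Qed.

End ComplexIntegral.

(** * The complex exponential and the unit circle *)

Section CircleExp.
Variable R : realType.
Implicit Types (x y : R) (z w : R[i]) (m k : int).

Definition circ x : R[i] := cos x +i* sin x.

Lemma circD x y : circ (x + y) = circ x * circ y.
Proof.
by rewrite /circ cosD sinD; apply/eqP; rewrite eq_complex /= eqxx /= addrC.
Qed.
Lemma circ0 : circ 0 = 1. Proof. by rewrite /circ cos0 sin0. Qed.
Lemma circ2pi : circ (2 * pi) = 1.
Proof. by rewrite mulrC mulr_natr /circ cos2pi sin2pi. Qed.
Lemma cn_circ x : cn (circ x) = 1.
Proof. by rewrite /cn /= cos2Dsin2 sqrtr1. Qed.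
Lemma circ_neq0 x : circ x != 0.
Proof. by rewrite -cn_gt0 cn_circ. Qed.
Lemma circ_expn x (n : nat) : circ x ^+ n = circ (n%:R * x).
Proof.
elim: n => [|n IH]; first by rewrite mul0r circ0.
by rewrite exprS IH -circD -[n.+1]add1n natrD mulrDl mul1r.
Qed.
Lemma circN x : circ (- x) = (circ x)^-1.
Proof.
by apply: (mulIf (circ_neq0 x)); rewrite mulVf ?circ_neq0 // -circD addNr circ0.
Qed.
Lemma circ_exprz x m : circ x ^ m = circ (m%:~R * x).
Proof.
case: m => n; first by rewrite -exprnP circ_expn.
by rewrite NegzE -exprnN circ_expn -circN mulrNz mulNr.
Qed.

Lemma cexpE z : cexp z = (expR (complex.Re z))%:C * circ (complex.Im z).
Proof. by []. Qed.
Lemma cexp0 : cexp (0 : R[i]) = 1.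
Proof. by rewrite cexpE /= expR0 circ0 mul1r. Qed.
Lemma cexpD z w : cexp (z + w) = cexp z * cexp w.
Proof.
rewrite !cexpE; case: z w => [a b] [c d] /=.
by rewrite expRD circD rmorphM /=; ring.
Qed.
Lemma cexp_neq0 z : cexp z != 0.
Proof.
by rewrite cexpE mulf_neq0 ?circ_neq0 // -cn_gt0 cn_real normr_gt0 gt_eqF ?expR_gt0.
Qed.
Lemma cexpN z : cexp (- z) = (cexp z)^-1.
Proof.
by apply: (mulIf (cexp_neq0 z)); rewrite mulVf ?cexp_neq0 // -cexpD addNr cexp0.
Qed.
Lemma cn_cexp z : cn (cexp z) = expR (complex.Re z).
Proof. by rewrite cexpE cnM cn_circ mulr1 cn_real gtr0_norm // expR_gt0. Qed.
Lemma circE x : circ x = cexp (0 +i* x).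
Proof. by rewrite cexpE /= expR0 mul1r. Qed.

Lemma circ_cvg x : (circ : R -> (R[i])^o) @ x --> (circ x : (R[i])^o).
Proof.
apply: ReIm_cvg => /=.
  by apply: (continuous_comp (f := id)) => //; exact: continuous_cos.
by apply: (continuous_comp (f := id)) => //; exact: continuous_sin.
Qed.

(** Continuity along the unit circle only: the integrands met below may have
    poles off the circle. The wrapper has the same purpose as in ccont. *)
Variant ccirc (g : R[i] -> R[i]) : Prop :=
  Ccirc of forall a b, ccont a b (fun x => g (circ x)).

Lemma ccircP g : ccirc g -> forall a b, ccont a b (fun x => g (circ x)).
Proof. by case. Qed.

Lemma ccirc_eq g h : (forall x, g (circ x) = h (circ x)) -> ccirc g -> ccirc h.
Proof.
move=> gh [cg]; split=> a b; rewrite (_ : (fun x => _) = (fun x => g (circ x))) //.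
by apply/funext => x; rewrite gh.
Qed.
Lemma ccirc_id : ccirc id.
Proof. by split=> a b; split=> x _; exact: circ_cvg. Qed.
Lemma ccirc_cst z : ccirc (fun=> z).
Proof. by split=> a b; exact: ccont_cst. Qed.
Lemma ccircD g h : ccirc g -> ccirc h -> ccirc (fun z => g z + h z).
Proof. by case=> cg [ch]; split=> a b; exact: (ccontD (cg a b) (ch a b)). Qed.
Lemma ccircB g h : ccirc g -> ccirc h -> ccirc (fun z => g z - h z).
Proof. by case=> cg [ch]; split=> a b; exact: (ccontB (cg a b) (ch a b)). Qed.
Lemma ccircM g h : ccirc g -> ccirc h -> ccirc (fun z => g z * h z).
Proof. by case=> cg [ch]; split=> a b; exact: (ccontM (cg a b) (ch a b)). Qed.
Lemma ccircV g : ccirc g -> (forall x, g (circ x) != 0) -> ccirc (fun z => (g z)^-1).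
Proof. by case=> cg g0; split=> a b; apply: (ccontV (cg a b)) => x _; exact: g0. Qed.
Lemma ccirc_exprz m : ccirc (fun z => z ^ m).
Proof.
have H (n : nat) : ccirc (fun z => z ^+ n).
  elim: n => [|n IH]; first exact: ccirc_cst.
  apply: (ccirc_eq _ (ccircM ccirc_id IH)) => x; by rewrite exprS.
case: m => n; first exact: H.
apply: (ccirc_eq _ (ccircV (H n.+1) _)) => x.
  by rewrite NegzE -exprnN.
by rewrite expf_neq0 // circ_neq0.
Qed.
Lemma ccirc_sum (I : Type) (r : seq I) (F : I -> R[i] -> R[i]) :
  (forall i, ccirc (F i)) -> ccirc (fun z => \sum_(i <- r) F i z).
Proof. by move=> cF; split=> a b; exact: (ccont_sum r (fun i => ccircP (cF i) a b)). Qed.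

Lemma pi2_gt0 : 0 < 2 * pi :> R.
Proof. by rewrite mulr_gt0 // pi_gt0. Qed.

(** Reduces bounds on the circle to a compact range of angles. *)
Lemma circ_2pi_range x : exists2 y, 0 <= y <= 2 * pi & circ x = circ y.
Proof.
have p0 := pi2_gt0; pose k := Num.floor (x / (2 * pi)).
exists (x - k%:~R * (2 * pi)).
  have := floor_itv (x / (2 * pi)); rewrite -/k => /andP[k1 k2].
  rewrite subr_ge0 -ler_pdivlMr // k1 /= lerBlDr.
  move: k2; rewrite intrD ltr_pdivrMr // mulrDl mul1r addrC => /ltW.
  by [].
rewrite circD -mulNr -mulrNz -circ_exprz circ2pi exp1rz mulr1.
by [].
Qed.

Lemma ccirc_bounded g : ccirc g -> exists2 M, 0 <= M & forall x, cn (g (circ x)) <= M.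
Proof.
move=> cg; have [M M0 gM] := ccont_bounded (ltW pi2_gt0) (ccircP cg 0 (2 * pi)).
by exists M => // x; have [y yb ->] := circ_2pi_range x; exact: gM.
Qed.

Lemma ointE g : oint g = cint 0 (2 * pi) (fun x => g (circ x) * ('i%C * circ x)).
Proof. by []. Qed.

Lemma pi2_neq0 : (2 * pi)%:C != 0 :> R[i].
Proof. by rewrite -cn_gt0 cn_real normr_gt0 gt_eqF // pi2_gt0. Qed.

Lemma ci_neq0 : 'i%C != 0 :> R[i].
Proof. by rewrite -cn_gt0 cn_i. Qed.

Lemma twoipiE : 2 * 'i%C * pi%:C = (2 * pi)%:C * 'i%C :> R[i].
Proof. by rewrite rmorphM /= rmorph_nat mulrAC. Qed.

Lemma fourierE g m : ccirc g ->
  fourier g m = ((2 * pi)%:C)^-1 * cint 0 (2 * pi) (fun x => g (circ x) * circ x ^ (- m)).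
Proof.
move=> cg; rewrite /fourier ointE twoipiE.
have c1 : ccont 0 (2 * pi) (fun x => g (circ x) * circ x ^ (- m)).
  exact: ccontM (ccircP cg 0 (2 * pi)) (ccircP (ccirc_exprz (- m)) 0 (2 * pi)).
rewrite (@eq_cint _ _ _ _ (fun x => 'i%C * (g (circ x) * circ x ^ (- m)))).
  rewrite (cintZ _ c1) invfM; have := ci_neq0; move: (cint _ _ _) => I i0.
  by rewrite mulrC mulrA -(mulrA _ _ 'i%C) mulVf // mulr1.
move=> x _; have c0 := circ_neq0 x; rewrite expfzDr // expr1z -invr_expz.
by field; rewrite c0 expfz_neq0.
Qed.

Lemma cint_circ m : cint 0 (2 * pi) (fun x => circ x ^ m) = if m == 0 then (2 * pi)%:C else 0.
Proof.
have cc : ccont 0 (2 * pi) (fun x => circ x ^ m) by exact: (ccircP (ccirc_exprz m)).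
have [m0|m0] := eqVneq m 0.
  transitivity ((2 * pi)%:C - 0%:C : R[i]); last by rewrite subr0.
  apply: (@cint_FTC _ _ _ _ (fun x => x%:C) (ltW pi2_gt0) cc).
  - by move=> x; rewrite m0 expr0z /=; exact: is_derive_id.
  - by move=> x; rewrite m0 expr0z /=; exact: is_derive_cst.
pose k : R := m%:~R; have k0 : k != 0 by rewrite intr_eq0.
pose F x := (k^-1 * sin (k * x)) +i* (- (k^-1 * cos (k * x))).
transitivity (F (2 * pi) - F 0); last first.
  have := circ_exprz (2 * pi) m; rewrite circ2pi exp1rz -/k.
  by rewrite /circ /F => -[<- <-]; rewrite !mulr0 cos0 sin0 mulr0 subrr.
apply: (cint_FTC (F := F) (ltW pi2_gt0) cc).
- move=> x; rewrite circ_exprz -/k /=.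
  have H : is_derive x 1 (k^-1 \*: (sin \o (k \*: id)) : R -> R)
      (k^-1 *: (cos (k *: x) * (k *: 1))).
    by apply: is_deriveZ; apply: is_derive1_comp.
  by apply: is_derive_eq H _; rewrite /GRing.scale /= mulr1 mulrCA mulVf // mulr1.
- move=> x; rewrite circ_exprz -/k /=.
  have H : is_derive x 1 (- (k^-1 \*: (cos \o (k \*: id))) : R -> R)
      (- (k^-1 *: (- sin (k *: x) * (k *: 1)))).
    by apply: is_deriveN; apply: is_deriveZ; apply: is_derive1_comp.
  apply: is_derive_eq H _; rewrite /GRing.scale /= mulr1 mulNr mulrN opprK.
  by rewrite mulrCA mulVf // mulr1.
Qed.

End CircleExp.

(** * Fourier coefficients *)

Section FourierCoefficients.
Variable R : realType.
Implicit Types (x y : R) (z w : R[i]) (m k : int) (f g h : R[i] -> R[i]).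

Lemma eq_fourier g h m : (forall x, g (circ x) = h (circ x)) -> fourier g m = fourier h m.
Proof.
by move=> gh; rewrite /fourier !ointE; congr (_ / _); apply: eq_cint => x _; rewrite gh.
Qed.

Let ccir g m : ccirc g -> ccont 0 (2 * pi) (fun x => g (circ x) * circ x ^ (- m)).
Proof.
move=> cg.
exact: (ccontM (ccircP cg 0 (2 * pi)) (ccircP (@ccirc_exprz R (- m)) 0 (2 * pi))).
Qed.

Lemma fourierD g h m : ccirc g -> ccirc h ->
  fourier (fun z => g z + h z) m = fourier g m + fourier h m.
Proof.
move=> cg ch; rewrite !fourierE //; last exact: ccircD.
rewrite -mulrDr -(cintD (ccir _ cg) (ccir _ ch)); congr (_ * _).
by apply: eq_cint => x _; rewrite mulrDl.
Qed.

Lemma fourierB g h m : ccirc g -> ccirc h ->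
  fourier (fun z => g z - h z) m = fourier g m - fourier h m.
Proof.
move=> cg ch; rewrite !fourierE //; last exact: ccircB.
rewrite -mulrBr -(cintB (ccir _ cg) (ccir _ ch)); congr (_ * _).
by apply: eq_cint => x _; rewrite mulrBl.
Qed.

Lemma fourierZ g w m : ccirc g -> fourier (fun z => w * g z) m = w * fourier g m.
Proof.
move=> cg; rewrite !fourierE //; last by apply: ccircM cg; exact: ccirc_cst.
rewrite [RHS]mulrCA -(cintZ _ (ccir _ cg)); congr (_ * _).
by apply: eq_cint => x _; rewrite mulrA.
Qed.

Lemma fourier_exprz k m : fourier (fun z => z ^ k) m = (k == m)%:R :> R[i].
Proof.
rewrite fourierE; last exact: ccirc_exprz.
transitivity (((2 * pi)%:C)^-1 * cint 0 (2 * pi) (fun x => circ x ^ (k - m)) : R[i]).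
  congr (_ * _); apply: eq_cint => x _.
  by rewrite -expfzDr ?circ_neq0.
rewrite cint_circ subr_eq0; case: eqP => _; last by rewrite mulr0.
by rewrite mulVf // pi2_neq0.
Qed.

Lemma fourier_cst w m : fourier (fun=> w) m = w * (m == 0)%:R :> R[i].
Proof.
rewrite [m == 0]eq_sym -(fourier_exprz 0) -fourierZ; last exact: ccirc_exprz.
by apply: eq_fourier => x; rewrite expr0z mulr1.
Qed.

Lemma fourier_shift g k m : ccirc g -> fourier (fun z => g z * z ^ k) m = fourier g (m - k).
Proof.
move=> cg; rewrite !fourierE //; last by apply: ccircM cg _; exact: ccirc_exprz.
congr (_ * _); apply: eq_cint => x _.
by rewrite -mulrA -expfzDr ?circ_neq0 // opprB addrC.
Qed.

Lemma fourier_sum (I : Type) (r : seq I) (F : I -> R[i] -> R[i]) m :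
  (forall i, ccirc (F i)) ->
  fourier (fun z => \sum_(i <- r) F i z) m = \sum_(i <- r) fourier (F i) m.
Proof.
move=> cF; elim: r => [|i r IH].
  rewrite big_nil -[RHS](mul0r (m == 0)%:R) -fourier_cst.
  by apply: eq_fourier => x; rewrite big_nil.
rewrite big_cons -IH -(fourierD _ (cF i) (ccirc_sum r cF)).
by apply: eq_fourier => x; rewrite big_cons.
Qed.

Lemma fourier_le g m M : ccirc g -> (forall x, cn (g (circ x)) <= M) ->
  cn (fourier g m) <= 2 * M.
Proof.
move=> cg gM; rewrite fourierE // cnM cnV cn_real gtr0_norm ?pi2_gt0 //.
rewrite mulrC ler_pdivrMr ?pi2_gt0 //.
apply: le_trans (@cint_le _ _ _ _ M (ltW (@pi2_gt0 R)) (ccir _ cg) _) _.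
  by move=> x _; rewrite cnM cn_exprz cn_circ exp1rz mulr1.
by rewrite subr0.
Qed.

(** Multiplying by a function that is the sum of a power series up to an error
    E turns into the corresponding finite convolution up to a multiple of E. *)
Lemma fourier_mul_expand f g (v : nat -> R[i]) (s : int) (M : nat) (B E : R) m :
  ccirc f -> ccirc g -> (forall x, cn (f (circ x)) <= B) ->
  (forall x, cn (g (circ x) - \sum_(i < M) v i * circ x ^ (s * i%:Z)) <= E) ->
  cn (fourier (fun z => f z * g z) m - \sum_(i < M) v i * fourier f (m - s * i%:Z))
    <= 2 * (B * E).
Proof.
move=> cf cg fB gE.
have ci (i : 'I_M) : ccirc (fun z => v i * (f z * z ^ (s * i%:Z))).
  by apply: ccircM (ccircM cf (@ccirc_exprz R _)); exact: ccirc_cst.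
have -> : \sum_(i < M) v i * fourier f (m - s * i%:Z) =
    fourier (fun z => \sum_(i < M) v i * (f z * z ^ (s * i%:Z))) m.
  rewrite fourier_sum //; apply: eq_bigr => i _.
  rewrite fourierZ ?fourier_shift //.
  exact: ccircM cf (@ccirc_exprz R _).
rewrite -fourierB; [|exact: ccircM|exact: ccirc_sum].
apply: fourier_le.
  by apply: ccircB; [exact: ccircM|exact: ccirc_sum].
move=> x; under eq_bigr do rewrite mulrCA.
rewrite -mulr_sumr -mulrBr cnM; apply: ler_pM; rewrite ?cn_ge0 //.
Qed.

Definition cj z : R[i] := conjc z.
Lemma cjB z w : cj (z - w) = cj z - cj w. Proof. exact: rmorphB. Qed.
Lemma cjM z w : cj (z * w) = cj z * cj w. Proof. exact: rmorphM. Qed.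
Lemma cjXz z m : cj (z ^ m) = cj z ^ m. Proof. exact: fmorphXz. Qed.

Lemma cint_conj a b (g : R -> R[i]) : ccont a b g ->
  cint a b (fun x => cj (g x)) = cj (cint a b g).
Proof.
move=> cg; rewrite /cint /=; congr (_ +i* _).
  by apply: eq_Rintegral => x _; case: (g x).
rewrite -mulN1r -RintegralZl //; last exact: ccont_int_Im.
by apply: eq_Rintegral => x _; rewrite mulN1r; case: (g x).
Qed.

Lemma cnJ z : cn (cj z) = cn z.
Proof. by apply: complexI; rewrite -!cnE normcJ. Qed.

Lemma conj_cvg (T : Type) (F : set_system T) (FF : Filter F) (f : T -> R[i]) (l : R[i]) :
  (f : T -> (R[i])^o) @ F --> (l : (R[i])^o) ->
  ((fun t => cj (f t)) : T -> (R[i])^o) @ F --> (cj l : (R[i])^o).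
Proof.
move=> /cvgcP fl; apply/cvgcP => e e0.
apply: filterS (fl e e0) => t.
by rewrite -cjB cnJ.
Qed.

Lemma circJ x : cj (circ x) = (circ x)^-1.
Proof. by rewrite -circN /circ /cj /= cosN sinN. Qed.

Lemma mulcJ_cn z : z * cj z = (cn z ^+ 2)%:C.
Proof. by rewrite /cj -sqr_normc cnE rmorphXn. Qed.

Definition energy g : R := \int[lebesgue_measure]_(x in `[0, 2 * pi]) (cn (g (circ x)) ^+ 2).

Lemma energy_ge0 g : 0 <= energy g.
Proof. by apply: Rintegral_ge0 => x _; rewrite exprn_ge0 // cn_ge0. Qed.

Lemma energyE g : (energy g)%:C = cint 0 (2 * pi) (fun x => g (circ x) * cj (g (circ x))).
Proof.
rewrite /cint; congr (_ +i* _).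
  by apply: eq_Rintegral => x _; rewrite mulcJ_cn.
transitivity (\int[lebesgue_measure]_(x in `[0%R, (2 * pi)%R]) (0 : R))%R.
  by rewrite Rintegral_cst // mul0r.
by apply: eq_Rintegral => x _; rewrite mulcJ_cn.
Qed.

(** Removing one Fourier mode lowers the energy by the squared modulus of its
    coefficient. *)
Lemma energy_sub g m : ccirc g ->
  energy (fun z => g z - fourier g m * z ^ m) = energy g - 2 * pi * cn (fourier g m) ^+ 2.
Proof.
move=> cg; apply: complexI; set d := fourier g m.
have -> : (energy g - 2 * pi * cn d ^+ 2)%:C =
    (energy g)%:C - (2 * pi)%:C * (d * cj d) :> R[i].
  by rewrite mulcJ_cn -rmorphM -rmorphB.
rewrite !energyE.
have Hd : cint 0 (2 * pi) (fun x => g (circ x) * circ x ^ (- m)) = (2 * pi)%:C * d.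
  by rewrite /d fourierE // mulrA mulfV ?mul1r // pi2_neq0.
clearbody d; have c1 := ccir m cg.
have c2 : ccont 0 (2 * pi) (fun x => cj (g (circ x) * circ x ^ (- m))).
  by split=> x xab; apply: conj_cvg; exact: (ccontP c1).
have c3 : ccont 0 (2 * pi) (fun x => g (circ x) * cj (g (circ x))).
  have [cg'] := ccircP cg 0 (2 * pi).
  split=> x xab; apply: cvgM; first exact: cg'.
  apply: conj_cvg; exact: cg'.
have c4 : ccont 0 (2 * pi) (fun x => cj d * (g (circ x) * circ x ^ (- m))).
  exact: ccontM (@ccont_cst _ _ _ _) c1.
have c5 : ccont 0 (2 * pi) (fun x => d * cj (g (circ x) * circ x ^ (- m))).
  exact: ccontM (@ccont_cst _ _ _ _) c2.
have c6 : ccont 0 (2 * pi) (fun x => (d * cj d) * circ x ^ 0).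
  exact: ccontM (@ccont_cst _ _ _ _) (ccircP (@ccirc_exprz R _) _ _).
transitivity (cint 0 (2 * pi) (fun x => (g (circ x) * cj (g (circ x)) -
   cj d * (g (circ x) * circ x ^ (- m))) - (d * cj (g (circ x) * circ x ^ (- m)) -
   (d * cj d) * circ x ^ 0))).
  apply: eq_cint => x _; rewrite expr0z mulr1 cjB !cjM !cjXz circJ !exprz_inv opprK.
  have H : circ x ^ m * circ x ^ (- m) = 1.
    by rewrite -expfzDr ?circ_neq0 // subrr expr0z.
  set e := circ x ^ m in H *; set e' := circ x ^ (- m) in H *.
  set G := g _; set G' := cj G; set d' := cj d.
  transitivity (G * G' - d' * (G * e') - (d * (G' * e) - d * d' * (e * e'))).
    by ring.
  by rewrite H mulr1.
rewrite (cintB (ccontB c3 c4) (ccontB c5 c6)) (cintB c3 c4) (cintB c5 c6).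
rewrite (cintZ _ c1) (cintZ _ c2) (cint_conj c1) Hd (cintZ _ (ccircP (@ccirc_exprz R _) _ _)).
have -> : cj ((2 * pi)%:C * d) = (2 * pi)%:C * cj d by rewrite cjM /cj conjc_real.
rewrite cint_circ eqxx; ring.
Qed.

Lemma fourier_sub_monom g m k : ccirc g -> k != m ->
  fourier (fun z => g z - fourier g m * z ^ m) k = fourier g k.
Proof.
move=> cg km; have cm := @ccirc_exprz R m.
rewrite fourierB //; last exact: ccircM (@ccirc_cst _ _) cm.
by rewrite fourierZ // fourier_exprz eq_sym (negbTE km) mulr0 subr0.
Qed.

(** The modes are removed one at a time, which leaves a nonnegative energy. *)
Lemma bessel g (s : seq int) : ccirc g -> uniq s ->
  2 * pi * \sum_(m <- s) cn (fourier g m) ^+ 2 <= energy g.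
Proof.
elim: s g => [|m s IH] g cg /=; first by rewrite big_nil mulr0 energy_ge0.
case/andP => ms us; rewrite big_cons mulrDr -lerBrDl -energy_sub //.
have cg' : ccirc (fun z => g z - fourier g m * z ^ m).
  apply: ccircB cg _; exact: ccircM (@ccirc_cst _ _) (@ccirc_exprz R m).
apply: le_trans (IH _ cg' us); rewrite ler_pM2l ?pi2_gt0 // le_eqVlt; apply/orP; left.
apply/eqP/eq_big_seq => k ks; rewrite fourier_sub_monom //.
by apply: contraNneq ms => <-.
Qed.

(** By Bessel's inequality, the squared moduli are summable. *)
Lemma riemann_lebesgue g (s : nat -> int) : ccirc g -> injective s ->
  (fun n => cn (fourier g (s n))) @ \oo --> 0.
Proof.
move=> cg sI; pose u n := cn (fourier g (s n)) ^+ 2.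
have cu : cvgn (series u).
  apply: nondecreasing_is_cvgn.
    apply/nondecreasing_seqP => n; rewrite /series /= big_nat_recr //= lerDl.
    by rewrite exprn_ge0 // cn_ge0.
  exists (energy g / (2 * pi)) => _ [n _ <-].
  rewrite ler_pdivlMr ?pi2_gt0 // mulrC.
  have us : uniq [seq s i | i <- iota 0 n] by rewrite map_inj_uniq ?iota_uniq.
  by have := bessel cg us; rewrite big_map /series /= /index_iota subn0.
have /cvgrPdist_lt u0 := cvg_series_cvg_0 cu.
apply/cvgrPdist_lt => e e0; have := u0 (e ^+ 2) (exprn_gt0 _ e0).
apply: filterS => n; rewrite !sub0r !normrN /u normrX.
by rewrite ltr_pXn2r ?nnegrE ?normr_ge0 // ltW.
Qed.

Lemma geo_sum_le (r : R) (M K : nat) : 0 <= r -> r < 1 ->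
  \sum_(M <= n < K) r ^+ n <= r ^+ M / (1 - r).
Proof.
move=> r0 r1; have q0 : 0 < 1 - r by rewrite subr_gt0.
rewrite ler_pdivlMr //; case: (leqP M K) => MK; last first.
  by rewrite big_geq ?(ltnW MK) // mul0r exprn_ge0.
suff -> : (\sum_(M <= n < K) r ^+ n) * (1 - r) = r ^+ M - r ^+ K.
  by rewrite lerBlDr lerDl exprn_ge0.
rewrite mulr_suml -[RHS]opprB -telescope_sumr // -sumrN.
by apply: eq_bigr => i _; rewrite mulrBr mulr1 -exprSr opprB.
Qed.

End FourierCoefficients.



(** * Pointwise convergence of Fourier series *)

Section Inversion.
Variable R : realType.
Implicit Types (x y : R) (z w : R[i]) (m k : int) (f g h : R[i] -> R[i]).

(** Convergence of the Fourier series at a point w of the circle where the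
    difference quotient q is continuous: multiplication by z - w telescopes the
    coefficients, and those of q tend to 0. *)
Lemma fourier_inversion (G q : R[i] -> R[i]) w (C r : R) :
  ccirc G -> ccirc q -> (forall x, (circ x - w) * q (circ x) = G (circ x) - G w) ->
  cn w = 1 -> 0 <= C -> 0 <= r -> r < 1 ->
  (forall n : nat, cn (fourier G n%:Z) <= C * r ^+ n) ->
  (forall n : nat, cn (fourier G (- n.+1%:Z)) <= C * r ^+ n) ->
  forall M : nat, cn (G w - \sum_(n < M) (fourier G n%:Z * w ^ n%:Z +
     fourier G (- n.+1%:Z) * w ^ (- n.+1%:Z))) <= 2 * C / (1 - r) * r ^+ M.
Proof.
move=> cG cq Gq w1 C0 r0 r1 Vp Vm M.
have wn0 : w != 0 by rewrite -cn_gt0 w1.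
have cwz (m : int) : cn (w ^ m) = 1 by rewrite cn_exprz w1 exp1rz.
pose t n := fourier G n%:Z * w ^ n%:Z + fourier G (- n.+1%:Z) * w ^ (- n.+1%:Z).
have cG' : ccirc (fun z => G z - G w) by apply: ccircB cG (@ccirc_cst _ _).
(* The relation (z - w) q = G - G w in terms of coefficients. *)
have Vd m : fourier G m - G w * (m == 0)%:R = fourier q (m - 1) - w * fourier q m.
  rewrite -fourier_cst -(fourierB _ cG (@ccirc_cst _ _)).
  rewrite -{1}(expr1z w) in Gq *.
  have cq1 : ccirc (fun z => q z * z ^ 1) by exact: ccircM cq (@ccirc_exprz R 1).
  have cq2 : ccirc (fun z => w * q z) by exact: ccircM (@ccirc_cst _ _) cq.
  rewrite -(fourier_shift 1 _ cq) -(fourierZ w _ cq) -(fourierB _ cq1 cq2).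
  by apply: eq_fourier => x; rewrite -Gq expr1z mulrBl mulrC expr1z.
(* Its sum telescopes, up to two boundary terms. *)
have tel N : \sum_(n < N) t n =
    (0 < N)%:R * G w + w ^ (- N%:Z) * fourier q (- N.+1%:Z) -
    w ^ N%:Z * fourier q (N%:Z - 1).
  elim: N => [|N IH].
    have -> : 0%:Z - 1 = - 1%:Z by [].
    by rewrite big_ord0 oppr0 !expr0z ltnn mul0r; ring.
  rewrite big_ord_recr /= IH /t.
  have -> : fourier G N%:Z = fourier q (N%:Z - 1) - w * fourier q N%:Z
     + G w * (N == 0)%:R by rewrite -Vd subrK.
  have := Vd (- N.+1%:Z); rewrite mulr0 subr0 => ->.
  have -> : - N.+1%:Z - 1 = - N.+2%:Z by lia.
  have -> : N.+1%:Z - 1 = N%:Z by lia.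
  have -> : w ^ N.+1%:Z = w * w ^ N%:Z by rewrite -exprnP exprS.
  have -> : w ^ (- N%:Z) = w * w ^ (- N.+1%:Z).
    by rewrite -[in RHS](expr1z w) -expfzDr //; congr (w ^ _); lia.
  case: N {IH} => [|N] /=; last by ring.
  by rewrite !expr0z; ring.
have small : forall e, 0 < e -> exists2 K, (M < K)%N & cn (\sum_(n < K) t n - G w) < e.
  move=> e e0; have e2 : 0 < e / 2 by rewrite divr_gt0.
  have H1 := @riemann_lebesgue R q (fun n => - n.+1%:Z) cq.
  have H2 := @riemann_lebesgue R q (fun n => n%:Z - 1) cq.
  have /cvgrPdist_lt/(_ _ e2) H1' : (fun n => cn (fourier q (- n.+1%:Z))) @ \oo --> 0.
    by apply: H1 => i j /oppr_inj [].
  have /cvgrPdist_lt/(_ _ e2) H2' : (fun n => cn (fourier q (n%:Z - 1))) @ \oo --> 0.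
    by apply: H2 => i j /addIr [].
  near \oo => K; exists K; first by near: K; exact: nbhs_infty_gt.
  rewrite tel (_ : (0 < K)%N = true) ?mul1r; last first.
    by apply: leq_ltn_trans (leq0n M) _; near: K; exact: nbhs_infty_gt.
  set A := w ^ (- K%:Z) * _; set B := w ^ K%:Z * _.
  rewrite (_ : _ - G w = A - B); last by ring.
  apply: le_lt_trans (cnB _ _) _; rewrite /A /B !(cnM (w ^ _)) !cwz !mul1r (splitr e).
  apply: ltrD.
    have : `|0 - cn (fourier q (- K.+1%:Z))| < e / 2 by near: K; exact: H1'.
    by rewrite sub0r normrN ger0_norm ?cn_ge0.
  have : `|0 - cn (fourier q (K%:Z - 1))| < e / 2 by near: K; exact: H2'.
  by rewrite sub0r normrN ger0_norm ?cn_ge0.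
apply/ler_addgt0Pr => e e0; have [K MK SK] := small e e0.
have -> : G w - \sum_(n < M) t n = \sum_(M <= n < K) t n - (\sum_(n < K) t n - G w).
  rewrite -(big_mkord predT t) -(big_mkord predT t).
  by rewrite (big_cat_nat (leq0n M) (ltnW MK)) /=; ring.
apply: le_trans (cnB _ _) _; apply: lerD (ltW SK).
apply: le_trans (cn_sum _ _ _) _.
apply: (@le_trans _ _ (\sum_(M <= n < K) 2 * C * r ^+ n)).
  apply: ler_sum => n _; apply: le_trans (cnD _ _) _; rewrite !(cnM _ (w ^ _)) !cwz !mulr1.
  by rewrite -mulrA mulr2n mulrDl !mul1r; apply: lerD.
have -> : 2 * C / (1 - r) * r ^+ M = 2 * C * (r ^+ M / (1 - r)) by ring.
by rewrite -mulr_sumr ler_wpM2l ?mulr_ge0 //; exact: geo_sum_le.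
Unshelve. all: by end_near. Qed.

End Inversion.

(** * Complex derivatives *)

Section ComplexDerivative.

Lemma derivable_near (K : numFieldType) (f : K^o -> K^o) (z : K^o) : derivable f z 1 ->
  forall e : K, 0 < e -> \forall h \near nbhs (0 : K^o),
    `|f (z + h) - f z - 'D_1 f z * h| <= e * `|h|.
Proof.
move=> df e e0.
have /cvgrPdist_le/(_ e e0) : (fun h : K => h^-1 *: (f (h *: (1 : K^o) + z) - f z)) @ 0^' --> 'D_1 f z.
  exact: df.
rewrite near_withinE; apply: filterS => h H.
have [->|h0] := eqVneq h 0; first by rewrite addr0 subrr mulr0 subrr normr0 mulr0.
have h0' : 0 < `|h| by rewrite normr_gt0.
have := H h0; rewrite -(ler_pM2r h0') -normrM distrC mulrBl.
by rewrite /GRing.scale /= mulr1 mulrAC mulVf // mul1r (addrC h).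
Qed.

Variable R : realType.
Implicit Types (x y : R) (z w d : R[i]) (f g : R[i] -> R[i]).

(** The error is compared with the increment h rather than divided by it, so that
    h = 0 needs no special treatment, and all radii are real numbers. *)
Definition cder f z d : Prop := forall e : R, 0 < e -> exists2 dl : R, 0 < dl &
  forall h, cn h < dl -> cn (f (z + h) - f z - d * h) <= e * cn h.

Lemma derivable_cder f z : derivable (f : (R[i])^o -> (R[i])^o) z 1 -> exists d, cder f z d.
Proof.
move=> /derivable_near H; exists ('D_1 (f : (R[i])^o -> (R[i])^o) z) => e e0.
have ec : (0 : R[i]) < e%:C by rewrite ltcR.
have /near_cP[dl dl0 Hd] := H _ ec; exists dl => // h hd.
by have := Hd h; rewrite subr0 !cnE -rmorphM lecR; apply.
Qed.

Lemma cder_derivable f z d : cder f z d -> derivable (f : (R[i])^o -> (R[i])^o) z 1.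
Proof.
move=> df; apply/cvg_ex; exists d; apply/cvgrPdist_le => e e0.
have eE := RRe_real (gtr0_real e0).
have e0' : 0 < complex.Re e by rewrite -ltcR eE.
have [dl dl0 H] := df _ e0'.
rewrite near_withinE; apply/near_cP; exists dl => // h; rewrite subr0 => hd h0.
have h0' : 0 < cn h by rewrite cn_gt0.
rewrite cnE -eE lecR -(ler_pM2r h0') -cnM -cnN /GRing.scale /= mulr1 (addrC h).
rewrite mulrBl mulrAC mulVf // mul1r opprB; exact: H.
Qed.

Let cder_diff f z d : cder f z d -> differentiable (f : (R[i])^o -> (R[i])^o) (z : (R[i])^o).
Proof. by move=> /cder_derivable /derivable1_diffP. Qed.

Lemma cder_cvg f z d : cder f z d -> (f : (R[i])^o -> (R[i])^o) @ (z : (R[i])^o) --> (f z : (R[i])^o).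
Proof. by move=> /cder_diff; exact: differentiable_continuous. Qed.

Lemma cder_comp f g z d d' : cder f z d -> cder g (f z) d' ->
  exists d'', cder (fun w => g (f w)) z d''.
Proof.
move=> /cder_diff df /cder_diff dg; apply: derivable_cder; apply/derivable1_diffP.
exact: (differentiable_comp df dg).
Qed.

Lemma cder_affine (a b z : R[i]) : cder (fun w => a * w + b) z a.
Proof.
move=> e e0; exists 1 => // h _.
by rewrite (_ : _ - _ - _ = 0) ?cn0 ?mulr_ge0 ?cn_ge0 ?(ltW e0) //; ring.
Qed.

Lemma cderM f g z d d' : cder f z d -> cder g z d' ->
  exists d'', cder (fun w => f w * g w) z d''.
Proof.
move=> /cder_diff df /cder_diff dg; apply: derivable_cder; apply/derivable1_diffP.
exact: (differentiableM df dg).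
Qed.

Lemma real_der (f : R -> R) (x df : R) : is_derive x 1 f df -> forall e : R, 0 < e ->
  exists2 dl : R, 0 < dl & forall h, `|h| < dl -> `|f (x + h) - f x - df * h| <= e * `|h|.
Proof.
move=> [fd <-] e e0; have /nbhs_normP[dl /= dl0 H] := derivable_near fd e0.
by exists dl => // h hd; apply: H; rewrite /= sub0r normrN.
Qed.

(** From the derivatives of the real exponential, cosine and sine at 0. *)
Lemma cder_cexp0 : cder (@cexp R) 0 1.
Proof.
move=> e e0; pose e1 := Num.min 1 (e / 6).
have e10 : 0 < e1 by rewrite lt_min ltr01 divr_gt0.
have e11 : e1 <= 1 by rewrite ge_min lexx.
have e16 : e1 <= e / 6 by rewrite ge_min lexx orbT.
have [d1 d10 H1] := real_der (is_derive_expR (0 : R)) e10.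
have [d2 d20 H2] := real_der (is_derive_cos (0 : R)) e10.
have [d3 d30 H3] := real_der (is_derive_sin (0 : R)) e10.
exists (Num.min d1 (Num.min d2 (Num.min d3 (e1 / 2)))).
  by rewrite !lt_min d10 d20 d30 divr_gt0.
move=> h; rewrite !lt_min => /and4P[h1 h2 h3 h4].
have hR := cn_Re h; have hI := cn_Im h.
have := H1 _ (le_lt_trans hR h1); have := H2 _ (le_lt_trans hI h2).
have := H3 _ (le_lt_trans hI h3).
rewrite !add0r sin0 cos0 expR0 oppr0 mul0r !subr0 ?mul1r cexp0 ?add0r ?mul1r => b1 b2 b3.
set N := cn h in h1 h2 h3 h4 hR hI *.
have N0 : 0 <= N by exact: cn_ge0.
apply: le_trans (cn_le_ReIm _) _; rewrite !ReB !ImB cexpE /=.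
move: b1 b2 b3 h4 hR hI; rewrite !subr0 !mul0r !subr0 !addr0.
set u := complex.Re h; set v := complex.Im h.
set E := expR u; set Cv := cos v; set Sv := sin v => b1 b2 b3 h4 hR hI.
have EN : `|E - 1| <= e1.
  have := ler_normD (E - 1 - u) u; rewrite subrK => /le_trans; apply.
  have : `|u| <= e1 / 2 by apply: le_trans hR (ltW h4).
  have : e1 * `|u| <= 1 * `|u| by rewrite ler_wpM2r.
  lra.
have C1 : `|Cv - 1| <= e1 * N by apply: le_trans b2 _; rewrite ler_wpM2l // ltW.
have E2 : `|E| <= 2.
  by have := ler_normD (E - 1) 1; rewrite subrK normr1; lra.
have r1 : `|E * Cv - 1 - u| <= 2 * (e1 * N) + e1 * N.
  have -> : E * Cv - 1 - u = E * (Cv - 1) + (E - 1 - u) by ring.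
  apply: le_trans (ler_normD _ _) _; apply: lerD.
    by rewrite normrM; apply: ler_pM.
  by apply: le_trans b3 _; rewrite ler_wpM2l // ltW.
have r2 : `|E * Sv - v| <= 2 * (e1 * N) + e1 * N.
  have -> : E * Sv - v = E * (Sv - v) + (E - 1) * v by ring.
  apply: le_trans (ler_normD _ _) _; apply: lerD; rewrite normrM; apply: ler_pM => //.
  by apply: le_trans b1 _; rewrite ler_wpM2l // ltW.
have e1N : e1 * N <= e / 6 * N by rewrite ler_wpM2r.
lra.
Qed.

Lemma cder_cexp z : cder (@cexp R) z (cexp z).
Proof.
move=> e e0; have c0 : 0 < cn (cexp z) by rewrite cn_gt0 cexp_neq0.
have [dl dl0 H] := cder_cexp0 (divr_gt0 e0 c0).
exists dl => // h /H; rewrite add0r cexp0 cexpD mul1r => H1.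
have -> : cexp z * cexp h - cexp z - cexp z * h = cexp z * (cexp h - 1 - h) by ring.
by rewrite cnM mulrC -ler_pdivlMr // mulrAC.
Qed.

End ComplexDerivative.

(** * Goursat's theorem on rectangles *)

Section Goursat.
Variable R : realType.
Implicit Types (x y : R) (z w d : R[i]) (f g h : R[i] -> R[i]).

(** The contour integral along the boundary of a rectangle. *)
Definition rint h (x1 x2 y1 y2 : R) : R[i] :=
  (cint x1 x2 (fun x => h (x +i* y1)) - cint x1 x2 (fun x => h (x +i* y2))) +
  'i%C * (cint y1 y2 (fun y => h (x2 +i* y)) - cint y1 y2 (fun y => h (x1 +i* y))).

(** The continuity needed to cut a rectangle in two and integrate along the cut. *)
Variant rcont h (x1 x2 y1 y2 : R) : Prop := Rcont of
  (forall y, y1 <= y <= y2 -> ccont x1 x2 (fun x => h (x +i* y))) &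
  (forall x, x1 <= x <= x2 -> ccont y1 y2 (fun y => h (x +i* y))).

Lemma hline_cvg x y : ((fun x => x +i* y) : R -> (R[i])^o) @ x --> (x +i* y : (R[i])^o).
Proof. by apply: ReIm_cvg => /=; [exact: cvg_id|exact: cvg_cst]. Qed.
Lemma vline_cvg x y : ((fun y => x +i* y) : R -> (R[i])^o) @ y --> (x +i* y : (R[i])^o).
Proof. by apply: ReIm_cvg => /=; [exact: cvg_cst|exact: cvg_id]. Qed.

Lemma cder_rcont h (x1 x2 y1 y2 : R) :
  (forall x y, x1 <= x <= x2 -> y1 <= y <= y2 -> exists d, cder h (x +i* y) d) ->
  rcont h x1 x2 y1 y2.
Proof.
move=> hd; split=> [y yb|x xb].
  split=> x xb; have [d /cder_cvg dh] := hd x y xb yb.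
  exact: (cvg_comp _ _ (@hline_cvg x y) dh).
split=> y yb; have [d /cder_cvg dh] := hd x y xb yb.
exact: (cvg_comp _ _ (@vline_cvg x y) dh).
Qed.

Lemma rcont_sub h (x1 x2 y1 y2 u1 u2 v1 v2 : R) :
  x1 <= u1 -> u2 <= x2 -> y1 <= v1 -> v2 <= y2 ->
  rcont h x1 x2 y1 y2 -> rcont h u1 u2 v1 v2.
Proof.
move=> xu1 xu2 yv1 yv2 [ch cv]; split=> [y|x] /andP[b1 b2].
  by apply: ccont_sub xu1 xu2 (ch _ _); rewrite (le_trans yv1 b1) (le_trans b2).
by apply: ccont_sub yv1 yv2 (cv _ _); rewrite (le_trans xu1 b1) (le_trans b2).
Qed.

Lemma rint_hsplit h (x1 x2 x3 y1 y2 : R) : x1 <= x2 <= x3 -> y1 <= y2 ->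
  rcont h x1 x3 y1 y2 -> rint h x1 x3 y1 y2 = rint h x1 x2 y1 y2 + rint h x2 x3 y1 y2.
Proof.
move=> xb yb [ch _]; rewrite /rint.
rewrite (cint_cat xb (ch y1 _)) ?lexx // (cint_cat xb (ch y2 _)) ?lexx ?andbT //.
by ring.
Qed.

Lemma rint_vsplit h (x1 x2 y1 y2 y3 : R) : x1 <= x2 -> y1 <= y2 <= y3 ->
  rcont h x1 x2 y1 y3 -> rint h x1 x2 y1 y3 = rint h x1 x2 y1 y2 + rint h x1 x2 y2 y3.
Proof.
move=> xb yb [_ cv]; rewrite /rint.
rewrite (cint_cat yb (cv x1 _)) ?lexx // (cint_cat yb (cv x2 _)) ?lexx ?andbT //.
by ring.
Qed.

Lemma rint_le h (x1 x2 y1 y2 M : R) : x1 <= x2 -> y1 <= y2 -> rcont h x1 x2 y1 y2 ->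
  (forall x y, x1 <= x <= x2 -> y1 <= y <= y2 -> cn (h (x +i* y)) <= M) ->
  cn (rint h x1 x2 y1 y2) <= 4 * M * ((x2 - x1) + (y2 - y1)).
Proof.
move=> xb yb [ch cv] hM.
have x1b : x1 <= x1 <= x2 by rewrite lexx.
have x2b : x1 <= x2 <= x2 by rewrite xb lexx.
have y1b : y1 <= y1 <= y2 by rewrite lexx.
have y2b : y1 <= y2 <= y2 by rewrite yb lexx.
have I1 := cint_le xb (ch _ y1b) (fun x xx => hM x y1 xx y1b).
have I2 := cint_le xb (ch _ y2b) (fun x xx => hM x y2 xx y2b).
have I3 := cint_le yb (cv _ x1b) (fun y yy => hM x1 y x1b yy).
have I4 := cint_le yb (cv _ x2b) (fun y yy => hM x2 y x2b yy).
move: I1 I2 I3 I4; rewrite /rint.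
set A := cint _ _ _; set B := cint _ _ _; set C := cint _ _ _; set D := cint _ _ _.
move=> I1 I2 I3 I4; have := cnD (A - B) ('i%C * (D - C)).
rewrite cnM cn_i mul1r; have := cnB A B; have := cnB D C; lra.
Qed.

Lemma rintB h g (x1 x2 y1 y2 : R) : x1 <= x2 -> y1 <= y2 ->
  rcont h x1 x2 y1 y2 -> rcont g x1 x2 y1 y2 ->
  rint (fun w => h w - g w) x1 x2 y1 y2 = rint h x1 x2 y1 y2 - rint g x1 x2 y1 y2.
Proof.
move=> xb yb [ch cv] [ch' cv'].
have x1b : x1 <= x1 <= x2 by rewrite lexx.
have x2b : x1 <= x2 <= x2 by rewrite xb lexx.
have y1b : y1 <= y1 <= y2 by rewrite lexx.
have y2b : y1 <= y2 <= y2 by rewrite yb lexx.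
rewrite /rint (cintB (ch _ y1b) (ch' _ y1b)) (cintB (ch _ y2b) (ch' _ y2b)).
by rewrite (cintB (cv _ x1b) (cv' _ x1b)) (cintB (cv _ x2b) (cv' _ x2b)); ring.
Qed.

Lemma cint_affine (a b : R) z w : a <= b ->
  cint a b (fun x => z * x%:C + w) = z * ((b ^+ 2 - a ^+ 2) / 2)%:C + w * (b - a)%:C.
Proof.
move=> ab.
have cx : ccont a b (fun x => x%:C) by split=> x _; exact: hline_cvg.
have cc (u : R[i]) : ccont a b (fun=> u) by exact: ccont_cst.
have czx := ccontM (cc z) cx.
rewrite (cintD czx (cc w)) (cintZ z cx).
congr (_ * _ + _).
  transitivity ((b ^+ 2 / 2)%:C - (a ^+ 2 / 2)%:C : R[i]).
    apply: (cint_FTC (F := fun x => (x ^+ 2 / 2)%:C) ab cx) => x /=; last exact: is_derive_cst.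
    have H : is_derive x 1 (2^-1 \*: ((id : R -> R) * id)) (2^-1 *: (x *: 1 + x *: 1)).
      by apply: is_deriveZ; apply: is_deriveM.
    rewrite (_ : (fun y => _) = 2^-1 \*: ((id : R -> R) * id)); last first.
      by apply/funext => y /=; rewrite mulrC expr2.
    apply: is_derive_eq H _; rewrite /GRing.scale /= mulr1; lra.
  by rewrite -rmorphB mulrBl.
transitivity (w * cint a b (fun=> 1)).
  by rewrite -(cintZ w (cc 1)); apply: eq_cint => x _; rewrite mulr1.
congr (_ * _); transitivity (b%:C - a%:C : R[i]); last by rewrite -rmorphB.
apply: (cint_FTC (F := fun x => x%:C) ab (cc 1)) => x /=.
by do ?[exact: is_derive_id|exact: is_derive_cst].
Qed.

Lemma rint_affine z w (x1 x2 y1 y2 : R) : x1 <= x2 -> y1 <= y2 ->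
  rint (fun u => z * u + w) x1 x2 y1 y2 = 0.
Proof.
move=> xb yb; rewrite /rint.
have H y : cint x1 x2 (fun x => z * (x +i* y) + w) =
    cint x1 x2 (fun x => z * x%:C + (z * 'i%C * y%:C + w)).
  by apply: eq_cint => x _; rewrite [x +i* y]complexE /=; ring.
have V x : cint y1 y2 (fun y => z * (x +i* y) + w) =
    cint y1 y2 (fun y => (z * 'i%C) * y%:C + (z * x%:C + w)).
  by apply: eq_cint => y _; rewrite [x +i* y]complexE /=; ring.
rewrite !H !V !cint_affine // !rmorphB.
by ring.
Qed.

Lemma pow2_ge (x : R) : x < 2 ^+ (Num.truncn `|x|).+1.
Proof.
apply: le_lt_trans (ler_norm x) _; apply: lt_le_trans (truncnS_gt _) _.
by rewrite -natrX ler_nat ltnW // ltn_expl.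
Qed.

Lemma quarter z (z1 z2 z3 z4 : R[i]) : z = (z1 + z2) + (z3 + z4) ->
  4 * cn z1 < cn z -> 4 * cn z2 < cn z -> 4 * cn z3 < cn z -> 4 * cn z4 < cn z -> False.
Proof.
move=> -> c1 c2 c3 c4.
have := cnD (z1 + z2) (z3 + z4); have := cnD z1 z2; have := cnD z3 z4.
lra.
Qed.

(** One quarter of a rectangle carries at least a quarter of the contour
    integral. *)
Lemma bisect h (x y A B : R) : 0 <= A -> 0 <= B ->
  rcont h x (x + (A + A)) y (y + (B + B)) -> exists u v : R,
  [/\ u = x \/ u = x + A, v = y \/ v = y + B &
    cn (rint h x (x + (A + A)) y (y + (B + B))) <= 4 * cn (rint h u (u + A) v (v + B))].
Proof.
have -> : x + (A + A) = x + A + A by rewrite addrA.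
have -> : y + (B + B) = y + B + B by rewrite addrA.
move=> ax bx rcs.
have hs : x <= x + A <= x + A + A by rewrite !lerDl ax.
have vs : y <= y + B <= y + B + B by rewrite !lerDl bx.
have rc1 : rcont h x (x + A) y (y + B + B) by apply: rcont_sub rcs => //; lra.
have rc2 : rcont h (x + A) (x + A + A) y (y + B + B).
  by apply: rcont_sub rcs => //; lra.
have yb : y <= y + B + B by lra.
have xa1 : x <= x + A by lra.
have xa2 : x + A <= x + A + A by lra.
have E := rint_hsplit hs yb rcs.
rewrite (rint_vsplit xa1 vs rc1) (rint_vsplit xa2 vs rc2) in E.
set r0 := rint h x (x + A + A) y (y + B + B) in E *.
case: (leP (cn r0) (4 * cn (rint h x (x + A) y (y + B)))) => c1.
  by exists x, y; split; [left|left|].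
case: (leP (cn r0) (4 * cn (rint h x (x + A) (y + B) (y + B + B)))) => c2.
  by exists x, (y + B); split; [left|right|].
case: (leP (cn r0) (4 * cn (rint h (x + A) (x + A + A) y (y + B)))) => c3.
  by exists (x + A), y; split; [right|left|].
exists (x + A), (y + B); split; [by right|by right|].
by rewrite leNgt; apply/negP => c4; exact: (quarter E c1 c2 c3 c4).
Qed.

Lemma nested_intervals (s l : nat -> R) : (forall k, 0 <= l k) ->
  (forall k, s k <= s k.+1) -> (forall k, s k.+1 + l k.+1 <= s k + l k) ->
  exists x, forall k, s k <= x <= s k + l k.
Proof.
move=> l0 s1 s2.
have nest j i : s j <= s (i + j)%N /\ s (i + j)%N + l (i + j)%N <= s j + l j.
  elim: i => [|i [j1 j2]]; first by [].
  by have := s1 (i + j)%N; have := s2 (i + j)%N; rewrite addSn; split; lra.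
have le_sl i j : s i <= s j + l j.
  have [ij|/ltnW ij] := leqP j i.
    by have [_] := nest j (i - j)%N; rewrite subnK // => H; have := l0 i; lra.
  by have [+ _] := nest i (j - i)%N; rewrite subnK // => H; have := l0 j; lra.
exists (sup (range s)) => k; apply/andP; split.
  apply: sup_upper_bound; last by exists k.
  by split; [exists (s k); exists k|exists (s k + l k) => _ [i _ <-]].
by apply: sup_le_ub; [exists (s k); exists k|move=> _ [i _ <-]].
Qed.

(** Nested bisection: the k-th nested rectangle carries an integral of size at
    least 4^-k times the whole one, whereas complex differentiability at the
    common point of the rectangles makes it o(4^-k), because the integral of an
    affine function vanishes. *)
Lemma goursat h (X1 X2 Y1 Y2 : R) : X1 <= X2 -> Y1 <= Y2 ->
  (forall x y, X1 <= x <= X2 -> Y1 <= y <= Y2 -> exists d, cder h (x +i* y) d) ->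
  rint h X1 X2 Y1 Y2 = 0.
Proof.
move=> XX YY hd; have rc := cder_rcont hd.
pose a := X2 - X1; pose b := Y2 - Y1.
have a0 : 0 <= a by rewrite subr_ge0.
have b0 : 0 <= b by rewrite subr_ge0.
pose ak k : R := a / 2 ^+ k; pose bk k : R := b / 2 ^+ k.
have ak0 k : 0 <= ak k by rewrite divr_ge0 // exprn_ge0.
have bk0 k : 0 <= bk k by rewrite divr_ge0 // exprn_ge0.
have akS k : ak k = ak k.+1 + ak k.+1.
  by rewrite /ak exprS; field; rewrite expf_neq0.
have bkS k : bk k = bk k.+1 + bk k.+1.
  by rewrite /bk exprS; field; rewrite expf_neq0.
pose rk k (s : R * R) := rint h s.1 (s.1 + ak k) s.2 (s.2 + bk k).
pose inside k (s : R * R) :=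
  [/\ X1 <= s.1, s.1 + ak k <= X2, Y1 <= s.2 & s.2 + bk k <= Y2].
pose nested k (s s' : R * R) :=
  [/\ s.1 <= s'.1, s'.1 + ak k.+1 <= s.1 + ak k,
      s.2 <= s'.2 & s'.2 + bk k.+1 <= s.2 + bk k].
have step k s : inside k s -> exists s', nested k s s' /\ cn (rk k s) <= 4 * cn (rk k.+1 s').
  case: s => x y [/= i1 i2 i3 i4].
  have rcs : rcont h x (x + ak k) y (y + bk k) by apply: rcont_sub rc.
  have ax := ak0 k.+1; have bx := bk0 k.+1; have aS := akS k; have bS := bkS k.
  rewrite /rk /nested /=; move: (ak k) (ak k.+1) (bk k) (bk k.+1) ax bx aS bS rcs {i1 i2 i3 i4}.
  move=> ? A ? B ax bx -> -> rcs.
  have [u [v [hu hv le4]]] := bisect ax bx rcs.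
  exists (u, v); split; last exact: le4.
  rewrite /=.
  by clear -ax bx hu hv; case: hu => ->; case: hv => ->; split; lra.
(* A chosen quarter; for rectangles that are not inside the initial one it is arbitrary. *)
have [nxt Hn] : {nxt : nat * (R * R) -> R * R & forall p, inside p.1 p.2 ->
    nested p.1 p.2 (nxt p) /\ cn (rk p.1 p.2) <= 4 * cn (rk p.1.+1 (nxt p))}.
  apply: (@choice _ _ (fun (p : nat * (R * R)) s' => inside p.1 p.2 ->
    nested p.1 p.2 s' /\ cn (rk p.1 p.2) <= 4 * cn (rk p.1.+1 s'))) => -[i s] /=.
  have [/step[s0 Hs0]|ni] := pselect (inside i s); first by exists s0.
  by exists s.
pose S := fix S k := if k is k'.+1 then nxt (k', S k') else (X1, Y1).
have inS k : inside k (S k).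
  elim: k => [|k IH] /=.
    by rewrite /inside /ak /bk expr0 !divr1 /a /b /=; split; lra.
  have [[n1 n2 n3 n4] _] := Hn (k, S k) IH; have [i1 i2 i3 i4] := IH.
  by split; move: n1 n2 n3 n4 => /=; lra.
have nestS k : nested k (S k) (S k.+1) by have [] := Hn (k, S k) (inS k).
have cnS k : cn (rint h X1 X2 Y1 Y2) <= 4 ^+ k * cn (rk k (S k)).
  elim: k => [|k IH].
    have ea : X1 + ak 0%N = X2 by rewrite /ak expr0 divr1 /a addrC subrK.
    have eb : Y1 + bk 0%N = Y2 by rewrite /bk expr0 divr1 /b addrC subrK.
    by rewrite expr0 mul1r -[X in _ <= cn X]/(rint h X1 (X1 + ak 0%N) Y1 (Y1 + bk 0%N)) ea eb.
  apply: le_trans IH _; rewrite exprS -mulrA mulrCA ler_wpM2l ?exprn_ge0 //.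
  by have [] := Hn (k, S k) (inS k).
clearbody S.
have [xs xsb] : exists xs, forall k, (S k).1 <= xs <= (S k).1 + ak k.
  by apply: nested_intervals => // k; have [] := nestS k.
have [ys ysb] : exists ys, forall k, (S k).2 <= ys <= (S k).2 + bk k.
  by apply: nested_intervals => // k; have [] := nestS k.
have [d dz] : exists d, cder h (xs +i* ys) d.
  have [i1 i2 i3 i4] := inS 0%N; have x0 := xsb 0%N; have y0 := ysb 0%N.
  by apply: hd; lra.
apply/eqP; rewrite -cn_eq0 eq_le cn_ge0 andbT; apply/ler_addgt0Pr => e e0; rewrite add0r.
pose L := 4 * (a + b) ^+ 2 + 1.
have L0 : 0 < L by rewrite ltr_wpDl // mulr_ge0 // exprn_ge0 // addr_ge0.
have [dl dl0 Hdl] := dz _ (divr_gt0 e0 L0).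
(* So large that the k-th rectangle lies where the derivative is accurate. *)
pose k := (Num.truncn `|(a + b) / dl|).+1.
have kdl : ak k + bk k < dl.
  by rewrite -mulrDl ltr_pdivrMr ?exprn_gt0 // mulrC -ltr_pdivrMr // pow2_ge.
have [xk yk] := (xsb k, ysb k); move: xk yk (inS k) (cnS k); rewrite /inside /rk.
set x := (S k).1; set y := (S k).2 => xk yk inSk cnSk.
have xle : x <= x + ak k by rewrite lerDl.
have yle : y <= y + bk k by rewrite lerDl.
have rcs : rcont h x (x + ak k) y (y + bk k).
  by have [? ? ? ?] := inSk; apply: rcont_sub rc.
pose w0 : R[i] := xs +i* ys.
(* The affine part of h at the limit point has a vanishing contour integral. *)
pose af w := d * w + (h w0 - d * w0).
have rca : rcont af x (x + ak k) y (y + bk k).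
  by apply: cder_rcont => u v _ _; exists d; exact: cder_affine.
have rcd : rcont (fun w => h w - af w) x (x + ak k) y (y + bk k).
  by case: rcs rca => c1 c2 [c3 c4]; split=> u ub; apply: ccontB; auto.
have E : rint h x (x + ak k) y (y + bk k) = rint (fun w => h w - af w) x (x + ak k) y (y + bk k).
  by rewrite (rintB xle yle rcs rca) rint_affine // subr0.
apply: le_trans cnSk _; rewrite E.
have bd u v : x <= u <= x + ak k -> y <= v <= y + bk k ->
    cn (h (u +i* v) - af (u +i* v)) <= e / L * (ak k + bk k).
  move=> ub vb; set w := u +i* v.
  have ww : cn (w - w0) <= ak k + bk k.
    have h1 : `|u - xs| <= ak k by rewrite ler_norml; lra.
    have h2 : `|v - ys| <= bk k by rewrite ler_norml; lra.
    by apply: le_trans (cn_le_ReIm _) _; rewrite ReB ImB; exact: (lerD h1 h2).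
  have := Hdl _ (le_lt_trans ww kdl); rewrite [_ + (w - w0)]addrC subrK.
  rewrite (_ : h w - af w = h w - h w0 - d * (w - w0)); last by rewrite /af; ring.
  move=> /le_trans; apply; rewrite ler_wpM2l // ltW // divr_gt0 //.
have := rint_le xle yle rcd bd.
have -> : x + ak k - x = ak k by ring.
have -> : y + bk k - y = bk k by ring.
move=> /(ler_wpM2l (exprn_ge0 k (ler0n R 4))) /le_trans; apply.
have -> : 4 ^+ k * (4 * (e / L * (ak k + bk k)) * (ak k + bk k)) =
   e * ((4 * (a + b) ^+ 2) / L).
  rewrite /ak /bk (_ : 4 = 2 ^+ 2 :> R); last by rewrite -natrX.
  by rewrite -exprM mulnC exprM; field; rewrite ?expf_neq0 ?gt_eqF.
by rewrite ler_piMr ?(ltW e0) // ler_pdivrMr // mul1r lerDl.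
Qed.

End Goursat.

(** * Holomorphic functions near the unit circle *)

Section Holomorphic.
Variable R : realType.
Implicit Types (x y : R) (z w d : R[i]) (m : int) (f g h G : R[i] -> R[i]).

Lemma cexp_line x y m : cexp ((- m)%:~R * (x +i* y)) = (expR (- (m%:~R * x)))%:C * circ y ^ (- m) :> R[i].
Proof.
have -> : (- m)%:~R * (x +i* y) = ((- m)%:~R * x) +i* ((- m)%:~R * y).
  by rewrite -(rmorph_int (real_complex R)) /=; apply/eqP; rewrite eq_complex /= !mul0r subr0 addr0 !eqxx.
by rewrite cexpE /= circ_exprz mulrNz mulNr.
Qed.

Lemma cexp_periodic x : cexp (x +i* (2 * pi)) = cexp (x +i* 0).
Proof. by rewrite !cexpE /= circ2pi circ0. Qed.

Lemma cder_eq f g z d : (forall w, f w = g w) -> cder f z d -> cder g z d.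
Proof. by move=> /funext <-. Qed.

Lemma cder_cexpZ (c z : R[i]) : exists d, cder (fun w => cexp (c * w)) z d.
Proof.
have [d dc] := cder_comp (cder_affine c 0 z) (cder_cexp _); exists d.
apply: cder_eq dc => w.
by rewrite addr0.
Qed.

(** Shifting the circle of integration: in the logarithmic coordinate the
    annulus becomes a rectangle whose horizontal sides carry equal integrals. *)
Lemma contour_shift G (x1 x2 : R) m : x1 <= x2 ->
  (forall x y, x1 <= x <= x2 -> 0 <= y <= 2 * pi -> exists d, cder G (cexp (x +i* y)) d) ->
  cint 0 (2 * pi) (fun y => G (cexp (x1 +i* y)) * cexp ((- m)%:~R * (x1 +i* y))) =
  cint 0 (2 * pi) (fun y => G (cexp (x2 +i* y)) * cexp ((- m)%:~R * (x2 +i* y))).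
Proof.
move=> x12 Gd; pose h w := G (cexp w) * cexp ((- m)%:~R * w).
have hd x y : x1 <= x <= x2 -> 0 <= y <= 2 * pi -> exists d, cder h (x +i* y) d.
  move=> xb yb; have [d dG] := Gd x y xb yb.
  have [d1 dh] := cder_comp (cder_cexp (x +i* y)) dG.
  have [d2 dc] := cder_cexpZ (- m)%:~R (x +i* y).
  exact: cderM dh dc.
have := goursat x12 (ltW (@pi2_gt0 R)) hd; rewrite /rint.
set A := cint x1 x2 _; set B := cint x1 x2 _; set C := cint 0 _ _; set D := cint 0 _ _.
have -> : A = B.
  apply: eq_cint => x _; rewrite /h cexp_periodic !cexp_line circ2pi circ0 !exp1rz //.
rewrite subrr add0r => /eqP; rewrite mulf_eq0 (negbTE (@ci_neq0 R)) /= subr_eq0.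
by move=> /eqP ->.
Qed.

(** On the circle of radius exp x0, the factor z^-m has modulus exp (- m x0). *)
Lemma fourier_decay G (x0 B : R) m : ccirc G ->
  (forall x y, Num.min 0 x0 <= x <= Num.max 0 x0 -> 0 <= y <= 2 * pi ->
     exists d, cder G (cexp (x +i* y)) d) ->
  (forall y, 0 <= y <= 2 * pi -> cn (G (cexp (x0 +i* y))) <= B) ->
  cn (fourier G m) <= 2 * B * expR (- (m%:~R * x0)).
Proof.
move=> cG Gd GB; have p0 := @pi2_gt0 R.
have E : cint 0 (2 * pi) (fun y => G (circ y) * circ y ^ (- m)) =
  cint 0 (2 * pi) (fun y => G (cexp (x0 +i* y)) * cexp ((- m)%:~R * (x0 +i* y))).
  transitivity (cint 0 (2 * pi) (fun y => G (cexp (0 +i* y)) * cexp ((- m)%:~R * (0 +i* y)))).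
    by apply: eq_cint => y _; rewrite cexp_line mulr0 oppr0 expR0 mul1r -circE.
  case: (leP 0 x0) Gd => [x00|/ltW x00] Gd; first exact: contour_shift.
  by apply/esym; exact: contour_shift.
rewrite fourierE // E (cnM _ (cint _ _ _)) cnV cn_real gtr0_norm // mulrC ler_pdivrMr //.
have cc : ccont 0 (2 * pi) (fun y => G (cexp (x0 +i* y)) * cexp ((- m)%:~R * (x0 +i* y))).
  split=> y yb; apply: cvgM.
    have [|d /cder_cvg dG] := Gd x0 y _ yb; first by rewrite ge_min le_max lexx !orbT.
    apply: (cvg_comp _ _ (cvg_comp _ _ (@vline_cvg R x0 y) (cder_cvg (cder_cexp _))) dG).
  have [d /cder_cvg dc] := cder_cexpZ (- m)%:~R (x0 +i* y).
  exact: (cvg_comp _ _ (@vline_cvg R x0 y) dc).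
apply: le_trans (cint_le (M := B * expR (- (m%:~R * x0))) (ltW p0) cc _) _.
  move=> y yb; rewrite (cnM (G _)) cexp_line (cnM _%:C) cn_real cn_exprz cn_circ exp1rz mulr1.
  by rewrite (ger0_norm (expR_ge0 _)) ler_wpM2r ?expR_ge0 ?GB.
by rewrite subr0 (mulrA 2 B).
Qed.

(** Tube lemma in the logarithmic coordinate x + i y: the angles y range over a
    compact set. *)
Lemma open_annulus (U : set (R[i])^o) : open U -> @unit_circle R `<=` U ->
  exists2 x0, 0 < x0 & forall x y, `|x| < x0 -> 0 <= y <= 2 * pi -> U (cexp (x +i* y)).
Proof.
move=> oU cU.
have K : compact (`[0, 2 * pi]%classic : set R) by exact: segment_compact.
have /compact_near_coveringP := K.
move=> /(_ R (nbhs (0 : R)) (fun x y => U (cexp (x +i* y)))) H.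
have : \forall x \near (0 : R), `[0, 2 * pi]%classic `<=` (fun y => U (cexp (x +i* y))).
  apply: H => y _.
  have Uy : U (cexp (0 +i* y)) by apply: cU; rewrite /unit_circle /= -circE cnE cn_circ.
  have /near_cP[dl dl0 Hdl] : nbhs (cexp (0 +i* y) : (R[i])^o) U by exact: open_nbhs_nbhs.
  have /cvg_atP/(_ _ dl0)[e e0 He] := cder_cvg (cder_cexp (0 +i* y)).
  have e2 : 0 < e / 2 by rewrite divr_gt0.
  exists (ball y (e / 2), ball (0 : R) (e / 2)) => /=.
    by split; [exact: nbhsx_ballx|exact: nbhsx_ballx].
  move=> [y' x] [/= by' bx]; apply/Hdl/He.
  apply: le_lt_trans (cn_le_ReIm _) _; rewrite ReB ImB /= (splitr e).
  rewrite /ball /= in by' bx; apply: ltrD; first by rewrite distrC.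
  by rewrite distrC.
move=> /nbhs_ballP[x0 /= x00 Hx0]; exists x0 => // x y xx yb.
by apply: Hx0; rewrite /= ?in_itv //= /ball /= sub0r normrN.
Qed.

End Holomorphic.

Section Expansion.
Variable R : realType.
Implicit Types (x y : R) (z w d : R[i]) (m : int) (f g h G : R[i] -> R[i]).

Lemma cder_ccirc G : (forall y, exists d, cder G (circ y) d) -> ccirc G.
Proof.
move=> Gd; split=> a b; split=> y _; have [d /cder_cvg dG] := Gd y.
exact: (cvg_comp _ _ (@circ_cvg R y) dG).
Qed.

(** The difference quotient of G at w, completed by the derivative d. *)
Definition dquot G w d z : R[i] := if z == w then d else (G z - G w) / (z - w).

Lemma dquotM G w d z : (z - w) * dquot G w d z = G z - G w.
Proof.
rewrite /dquot; have [->|zw] := eqVneq z w; first by rewrite !subrr mul0r.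
by rewrite mulrC mulfVK // subr_eq0.
Qed.

Lemma dquot_ccirc G w d : ccirc G -> cder G w d -> ccirc (dquot G w d).
Proof.
move=> cG dG; split=> a b; split=> y _.
suff : ((fun t => dquot G w d (circ t)) : R -> (R[i])^o) @ y -->
    (dquot G w d (circ y) : (R[i])^o) by [].
have cz := @circ_cvg R y; have [zw|zw] := eqVneq (circ y) w.
  have -> : dquot G w d (circ y) = d by rewrite /dquot zw eqxx.
  apply/cvgcP => e e0; have e2 : 0 < e / 2 by rewrite divr_gt0.
  have [dl dl0 H] := dG _ e2.
  have cz' : \forall t \near y, cn (circ t - circ y) < dl.
    exact: (proj1 (@cvgcP R R (nbhs y) _ _ _)) cz dl dl0.
  apply: filterS cz' => t; rewrite zw => ct; rewrite /dquot.
  have [_|tw] := eqVneq (circ t) w; first by rewrite subrr cn0.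
  have hn0 : circ t - w != 0 by rewrite subr_eq0.
  have := H _ ct; rewrite [w + _]addrC subrK.
  rewrite -ler_pdivrMr ?cn_gt0 // -cnV -(cnM (_ - _ - _)) mulrBl mulfK //.
  by move=> /le_lt_trans; apply; rewrite ltr_pdivrMr // ltr_pMr // ltr1n.
have tw : \forall t \near y, circ t != w.
  have c0 : 0 < cn (circ y - w) by rewrite cn_gt0 subr_eq0.
  have cz' : \forall t \near y, cn (circ t - circ y) < cn (circ y - w).
    exact: (proj1 (@cvgcP R R (nbhs y) _ _ _)) cz _ c0.
  by apply: filterS cz' => t; apply: contraTneq => ->; rewrite cnBC ltxx.
have -> : dquot G w d (circ y) = (G (circ y) - G w) / (circ y - w).
  by rewrite /dquot (negbTE zw).
have H : ((fun t => (G (circ t) - G w) / (circ t - w)) : R -> (R[i])^o) @ y -->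
    ((G (circ y) - G w) / (circ y - w) : (R[i])^o).
  have [cG'] := ccircP cG y y.
  apply: cvgM.
    by apply: cvgB; [apply: cG'; rewrite lexx|exact: cvg_cst].
  apply: cvgV; first by rewrite subr_eq0.
  by apply: cvgB cz _; exact: cvg_cst.
apply: cvg_trans H; apply: near_eq_cvg.
by apply: filterS tw => t tw; rewrite /dquot (negbTE tw).
Qed.

Lemma expR_natN (x : R) (n : nat) : expR (- (n%:R * x)) = expR (- x) ^+ n.
Proof. by rewrite -expRM_natl mulrN. Qed.

Lemma expRN_lt1 (x : R) : 0 < x -> expR (- x) < 1.
Proof. by move=> x0; rewrite expR_lt1 oppr_lt0. Qed.

(** Shifting the contour outwards or inwards bounds the coefficients of positive
    or negative index; differentiability makes the difference quotient
    continuous, as pointwise inversion requires. *)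
Lemma annulus_expand G (x0 : R) : 0 < x0 ->
  (forall x y, `|x| <= x0 -> 0 <= y <= 2 * pi -> exists d, cder G (cexp (x +i* y)) d) ->
  ccirc G /\ exists C r : R, [/\ 0 <= C, 0 < r < 1,
    (forall n : nat, cn (fourier G n%:Z) <= C * r ^+ n),
    (forall n : nat, cn (fourier G (- n.+1%:Z)) <= C * r ^+ n) &
    forall x (M : nat), cn (G (circ x) - \sum_(n < M) (fourier G n%:Z * circ x ^ n%:Z +
      fourier G (- n.+1%:Z) * circ x ^ (- n.+1%:Z))) <= C * r ^+ M].
Proof.
move=> x00 Gd; have p0 := @pi2_gt0 R.
have Gc y : exists d, cder G (circ y) d.
  have [y' yb ->] := circ_2pi_range y; rewrite circE; apply: Gd => //.
  by rewrite normr0 ltW.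
have cG := cder_ccirc Gc; split => //.
have bnd x : `|x| <= x0 ->
    exists2 B, 0 <= B & forall y, 0 <= y <= 2 * pi -> cn (G (cexp (x +i* y))) <= B.
  move=> xx; apply: ccont_bounded; first exact: ltW.
  split=> y yb; have [d /cder_cvg dG] := Gd x y xx yb.
  exact: (cvg_comp _ _ (cvg_comp _ _ (@vline_cvg R x y) (cder_cvg (cder_cexp _))) dG).
have nx0 : `|x0| <= x0 by rewrite gtr0_norm.
have nNx0 : `|- x0| <= x0 by rewrite normrN gtr0_norm.
have [B1 B10 HB1] := bnd _ nx0; have [B2 B20 HB2] := bnd _ nNx0.
pose r := expR (- x0); have r0 : 0 < r by exact: expR_gt0.
have r1 : r < 1 by exact: expRN_lt1.
pose C := 2 * B1 + 2 * B2; have C0 : 0 <= C by rewrite addr_ge0 // mulr_ge0.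
have r10 : 0 < 1 - r by rewrite subr_gt0.
have Vp (n : nat) : cn (fourier G n%:Z) <= C * r ^+ n.
  apply: le_trans (fourier_decay (x0 := x0) n%:Z cG _ HB1) _.
    move=> x y; rewrite (min_idPl (ltW x00)) (max_idPr (ltW x00)) => /andP[x1 x2].
    by apply: Gd; rewrite ger0_norm.
  rewrite expR_natN -/r ler_wpM2r ?exprn_ge0 ?(ltW r0) // lerDl mulr_ge0 //.
have Vm (n : nat) : cn (fourier G (- n.+1%:Z)) <= C * r ^+ n.
  have Nx0 : - x0 <= 0 by rewrite oppr_le0 ltW.
  apply: le_trans (fourier_decay (x0 := - x0) (- n.+1%:Z) cG _ HB2) _.
    move=> x y; rewrite (min_idPr Nx0) (max_idPl Nx0) => /andP[x1 x2].
    by apply: Gd; rewrite ler0_norm // lerNl.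
  rewrite mulrN mulrNz mulNr opprK expR_natN -/r exprSr mulrA.
  apply: le_trans (_ : 2 * B2 * r ^+ n <= _).
    by rewrite ler_piMr ?(ltW r1) // !mulr_ge0 // exprn_ge0 // ltW.
  by rewrite ler_wpM2r ?exprn_ge0 ?(ltW r0) // lerDr mulr_ge0.
exists (2 * C / (1 - r)), r.
have CC (n : nat) : C * r ^+ n <= 2 * C / (1 - r) * r ^+ n.
  rewrite ler_wpM2r ?exprn_ge0 ?(ltW r0) // ler_pdivlMr // mulrC.
  by rewrite ler_wpM2r //; lra.
split=> //.
- by rewrite divr_ge0 ?mulr_ge0 ?(ltW r10).
- by rewrite r0.
- by move=> n; apply: le_trans (Vp n) (CC n).
- by move=> n; apply: le_trans (Vm n) (CC n).
move=> x M; have [d dG] := Gc x.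
apply: (fourier_inversion cG (dquot_ccirc cG dG)) => //; last exact: ltW.
- by move=> y; exact: dquotM.
- exact: cn_circ.
Qed.

(** The coefficients of negative index vanish, since the contour can be shrunk to
    the centre. *)
Lemma disc_expand G (R1 B : R) : 1 < R1 -> (forall z, cn z < R1 -> exists d, cder G z d) ->
  (forall z, cn z <= 1 -> cn (G z) <= B) ->
  exists C r : R, [/\ 0 <= C, 0 < r < 1,
    (forall n : nat, cn (fourier G n%:Z) <= C * r ^+ n) &
    forall x (M : nat),
      cn (G (circ x) - \sum_(n < M) fourier G n%:Z * circ x ^+ n) <= C * r ^+ M].
Proof.
move=> R11 Gd GB; have R10 : 0 < R1 by apply: lt_trans R11.
have x00 : 0 < ln R1 / 2 by rewrite divr_gt0 // ln_gt0.
have B0 : 0 <= B by apply: le_trans (GB 0 _); rewrite ?cn_ge0 ?cn0.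
have Gs x y : x <= ln R1 / 2 -> exists d, cder G (cexp (x +i* y)) d.
  move=> xx; apply: Gd; rewrite cn_cexp /= -[R1]lnK ?posrE // ltr_expR.
  by apply: le_lt_trans xx _; lra.
have Ga x y : `|x| <= ln R1 / 2 -> 0 <= y <= 2 * pi -> exists d, cder G (cexp (x +i* y)) d.
  by move=> /ler_normlP[_ xx] _; exact: Gs.
have [cG [C [r [C0 r01 Vp Vm Ex]]]] := annulus_expand x00 Ga.
exists C, r; split=> // x M; have := Ex x M.
have Vm0 n : fourier G (- n.+1%:Z) = 0.
  (* The contour of radius exp (- K); the exponential is at least 1 + K. *)
  have H (K : R) : 0 <= K -> cn (fourier G (- n.+1%:Z)) <= 2 * B / (1 + K).
    move=> K0; have NK : - K <= 0 by rewrite oppr_le0.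
    apply: le_trans (fourier_decay (x0 := - K) (B := B) (- n.+1%:Z) cG _ _) _.
    - move=> u y /andP[_ u0] _; apply: Gs; apply: le_trans u0 _.
      by rewrite (max_idPl NK) ltW.
    - move=> y _; apply: GB; rewrite cn_cexp /=.
      by rewrite -[leRHS]expR0 ler_expR.
    rewrite mulrN mulrNz mulNr opprK ler_wpM2l ?mulr_ge0 //.
    rewrite expRN lef_pV2 ?posrE ?expR_gt0 ?ltr_pwDl //.
    apply: le_trans (expR_ge1Dx K) _; rewrite ler_expR.
    by rewrite ler_peMl // (ler_nat R 1).
  apply/eqP; rewrite -cn_eq0 eq_le cn_ge0 andbT leNgt; apply/negP => c0.
  have := H (2 * B / cn (fourier G (- n.+1%:Z))).
  rewrite divr_ge0 ?mulr_ge0 ?cn_ge0 // => /(_ isT).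
  set c := cn _ in c0 *.
  have D0 : 0 < 1 + 2 * B / c by rewrite ltr_pwDl // divr_ge0 ?mulr_ge0 // ltW.
  by rewrite ler_pdivlMr // mulrDr mulr1 mulrC mulfVK ?gt_eqF //; lra.
by under eq_bigr => n _ do rewrite Vm0 mul0r addr0.
Qed.

End Expansion.

(** * Power series *)

Section PowerSeries.
Variable R : realType.
Implicit Types (x y q : R) (z w d : R[i]) (f g h G : R[i] -> R[i]) (v u : nat -> R[i]).

Lemma bernoulli_ge x (m : nat) : 0 <= x -> 1 + m%:R * x <= (1 + x) ^+ m.
Proof.
move=> x0; elim: m => [|m IH]; first by rewrite mul0r addr0 expr0.
rewrite exprS; apply: le_trans (ler_wpM2l _ IH); last by rewrite addr_ge0.
by rewrite -natr1; have := mulr_ge0 (mulr_ge0 (ler0n R m) x0) x0; lra.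
Qed.

(** By induction on k: Bernoulli's inequality absorbs one factor m into a larger
    ratio. *)
Lemma poly_geo (k : nat) q0 q : 0 <= q0 -> q0 < q ->
  exists2 K : R, 0 <= K & forall m : nat, m%:R ^+ k * q0 ^+ m <= K * q ^+ m.
Proof.
elim: k q0 => [|k IH] q0 q00 q0q.
  have qq := ltW q0q; have qn := le_trans q00 qq.
  by exists 1 => // m; rewrite expr0 !mul1r lerXn2r ?nnegrE.
pose q1 := (q0 + q) / 2.
have q01 : q0 < q1 by rewrite /q1; lra.
have q1q : q1 < q by rewrite /q1; lra.
have q10 : 0 < q1 by exact: le_lt_trans q01.
have [K2 K20 H2] := IH q1 (ltW q10) q1q.
have [K1 K10 H1] : exists2 K : R, 0 <= K & forall m : nat, m%:R * q0 ^+ m <= K * q1 ^+ m.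
  move: q00; rewrite le_eqVlt => /predU1P[<-|q00].
    exists 0 => // -[|m]; first by rewrite !mul0r.
    by rewrite expr0n /= mulr0 mul0r.
  pose x := q1 / q0 - 1; have x0 : 0 < x by rewrite subr_gt0 ltr_pdivlMr // mul1r.
  exists x^-1; first by rewrite invr_ge0 ltW.
  move=> m; rewrite -ler_pdivlMr ?exprn_gt0 // -mulrA -expr_div_n mulrC ler_pdivlMr //.
  apply: le_trans (_ : 1 + m%:R * x <= _); first by rewrite lerDr.
  by apply: le_trans (bernoulli_ge m (ltW x0)) _; rewrite /x addrC subrK.
exists (K1 * K2); first exact: mulr_ge0.
move=> m; rewrite exprSr -mulrA.
apply: le_trans (ler_wpM2l _ (H1 m)) _; first exact: exprn_ge0.
by rewrite mulrCA -mulrA ler_wpM2l.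
Qed.

Lemma cseries_cvg u (K q : R) : 0 <= q -> q < 1 -> (forall m, cn (u m) <= K * q ^+ m) ->
  exists2 l : R[i], (series u : nat -> (R[i])^o) @ \oo --> (l : (R[i])^o) &
    forall M : nat, cn (l - \sum_(i < M) u i) <= K / (1 - q) * q ^+ M.
Proof.
move=> q0 q1 uK.
have K0 : 0 <= K by apply: le_trans (cn_ge0 (u 0%N)) _; have := uK 0%N; rewrite mulr1.
have cgeo : cvgn (series (fun m => K * q ^+ m) : nat -> R).
  by apply: is_cvg_geometric_series; rewrite ger0_norm.
have H (s : nat -> R) : (forall m, `|s m| <= cn (u m)) -> cvgn (series s).
  move=> sm; apply: normed_cvg; apply: series_le_cvg cgeo.
  - by move=> m /=; exact: normr_ge0.
  - by move=> m; rewrite mulr_ge0 ?exprn_ge0.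
  - by move=> m; exact: le_trans (sm m) (uK m).
have cR := H _ (fun m => cn_Re (u m)); have cI := H _ (fun m => cn_Im (u m)).
have ReS n : complex.Re (series u n) = series (fun m => complex.Re (u m)) n.
  rewrite /series /=; apply: (big_morph (@complex.Re R)) => //.
  by move=> [? ?] [? ?].
have ImS n : complex.Im (series u n) = series (fun m => complex.Im (u m)) n.
  rewrite /series /=; apply: (big_morph (@complex.Im R)) => //.
  by move=> [? ?] [? ?].
pose l : R[i] := limn (series (fun m => complex.Re (u m))) +i*
                 limn (series (fun m => complex.Im (u m))).
have cl : (series u : nat -> (R[i])^o) @ \oo --> (l : (R[i])^o).
  by apply: ReIm_cvg => /=; [under eq_fun do rewrite ReS|under eq_fun do rewrite ImS].
exists l => // M; apply/ler_addgt0Pr => e e0.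
have clP : \forall n \near \oo, cn (series u n - l) < e.
  exact: (proj1 (@cvgcP R nat \oo _ _ _)) cl e e0.
near \oo => n.
have Mn : (M <= n)%N by near: n; exact: nbhs_infty_ge.
have ne : cn (series u n - l) < e by near: n.
have -> : l - \sum_(i < M) u i = \sum_(M <= i < n) u i - (series u n - l).
  by rewrite /series /= -(big_mkord predT u) (big_cat_nat (leq0n M) Mn) /=; ring.
apply: le_trans (cnB _ _) _; apply: lerD (ltW ne).
apply: le_trans (cn_sum _ _ _) _.
apply: le_trans (ler_sum _ (fun i _ => uK i)) _.
by rewrite -mulr_sumr mulrAC -mulrA ler_wpM2l // geo_sum_le.
Unshelve. all: by end_near. Qed.

Definition psum v z : R[i] := limn (series (fun m : nat => v m * z ^+ m : (R[i])^o)).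

Lemma c_lim_unique (s : nat -> R[i]) (l : R[i]) :
  (s : nat -> (R[i])^o) @ \oo --> (l : (R[i])^o) -> limn (s : nat -> (R[i])^o) = l.
Proof. by move=> sl; apply/cvg_lim. Qed.

Lemma psum_term v (C rho q : R) z : (forall m, cn (v m) <= C * rho ^+ m) ->
  0 <= C -> 0 <= rho -> cn z * rho <= q -> forall m, cn (v m * z ^+ m) <= C * q ^+ m.
Proof.
move=> vC C0 r0 zq m; rewrite cnM cnX.
apply: le_trans (ler_wpM2r (exprn_ge0 m (cn_ge0 z)) (vC m)) _.
rewrite -mulrA ler_wpM2l // -exprMn mulrC lerXn2r ?nnegrE ?mulr_ge0 ?cn_ge0 //.
by apply: le_trans zq; rewrite mulr_ge0 ?cn_ge0.
Qed.

Lemma psum_cvg v (C rho q : R) z : (forall m, cn (v m) <= C * rho ^+ m) ->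
  0 <= C -> 0 <= rho -> cn z * rho <= q -> q < 1 ->
  (series (fun m : nat => v m * z ^+ m) : nat -> (R[i])^o) @ \oo --> (psum v z : (R[i])^o) /\
  forall M : nat, cn (psum v z - \sum_(i < M) v i * z ^+ i) <= C / (1 - q) * q ^+ M.
Proof.
move=> vC C0 r0 zq q1.
have q0 : 0 <= q by apply: le_trans zq; rewrite mulr_ge0 ?cn_ge0.
have [l cl Hl] := cseries_cvg q0 q1 (psum_term vC C0 r0 zq).
by rewrite /psum (c_lim_unique cl); split.
Qed.

(** The second-order remainder of z^m; the factor S^2 on the left avoids the
    exponent m - 2. *)
Lemma expand2_le (z h : R[i]) (S : R) (m : nat) : cn z <= S -> cn (z + h) <= S ->
  cn ((z + h) ^+ m - z ^+ m - m%:R * z ^+ m.-1 * h) * S ^+ 2 <=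
  m%:R ^+ 2 * S ^+ m * cn h ^+ 2.
Proof.
move=> zS zhS; have S0 : 0 <= S by apply: le_trans zS; exact: cn_ge0.
elim: m => [|m IH].
  by rewrite !expr0 subrr !mul0r subr0 cn0 expr0n /= !mul0r.
set D := _ - _ - _ in IH.
have -> : (z + h) ^+ m.+1 - z ^+ m.+1 - m.+1%:R * z ^+ m.+1.-1 * h =
    (z + h) * D + m%:R * z ^+ m.-1 * h ^+ 2.
  rewrite /D /= -natr1; case: m {D IH} => [|m] /=; first by rewrite expr1 expr0; ring.
  by rewrite !exprS; ring.
have b1 : cn ((z + h) * D) * S ^+ 2 <= S * (m%:R ^+ 2 * S ^+ m * cn h ^+ 2).
  by rewrite cnM -mulrA; apply: ler_pM IH; rewrite ?cn_ge0 // mulr_ge0 ?cn_ge0 ?exprn_ge0.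
have b2 : cn (m%:R * z ^+ m.-1 * h ^+ 2) * S ^+ 2 <= m%:R * S ^+ m.+1 * cn h ^+ 2.
  rewrite (cnM _ (h ^+ 2)) (cnM m%:R) cn_nat !cnX mulrAC ler_wpM2r ?exprn_ge0 ?cn_ge0 // -mulrA.
  case: m {D IH b1} => [|m]; first by rewrite !mul0r.
  rewrite ler_wpM2l //= -[m.+2]addn2 exprD ler_wpM2r ?exprn_ge0 //.
  by rewrite lerXn2r ?nnegrE ?cn_ge0.
apply: le_trans (ler_wpM2r (exprn_ge0 2 S0) (cnD _ _)) _; rewrite mulrDl.
apply: le_trans (lerD b1 b2) _.
have : 0 <= (m%:R + 1) * (S ^+ m.+1 * cn h ^+ 2).
  by rewrite mulr_ge0 ?addr_ge0 // mulr_ge0 ?exprn_ge0 ?cn_ge0.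
by rewrite -natr1 exprS; nra.
Qed.

(** Term-by-term differentiation: the second-order remainders of the terms add up
    to a bound quadratic in the increment. *)
Lemma psum_cder v (C rho : R) z : (forall m, cn (v m) <= C * rho ^+ m) ->
  0 <= C -> 0 < rho -> cn z * rho < 1 -> exists d, cder (psum v) z d.
Proof.
move=> vC C0 r0 zr.
(* A radius between that of z and the radius of convergence. *)
pose S := (cn z + rho^-1) / 2.
have zri : cn z < rho^-1 by rewrite -div1r ltr_pdivlMr.
have zS : cn z < S by rewrite /S; lra.
have Sr : S < rho^-1 by rewrite /S; lra.
have S0 : 0 < S by exact: le_lt_trans (cn_ge0 z) zS.
pose q0 := S * rho; have q00 : 0 < q0 by rewrite mulr_gt0.
have q01 : q0 < 1 by rewrite /q0 -ltr_pdivlMr // div1r.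
pose q := (q0 + 1) / 2; have q0q : q0 < q by rewrite /q; lra.
have q1 : q < 1 by rewrite /q; lra.
have q_0 : 0 <= q by apply: ltW; apply: lt_trans q0q.
have [K1 K10 HK1] := poly_geo 1 (ltW q00) q0q.
have [K2 K20 HK2] := poly_geo 2 (ltW q00) q0q.
(* The derived series. *)
have [d cd _] : exists2 d : R[i],
    (series (fun m => v m * (m%:R * z ^+ m.-1)) : nat -> (R[i])^o) @ \oo --> (d : (R[i])^o) &
    forall M : nat, cn (d - \sum_(i < M) v i * (i%:R * z ^+ i.-1)) <= (C * K1 / S) / (1 - q) * q ^+ M.
  apply: cseries_cvg => // m; rewrite !cnM cn_nat cnX.
  apply: le_trans (ler_wpM2r _ (vC m)) _; first by rewrite mulr_ge0 ?exprn_ge0 ?cn_ge0.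
  rewrite -!mulrA ler_wpM2l //.
  rewrite -(ler_pM2l S0).
  have -> : S * (K1 * (S^-1 * q ^+ m)) = K1 * q ^+ m by field; rewrite gt_eqF.
  apply: le_trans (HK1 m); rewrite expr1.
  case: m => [|m]; first by rewrite !(mul0r, mulr0).
  have -> : S * (rho ^+ m.+1 * (m.+1%:R * cn z ^+ m.+1.-1)) =
    m.+1%:R * (S * cn z ^+ m * rho ^+ m.+1) by rewrite /=; ring.
  rewrite ler_wpM2l // /q0 exprMn ler_wpM2r ?exprn_ge0 ?(ltW r0) // exprS ler_pM2l //.
  by rewrite lerXn2r ?nnegrE ?cn_ge0 ?(ltW S0) ?(ltW zS).
exists d => e e0.
pose K := C * K2 / S ^+ 2 / (1 - q).
have K0 : 0 <= K.
  rewrite /K; apply: divr_ge0; last by rewrite subr_ge0 ltW.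
  by apply: divr_ge0; [exact: mulr_ge0|rewrite exprn_ge0 ?(ltW S0)].
exists (Num.min (S - cn z) (e / (K + 1))).
  by rewrite lt_min subr_gt0 zS divr_gt0 // ltr_wpDl.
move=> h; rewrite lt_min => /andP[h1 h2].
have zhS : cn (z + h) <= S by apply: le_trans (cnD _ _) _; lra.
have sr a : cn a <= S -> cn a * rho <= q0 by move=> aS; rewrite ler_wpM2r // ltW.
have [c1 _] := psum_cvg vC C0 (ltW r0) (sr _ zhS) q01.
have [c2 _] := psum_cvg vC C0 (ltW r0) (sr _ (ltW zS)) q01.
pose t m := v m * ((z + h) ^+ m - z ^+ m - m%:R * z ^+ m.-1 * h).
have tb m : cn (t m) <= (C * K2 / S ^+ 2 * cn h ^+ 2) * q ^+ m.
  rewrite /t (cnM (v m)).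
  apply: le_trans (ler_wpM2r (cn_ge0 _) (vC m)) _.
  have S2 : 0 < S ^+ 2 by rewrite exprn_gt0.
  rewrite -(ler_pM2r S2) -mulrA.
  apply: le_trans (ler_wpM2l _ (expand2_le m (ltW zS) zhS)) _.
    by rewrite mulr_ge0 // exprn_ge0 // ltW.
  have -> : C * K2 / S ^+ 2 * cn h ^+ 2 * q ^+ m * S ^+ 2 =
     C * (K2 * q ^+ m) * cn h ^+ 2 by field; rewrite gt_eqF.
  have -> : C * rho ^+ m * (m%:R ^+ 2 * S ^+ m * cn h ^+ 2) =
    C * (m%:R ^+ 2 * q0 ^+ m) * cn h ^+ 2.
    have -> : q0 ^+ m = S ^+ m * rho ^+ m by exact: exprMn.
    by move: (S ^+ m) (rho ^+ m) (m%:R ^+ 2) (cn h ^+ 2) => a b c a'; ring.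
  by rewrite ler_wpM2r ?exprn_ge0 ?cn_ge0 // ler_wpM2l.
have [l cl Hl] := cseries_cvg q_0 q1 tb.
have lE : l = psum v (z + h) - psum v z - d * h.
  apply/esym; rewrite -(c_lim_unique cl); apply/esym/c_lim_unique.
  have -> : series t = (fun n => series (fun m => v m * (z + h) ^+ m) n -
     series (fun m => v m * z ^+ m) n -
     series (fun m => v m * (m%:R * z ^+ m.-1)) n * h).
    apply/funext => n; rewrite /series /= mulr_suml -!sumrB; apply: eq_bigr => i _.
    by rewrite /t; ring.
  apply: cvgB; first exact: cvgB c1 c2.
  by apply: cvgM cd _; exact: cvg_cst.
rewrite -lE; have := Hl 0%N; rewrite big_ord0 subr0 expr0 mulr1 => /le_trans; apply.
rewrite expr2 mulrA mulrAC ler_wpM2r ?cn_ge0 // mulrAC -/K.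
apply: le_trans (_ : (K + 1) * cn h <= _).
  by rewrite ler_wpM2r ?cn_ge0 // lerDl.
by rewrite mulrC -ler_pdivlMr ?ltW // ltr_wpDl.
Qed.

End PowerSeries.

(** * Boundary values of the Wiener-Hopf factors *)

Section Factorization.
Variable R : realType.
Implicit Types (x y q : R) (z w d : R[i]) (f g h G : R[i] -> R[i]) (v u : nat -> R[i]).

Lemma geo_le0 (x K r : R) : 0 <= r -> r < 1 -> (forall M : nat, x <= K * r ^+ M) -> x <= 0.
Proof.
move=> r0 r1 H; have r1' : `|r| < 1 by rewrite ger0_norm.
have c : (fun M : nat => K * r ^+ M) @ \oo --> K * 0.
  by apply: cvgM; [exact: cvg_cst|exact: cvg_expr].
rewrite mulr0 in c; rewrite -(cvg_lim (@Rhausdorff R) c).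
by apply: limr_ge; [exact: cvgP c|exact: nearW].
Qed.

Lemma cgeo_eq (z w : R[i]) (K r : R) : 0 <= r -> r < 1 ->
  (forall M : nat, cn (z - w) <= K * r ^+ M) -> z = w.
Proof.
move=> r0 r1 H; apply/eqP; rewrite -subr_eq0 -cn_eq0 eq_le cn_ge0 andbT.
exact: geo_le0 r0 r1 H.
Qed.

(** Eventual version: the first few bounds may fail. *)
Lemma cgeo_eq_ev (z w : R[i]) (K r : R) (M0 : nat) : 0 <= K -> 0 < r -> r < 1 ->
  (forall M : nat, (M0 <= M)%N -> cn (z - w) <= K * r ^+ M) -> z = w.
Proof.
move=> K0 r0 r1 H; apply: (cgeo_eq (K := K) (ltW r0) r1) => M.
apply: le_trans (H (M0 + M)%N (leq_addr _ _)) _.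
by rewrite ler_wpM2l // exprD ler_piMl ?exprn_ge0 ?exprn_ile1 ?ltW.
Qed.

(** Coefficients extended by zero to the negative integers. *)
Definition ext v (k : int) : R[i] := if k is Posz n then v n else 0.

(** The sign s allows for power series in z and in 1/z. By orthogonality, the
    coefficients of the partial sums stabilise once M exceeds the index. *)
Lemma fourier_of_expand g v (s : int) (C r : R) : ccirc g -> 0 < r -> r < 1 -> 0 <= C ->
  s * s = 1 ->
  (forall x (M : nat), cn (g (circ x) - \sum_(i < M) v i * circ x ^ (s * i%:Z)) <= C * r ^+ M) ->
  forall m : int, fourier g m = ext v (s * m).
Proof.
move=> cg r0 r1 C0 ss Ex m.
have cg1 : ccirc (fun=> 1 : R[i]) by exact: ccirc_cst.
have H M : cn (fourier g m - \sum_(i < M) v i * (m - s * i%:Z == 0)%:R) <= 2 * C * r ^+ M.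
  have := fourier_mul_expand (B := 1) (E := C * r ^+ M) m cg1 cg _ (fun x => Ex x M).
  rewrite mul1r mulrA => /(_ _).
  rewrite (_ : fourier (fun z => 1 * g z) m = fourier g m); last first.
    by apply: eq_fourier => x; rewrite mul1r.
  under eq_bigr => i _ do rewrite fourier_cst mul1r.
  by apply=> x; rewrite cn1.
apply: (cgeo_eq_ev (K := 2 * C) (r := r) (M0 := `|s * m|.+1)) => //.
  by rewrite mulr_ge0.
move=> M MM; apply: le_trans (H M); rewrite le_eqVlt; apply/orP; left; apply/eqP.
congr (cn (_ - _)); rewrite /ext.
have E i : (m - s * i%:Z == 0) = (s * m == i%:Z).
  have {1}-> : m = s * (s * m) by rewrite mulrA ss mul1r.
  rewrite -mulrBr mulf_eq0 subr_eq0; case: eqP ss => [->|//].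
  by rewrite mul0r => /eqP.
under eq_bigr => i _ do rewrite E.
case: (s * m) MM => n MM.
  rewrite /= in MM; rewrite (bigD1 (Ordinal MM)) //= eqxx mulr1 big1 ?addr0 // => i.
  by rewrite -val_eqE /= => ni; rewrite eqz_nat eq_sym (negbTE ni) mulr0.
by rewrite big1 // => i _; rewrite mulr0.
Qed.

Variables (lf : R[i] -> R[i]) (C rho : R).
Hypotheses (C0 : 0 <= C) (rho0 : 0 < rho) (rho1 : rho < 1).
Let vp (n : nat) := fourier lf n%:Z.
Let vm (n : nat) := fourier lf (- n.+1%:Z).
Hypotheses (Hvp : forall n, cn (vp n) <= C * rho ^+ n)
  (Hvm : forall n, cn (vm n) <= C * rho ^+ n).

(** The exponentials of c times the two halves of the Laurent series of lf, the
    second one in the variable 1/z. For c = 1 they are the Wiener-Hopf factors of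
    exp lf, for c = -1 the inverses of these; alpha is gplus (-1) inside the unit
    disc and gminus 1 at 1/z outside. *)
Definition gplus (c : R[i]) z : R[i] := cexp (c * psum (fun n => fourier lf n%:Z) z).
Definition gminus (c : R[i]) z : R[i] :=
  cexp (c * (z * psum (fun n => fourier lf (- n.+1%:Z)) z)).

Let R1 := rho^-1.
Let R11 : 1 < R1. Proof. by rewrite -invr1 ltf_pV2 ?posrE. Qed.
Let inR1 z : cn z < R1 -> cn z * rho < 1.
Proof. by rewrite /R1 -div1r -ltr_pdivlMr. Qed.

Lemma gplus_cder c z : cn z < R1 -> exists d, cder (gplus c) z d.
Proof.
move=> /inR1 zr; have [d pd] := psum_cder Hvp C0 rho0 zr.
have [d1 h1] := cder_comp pd (cder_affine c 0 _).
have [d2 h2] := cder_comp h1 (cder_cexp _); exists d2; apply: cder_eq h2 => w.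
by rewrite addr0.
Qed.

Lemma gminus_cder c z : cn z < R1 -> exists d, cder (gminus c) z d.
Proof.
move=> /inR1 zr; have [d pd] := psum_cder Hvm C0 rho0 zr.
have [d' pd'] := cderM (cder_affine 1 0 z) pd.
have [d1 h1] := cder_comp pd' (cder_affine c 0 _).
have [d2 h2] := cder_comp h1 (cder_cexp _); exists d2; apply: cder_eq h2 => w.
by rewrite !addr0 mul1r.
Qed.

Let psum_le v z : (forall n, cn (v n) <= C * rho ^+ n) -> cn z <= 1 ->
  cn (psum v z) <= C / (1 - rho).
Proof.
move=> Hv z1; have zr : cn z * rho <= rho by rewrite ler_piMl ?(ltW rho0).
have [_ /(_ 0%N)] := psum_cvg Hv C0 (ltW rho0) zr rho1.
by rewrite big_ord0 subr0 mulr1.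
Qed.

Let cexp_le (c z : R[i]) (B : R) : cn c <= 1 -> cn z <= B -> cn (cexp (c * z)) <= expR B.
Proof.
move=> c1 zB; rewrite cn_cexp ler_expR.
apply: le_trans (ler_norm _) _; apply: le_trans (cn_Re _) _.
by rewrite cnM; apply: le_trans zB; rewrite ler_piMl ?cn_ge0.
Qed.

Lemma gplus_le c z : cn c <= 1 -> cn z <= 1 -> cn (gplus c z) <= expR (C / (1 - rho)).
Proof. by move=> c1 z1; apply: cexp_le => //; exact: psum_le. Qed.

Lemma gminus_le c z : cn c <= 1 -> cn z <= 1 -> cn (gminus c z) <= expR (C / (1 - rho)).
Proof.
move=> c1 z1; apply: cexp_le => //; rewrite cnM.
by apply: le_trans (psum_le Hvm z1); rewrite ler_piMl ?cn_ge0.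
Qed.

(** Points of the circle are limits of points of both regions, so that the limits
    defining alpha_bv are unique. *)
Lemma ball_annulus_proper (b : bool) x :
  ProperFilter (within (if b then [set w : (R[i])^o | `|w| < 1] else [set w : (R[i])^o | 1 < `|w|])
     (nbhs (circ x : (R[i])^o))).
Proof.
apply: within_nbhs_proper => B /near_cP[dl dl0 H].
(* Radial approach. *)
pose e := Num.min (1 / 2) (dl / 2).
have e0 : 0 < e by rewrite lt_min !divr_gt0.
have e1 : e < 1 by rewrite gt_min; apply/orP; left; lra.
have ed : e < dl by rewrite gt_min; apply/orP; right; lra.
have [t [t0 tb td]] : exists t : R, [/\ 0 < t, if b then t < 1 else 1 < t & `|t - 1| < dl].
  case: b; [exists (1 - e)|exists (1 + e)]; split; try lra.
    by rewrite ler0_norm; lra.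
  by rewrite ger0_norm; lra.
have tn : cn (t%:C * circ x) = t by rewrite cnM cn_real cn_circ mulr1 gtr0_norm.
exists (t%:C * circ x); split.
  by case: b tb => tb /=; rewrite cnE tn ltcR.
apply: H; rewrite -[X in _ - X]mul1r -mulrBl -(rmorph1 (real_complex R)) -rmorphB.
by rewrite cnM cn_real cn_circ mulr1.
Qed.

(** From either side, alpha coincides with a function that is holomorphic, hence
    continuous, across the circle. *)
Lemma alpha_bv_plus x : alpha_bv lf 1 (circ x) = gplus (-1) (circ x).
Proof.
rewrite /alpha_bv; have PF := ball_annulus_proper true x.
have zR : cn (circ x) < R1 by rewrite cn_circ.
have [d /cder_cvg cG] := gplus_cder (-1) zR.
apply: (@cvg_lim (R[i])^o); first exact: norm_hausdorff.
have cG' := @cvg_within_filter _ _ _ _ (nbhs_filter (circ x : (R[i])^o)) _ [set w : (R[i])^o | `|w| < 1] cG.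
apply: (cvg_trans _ cG').
apply: (@fmap_within_eq (R[i])^o _ (R[i])^o (nbhs (circ x : (R[i])^o))
  (alpha lf) (gplus (-1))) => w; rewrite inE /= => w1.
by rewrite /alpha w1 /gplus mulN1r.
Qed.

Lemma alpha_bv_minus x : alpha_bv lf (- 1) (circ x) = gminus 1 (circ x)^-1.
Proof.
rewrite /alpha_bv; have PF := ball_annulus_proper false x.
have zR : cn (circ x)^-1 < R1 by rewrite cnV cn_circ invr1.
have [d /cder_cvg cG] := gminus_cder 1 zR.
apply: (@cvg_lim (R[i])^o); first exact: norm_hausdorff.
have cI : ((fun w : R[i] => w^-1) : (R[i])^o -> (R[i])^o) @ (circ x : (R[i])^o) --> ((circ x)^-1 : (R[i])^o).
  exact: (@inv_continuous R[i] (circ x) (circ_neq0 x)).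
have cG' := @cvg_within_filter _ _ _ _ (nbhs_filter (circ x : (R[i])^o)) _ [set w : (R[i])^o | 1 < `|w|] (cvg_comp _ _ cI cG).
apply: (cvg_trans _ cG').
apply: (@fmap_within_eq (R[i])^o _ (R[i])^o (nbhs (circ x : (R[i])^o))
  (alpha lf) (fun w => gminus 1 w^-1)) => w; rewrite inE /= => w1.
rewrite /alpha (lt_gtF w1) /gminus mul1r; congr cexp.
have wr : cn w^-1 * rho <= rho.
  rewrite ler_piMl ?(ltW rho0) // cnV invf_le1.
    by rewrite cnE ltcR in w1; exact: ltW.
  by rewrite cnE ltcR in w1; apply: lt_trans w1.
have [c1 _] := psum_cvg Hvm C0 (ltW rho0) wr rho1.
apply: c_lim_unique.
rewrite (_ : series _ = fun n => w^-1 * series (fun m => vm m * w^-1 ^+ m) n).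
  by apply: cvgM c1; exact: cvg_cst.
apply/funext => n; rewrite /series /= mulr_sumr; apply: eq_bigr => i _.
by rewrite /vm mulrCA -exprS exprVn.
Qed.

End Factorization.

(** * Regularised double integrals *)

Section DoubleIntegral.
Variable R : realType.
Implicit Types (x y q eta : R) (z w s : R[i]) (f g h : R[i] -> R[i]) (e : int).

Lemma oint_fourier g : oint g = (2 * 'i%C * pi%:C) * fourier g (-1).
Proof.
rewrite /fourier mulrC mulfVK; last first.
  by rewrite twoipiE mulf_neq0 ?pi2_neq0 ?ci_neq0.
rewrite !ointE; apply: eq_cint => x _.
by rewrite addNr expr0z divr1.
Qed.

Lemma geo_kernel (u v : R[i]) (J : nat) : v != 0 -> u != v ->
  (u - v)^-1 + \sum_(j < J) u ^+ j * v ^- j.+1 = u ^+ J * v ^- J * (u - v)^-1.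
Proof.
move=> v0 uv; have d0 : u - v != 0 by rewrite subr_eq0.
elim: J => [|J IH]; first by rewrite big_ord0 addr0 !expr0 invr1 !mul1r.
rewrite big_ord_recr /= addrA IH !exprS; field.
by rewrite v0 d0 expf_neq0.
Qed.

(** Exponents of w in the geometric expansion of the kernel 1 / (w - s):
    nonnegative for e = 1, where w is inside the circle, and negative for e = -1,
    where w is outside. *)
Definition kernel_exp e (j : nat) : int := if e == 1 then j%:Z else - j.+1%:Z.

(** The ratio of that geometric expansion. *)
Definition kernel_ratio e eta : R := if e == 1 then 1 - eta else (1 + eta)^-1.

Lemma kernel_expand e eta z s (J : nat) : e = 1 \/ e = -1 -> 0 < eta < 1 ->
  cn z = 1 -> cn s = 1 -> let w := z * (1 - e%:~R * eta%:C) in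
  w != s /\
  cn ((w - s)^-1 + e%:~R * \sum_(j < J) w ^ kernel_exp e j * s ^ (-1 - kernel_exp e j)) <= kernel_ratio e eta ^+ J / eta.
Proof.
move=> ee /andP[e0 e1] z1 s1 w.
have s0 : s != 0 by rewrite -cn_gt0 s1.
have wE : cn w = 1 - e%:~R * eta.
  rewrite cnM z1 mul1r (_ : 1 - _ = (1 - e%:~R * eta)%:C).
    by rewrite cn_real ger0_norm //; case: ee => ->; lra.
  by rewrite rmorphB rmorphM rmorph1 rmorph_int.
(* The circles containing w and s are at distance eta. *)
have dl : eta <= cn (w - s).
  have h1 := cnD (w - s) s; have h2 := cnD (s - w) w.
  rewrite subrK in h1; rewrite subrK cnBC in h2.
  by case: ee wE => -> wE; lra.
have ws : w != s by rewrite -subr_eq0 -cn_gt0; apply: lt_le_trans dl.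
have w0 : w != 0 by rewrite -cn_gt0 wE; case: ee => ->; lra.
split=> //.
have dli : cn (w - s)^-1 <= eta^-1.
  by rewrite cnV lef_pV2 ?posrE //; apply: lt_le_trans dl.
case: ee wE => -> wE.
  have -> : \sum_(j < J) w ^ kernel_exp 1 j * s ^ (-1 - kernel_exp 1 j) = \sum_(j < J) w ^+ j * s ^- j.+1.
    apply: eq_bigr => j _; rewrite /kernel_exp /=; congr (_ * _).
    by rewrite exprnN; congr (_ ^ _); lia.
  rewrite mul1r geo_kernel // (cnM _ (w - s)^-1) (cnM (w ^+ J)) cnV !cnX s1 expr1n invr1 mulr1.
  rewrite wE /kernel_ratio /= mul1r.
  by apply: ler_pM => //; rewrite ?cn_ge0 // exprn_ge0 //; lra.
have -> : \sum_(j < J) w ^ kernel_exp (-1) j * s ^ (-1 - kernel_exp (-1) j) = \sum_(j < J) s ^+ j * w ^- j.+1.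
  apply: eq_bigr => j _; rewrite /kernel_exp /= mulrC; congr (_ * _).
  by rewrite exprnP; congr (_ ^ _); lia.
have := geo_kernel J w0 (_ : s != w); rewrite eq_sym => /(_ ws) G.
have -> : (w - s)^-1 = - (s - w)^-1 by rewrite -invrN opprB.
rewrite mulN1r -opprD G cnN (cnM _ (s - w)^-1) (cnM (s ^+ J)) (cnV (w ^+ J)) !cnX.
rewrite s1 expr1n mul1r wE /kernel_ratio /= mulN1r opprK -exprVn.
rewrite -opprB invrN cnN; apply: ler_pM => //; rewrite ?cn_ge0 // exprn_ge0 //.
by rewrite invr_ge0; lra.
Qed.

Lemma kernel_ratio_lt1 e eta : e = 1 \/ e = -1 -> 0 < eta < 1 -> 0 < kernel_ratio e eta < 1.
Proof.
move=> [->|->] /andP[e0 e1]; rewrite /kernel_ratio /=; first by apply/andP; split; lra.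
by rewrite invr_gt0 invf_lt1 //; [apply/andP; split; lra|lra].
Qed.

(** The inner integral, over s. *)
Definition inner e eta h z : R[i] :=
  fourier (fun s => (z * (1 - e%:~R * eta%:C) - s)^-1 * h s) (-1).

Let ccker e eta h z : e = 1 \/ e = -1 -> 0 < eta < 1 -> cn z = 1 -> ccirc h ->
  ccirc (fun s => (z * (1 - e%:~R * eta%:C) - s)^-1 * h s).
Proof.
move=> ee eb z1 ch; apply: ccircM ch; apply: ccircV.
  by apply: ccircB; [exact: ccirc_cst|exact: ccirc_id].
move=> x; rewrite subr_eq0.
by have [] := kernel_expand 0 ee eb z1 (@cn_circ R x).
Qed.

(** Integrating the expansion of the kernel against h picks one Fourier
    coefficient of h per term. *)
Lemma inner_expand e eta h (B : R) z (J : nat) : e = 1 \/ e = -1 -> 0 < eta < 1 ->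
  cn z = 1 -> ccirc h -> (forall x, cn (h (circ x)) <= B) ->
  cn (inner e eta h z + e%:~R * \sum_(j < J)
     (z * (1 - e%:~R * eta%:C)) ^ kernel_exp e j * fourier h (kernel_exp e j)) <=
  2 * (kernel_ratio e eta ^+ J / eta * B).
Proof.
move=> ee eb z1 ch hB; set w := z * _.
have cs (j : 'I_J) : ccirc (fun s => w ^ kernel_exp e j * (h s * s ^ (-1 - kernel_exp e j))).
  by apply: ccircM (ccircM ch (@ccirc_exprz R _)); exact: ccirc_cst.
have cS : ccirc (fun s => e%:~R * \sum_(j < J) w ^ kernel_exp e j * (h s * s ^ (-1 - kernel_exp e j))).
  by apply: ccircM; [exact: ccirc_cst|exact: ccirc_sum].
have -> : e%:~R * \sum_(j < J) w ^ kernel_exp e j * fourier h (kernel_exp e j) =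
   fourier (fun s => e%:~R * \sum_(j < J) w ^ kernel_exp e j * (h s * s ^ (-1 - kernel_exp e j))) (-1).
  rewrite fourierZ; last exact: ccirc_sum.
  rewrite fourier_sum //; congr (_ * _); apply: eq_bigr => j _.
  rewrite fourierZ; last exact: ccircM ch (@ccirc_exprz R _).
  by rewrite fourier_shift //; congr (_ * fourier _ _); lia.
rewrite /inner -fourierD //; last exact: ccker.
apply: fourier_le; first by apply: ccircD cS; exact: ccker.
move=> x; have [_ H] := kernel_expand J ee eb z1 (@cn_circ R x).
rewrite -/w in H *.
have -> : (w - circ x)^-1 * h (circ x) +
    e%:~R * (\sum_(j < J) w ^ kernel_exp e j * (h (circ x) * circ x ^ (-1 - kernel_exp e j))) =
   ((w - circ x)^-1 + e%:~R * \sum_(j < J) w ^ kernel_exp e j * circ x ^ (-1 - kernel_exp e j)) * h (circ x).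
  rewrite mulrDl -mulrA; congr (_ + _ * _).
  by rewrite mulr_suml; apply: eq_bigr => j _; ring.
by rewrite cnM; apply: ler_pM; rewrite ?cn_ge0.
Qed.

(** At fixed eta the denominator stays away from 0, so the kernel is Lipschitz in
    its outer variable. *)
Lemma inner_ccirc e eta h : e = 1 \/ e = -1 -> 0 < eta < 1 -> ccirc h ->
  ccirc (inner e eta h).
Proof.
move=> ee eb ch; have [B B0 hB] := ccirc_bounded ch.
have eta0 : 0 < eta by case/andP: eb.
split=> a b; split=> x _.
suff : ((fun t => inner e eta h (circ t)) : R -> (R[i])^o) @ x -->
    (inner e eta h (circ x) : (R[i])^o) by [].
apply/cvgcP => e' e'0.
pose L := 2 * (2 * eta^-1 * eta^-1 * B) + 1.
have L0 : 0 < L by rewrite ltr_wpDl // !mulr_ge0 ?invr_ge0 // ltW.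
have ct : \forall t \near x, cn (circ t - circ x) < e' / L.
  by apply: (proj1 (@cvgcP R R (nbhs x) _ _ _)) (@circ_cvg R x) _ _; exact: divr_gt0.
apply: filterS ct => t tx; rewrite /inner -fourierB; try by apply: ccker; rewrite ?cn_circ.
set c := 1 - _; set w := circ t * c; set w' := circ x * c.
apply: le_lt_trans (fourier_le (M := 2 * eta^-1 * eta^-1 * B * cn (circ t - circ x)) _ _ _) _.
- by apply: ccircB; apply: ccker; rewrite ?cn_circ.
- move=> y.
  have [n1 H1] := kernel_expand 0 ee eb (@cn_circ R t) (@cn_circ R y).
  have [n2 H2] := kernel_expand 0 ee eb (@cn_circ R x) (@cn_circ R y).
  rewrite big_ord0 mulr0 addr0 expr0 mul1r -/c -/w in n1 H1.
  rewrite big_ord0 mulr0 addr0 expr0 mul1r -/c -/w' in n2 H2.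
  rewrite -subr_eq0 in n1; rewrite -subr_eq0 in n2.
  have -> : (w - circ y)^-1 * h (circ y) - (w' - circ y)^-1 * h (circ y) =
     (w - circ y)^-1 * (w' - circ y)^-1 * h (circ y) * (c * (circ x - circ t)).
    by rewrite /w /w' in n1 n2 *; field; rewrite n1 n2.
  rewrite (cnM _ (c * _)) (cnM _ (h _)) (cnM (w - _)^-1) (cnM c) (cnBC (circ x)) mulrA.
  have c2 : cn c <= 2.
    have -> : c = (1 - e%:~R * eta)%:C.
      by rewrite rmorphB rmorphM rmorph1 rmorph_int.
    rewrite cn_real ler_norml; case/andP: eb => b1 b2.
    by case: ee => ->; apply/andP; split; lra.
  have inv_le u : eta <= cn u -> cn u^-1 <= eta^-1.
    by move=> uu; rewrite cnV lef_pV2 ?posrE //; apply: lt_le_trans uu.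
  have -> : 2 * eta^-1 * eta^-1 * B = eta^-1 * eta^-1 * B * 2 by ring.
  have ei : 0 <= eta^-1 by rewrite invr_ge0 ltW.
  rewrite ler_wpM2r ?cn_ge0 //; apply: ler_pM; rewrite ?mulr_ge0 ?cn_ge0 //.
  by apply: ler_pM; rewrite ?mulr_ge0 ?cn_ge0 //; apply: ler_pM; rewrite ?cn_ge0.
rewrite mulrA; apply: (@le_lt_trans _ _ (L * cn (circ t - circ x))).
  by rewrite ler_wpM2r ?cn_ge0 // /L lerDl.
by rewrite mulrC -ltr_pdivlMr.
Qed.

(** Inserting the expansion of the kernel into both integrals leaves a geometric
    error; if only finitely many terms are nonzero the identity is exact. *)
Lemma outer_eval e eta g h (J0 : nat) : e = 1 \/ e = -1 -> 0 < eta < 1 ->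
  ccirc g -> ccirc h ->
  (forall j, (J0 <= j)%N -> fourier g (-1 - kernel_exp e j) * fourier h (kernel_exp e j) = 0) ->
  fourier (fun z => g z * inner e eta h z) (-1) = - e%:~R *
  \sum_(j < J0) (1 - e%:~R * eta%:C) ^ kernel_exp e j *
     (fourier g (-1 - kernel_exp e j) * fourier h (kernel_exp e j)).
Proof.
move=> ee eb cg ch van; have [Bh Bh0 hB] := ccirc_bounded ch.
have [Bg Bg0 gB] := ccirc_bounded cg.
have eta0 : 0 < eta by case/andP: eb.
have /andP[q0 q1] := kernel_ratio_lt1 ee eb.
have ci := inner_ccirc ee eb ch.
set c := 1 - _.
pose P j := c ^ kernel_exp e j * (fourier g (-1 - kernel_exp e j) * fourier h (kernel_exp e j)).
apply: (cgeo_eq_ev (K := 2 * (Bg * (2 * (eta^-1 * Bh)))) (r := kernel_ratio e eta) (M0 := J0)) => //.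
  by rewrite !mulr_ge0 // invr_ge0 ltW.
move=> J JJ.
have -> : \sum_(j < J0) c ^ kernel_exp e j * (fourier g (-1 - kernel_exp e j) * fourier h (kernel_exp e j)) =
    \sum_(j < J) P j.
  rewrite -[RHS](big_mkord predT P) (big_cat_nat (leq0n J0) JJ) /= big_mkord.
  rewrite [X in _ + X]big_nat_cond [X in _ + X]big1 ?addr0 // => j /andP[/andP[j1 _] _].
  by rewrite /P van // mulr0.
have cs (j : 'I_J) : ccirc (fun z => (c ^ kernel_exp e j * fourier h (kernel_exp e j)) * (g z * z ^ kernel_exp e j)).
  by apply: ccircM (ccircM cg (@ccirc_exprz R _)); exact: ccirc_cst.
have cS : ccirc (fun z => e%:~R * \sum_(j < J) (c ^ kernel_exp e j * fourier h (kernel_exp e j)) * (g z * z ^ kernel_exp e j)).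
  by apply: ccircM; [exact: ccirc_cst|exact: ccirc_sum].
have -> : - e%:~R * \sum_(j < J) P j = - fourier (fun z => e%:~R *
    \sum_(j < J) (c ^ kernel_exp e j * fourier h (kernel_exp e j)) * (g z * z ^ kernel_exp e j)) (-1).
  rewrite fourierZ; last exact: ccirc_sum.
  rewrite fourier_sum // mulNr; congr (- (_ * _)); apply: eq_bigr => j _.
  rewrite fourierZ; last exact: ccircM cg (@ccirc_exprz R _).
  by rewrite fourier_shift // /P; ring.
rewrite opprK -fourierD //; last exact: ccircM.
apply: le_trans (fourier_le (M := Bg * (2 * (kernel_ratio e eta ^+ J / eta * Bh))) _ _ _) _.
- by apply: ccircD cS; exact: ccircM.
- move=> x; have H := inner_expand J ee eb (@cn_circ R x) ch hB.
  rewrite -/c in H.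
  have -> : g (circ x) * inner e eta h (circ x) + e%:~R * (\sum_(j < J)
      c ^ kernel_exp e j * fourier h (kernel_exp e j) * (g (circ x) * circ x ^ kernel_exp e j)) =
    g (circ x) * (inner e eta h (circ x) + e%:~R * \sum_(j < J)
     (circ x * c) ^ kernel_exp e j * fourier h (kernel_exp e j)).
    rewrite mulrDr; congr (_ + _); rewrite mulrCA; congr (_ * _).
    rewrite mulr_sumr; apply: eq_bigr => j _; rewrite expfzMl; ring.
  by rewrite (cnM (g _)); apply: ler_pM; rewrite ?cn_ge0.
by rewrite le_eqVlt; apply/orP; left; apply/eqP; ring.
Qed.

Lemma csum_cvg (I : Type) (r : seq I) (T : Type) (F : set_system T) (FF : Filter F)
    (f : I -> T -> R[i]) (l : I -> R[i]) :
  (forall i, (f i : T -> (R[i])^o) @ F --> (l i : (R[i])^o)) ->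
  ((fun t => \sum_(i <- r) f i t) : T -> (R[i])^o) @ F --> (\sum_(i <- r) l i : (R[i])^o).
Proof.
move=> fl; elim: r => [|i r IH].
  rewrite big_nil (_ : (fun t => _) = fun=> 0); first exact: cvg_cst.
  by apply/funext => t; rewrite big_nil.
rewrite big_cons (_ : (fun t => _) = fun t => f i t + \sum_(j <- r) f j t).
  exact: cvgD (fl i) IH.
by apply/funext => t; rewrite big_cons.
Qed.

Lemma exprz_cvg (T : Type) (F : set_system T) (FF : Filter F) (f : T -> R[i]) (l : R[i]) (m : int) :
  l != 0 -> (f : T -> (R[i])^o) @ F --> (l : (R[i])^o) ->
  ((fun t => f t ^ m) : T -> (R[i])^o) @ F --> (l ^ m : (R[i])^o).
Proof.
move=> l0 fl.
have H (n : nat) : ((fun t => f t ^+ n) : T -> (R[i])^o) @ F --> (l ^+ n : (R[i])^o).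
  elim: n => [|n IH]; first exact: cvg_cst.
  rewrite exprS (_ : (fun t => _) = fun t => f t * f t ^+ n); first exact: cvgM fl IH.
  by apply/funext => t; rewrite exprS.
case: m => n; first exact: H.
rewrite NegzE -exprnN (_ : (fun t => _) = fun t => (f t ^+ n.+1)^-1).
  by apply: cvgV (H n.+1); rewrite expf_neq0.
by apply/funext => t; rewrite exprnN.
Qed.

(** A finite sum of terms each continuous in eta: the limit eta = 0 is taken term
    by term. *)
Lemma reg_dint_eval e (G : R[i] -> R[i] -> R[i]) (n J0 : nat) (k : 'I_n -> R[i])
  (g h : 'I_n -> R[i] -> R[i]) : e = 1 \/ e = -1 ->
  (forall i, ccirc (g i)) -> (forall i, ccirc (h i)) ->
  (forall x y, G (circ x) (circ y) = \sum_i k i * (g i (circ x) * h i (circ y))) ->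
  (forall i j, (J0 <= j)%N -> fourier (g i) (-1 - kernel_exp e j) * fourier (h i) (kernel_exp e j) = 0) ->
  - e%:~R * reg_dint e G =
  \sum_i k i * \sum_(j < J0) fourier (g i) (-1 - kernel_exp e j) * fourier (h i) (kernel_exp e j).
Proof.
move=> ee cg ch GE van; pose c : R[i] := 2 * 'i%C * pi%:C.
have c0 : c != 0 by rewrite /c twoipiE mulf_neq0 ?pi2_neq0 ?ci_neq0.
pose P i j := fourier (g i) (-1 - kernel_exp e j) * fourier (h i) (kernel_exp e j).
have e2 : (- e%:~R) * (- e%:~R) = 1 :> R[i] by case: ee => ->; ring.
have E eta : 0 < eta < 1 ->
   oint (fun z => oint (fun s => (z * (1 - e%:~R * eta%:C) - s)^-1 * G z s)) / c ^+ 2 =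
   \sum_i k i * (- e%:~R * \sum_(j < J0) (1 - e%:~R * eta%:C) ^ kernel_exp e j * P i j).
  move=> eb.
  have ci i : ccirc (fun z => k i * (g i z * inner e eta (h i) z)).
    by apply: ccircM (ccircM (cg i) (inner_ccirc ee eb (ch i))); exact: ccirc_cst.
  have -> : oint (fun z => oint (fun s => (z * (1 - e%:~R * eta%:C) - s)^-1 * G z s)) =
    oint (fun z => c * \sum_i k i * (g i z * inner e eta (h i) z)).
    rewrite !ointE; apply: eq_cint => x _; congr (_ * _).
    rewrite oint_fourier -/c; congr (_ * _).
    have cj i : ccirc (fun s => (k i * g i (circ x)) *
        ((circ x * (1 - e%:~R * eta%:C) - s)^-1 * h i s)).
      by apply: ccircM; [exact: ccirc_cst|apply: ccker; rewrite ?cn_circ].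
    transitivity (fourier (fun s => \sum_i (k i * g i (circ x)) *
        ((circ x * (1 - e%:~R * eta%:C) - s)^-1 * h i s)) (-1)).
      by apply: eq_fourier => y; rewrite GE mulr_sumr; apply: eq_bigr => i _; ring.
    rewrite fourier_sum //; apply: eq_bigr => i _.
    rewrite fourierZ; last by apply: ccker; rewrite ?cn_circ.
    by rewrite mulrA.
  rewrite oint_fourier -/c fourierZ; last exact: ccirc_sum.
  rewrite mulrA -expr2 mulrC mulKf ?expf_neq0 //.
  rewrite fourier_sum //; apply: eq_bigr => i _; rewrite fourierZ.
    by rewrite (outer_eval ee eb (cg i) (ch i) (van i)).
  exact: ccircM (cg i) (inner_ccirc ee eb (ch i)).
rewrite /reg_dint -/c.
have -> : \sum_i k i * \sum_(j < J0) P i j =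
   - e%:~R * \sum_i k i * (- e%:~R * \sum_(j < J0) (1 - e%:~R * (0%:C : R[i])) ^ kernel_exp e j * P i j).
  rewrite mulr_sumr; apply: eq_bigr => i _; rewrite mulrCA; congr (_ * _).
  rewrite mulrA e2 mul1r; apply: eq_bigr => j _.
  by rewrite mulr0 subr0 exp1rz mul1r.
congr (_ * _); apply: (@cvg_lim (R[i])^o); first exact: norm_hausdorff.
have H : ((fun eta : R => \sum_i k i *
    (- e%:~R * \sum_(j < J0) (1 - e%:~R * (eta%:C : R[i])) ^ kernel_exp e j * P i j)) : R -> (R[i])^o) @ 0^'+ -->
   (\sum_i k i * (- e%:~R * \sum_(j < J0) (1 - e%:~R * (0%:C : R[i])) ^ kernel_exp e j * P i j) : (R[i])^o).
  apply: csum_cvg => i; apply: cvgM; first exact: cvg_cst.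
  apply: cvgM; first exact: cvg_cst.
  apply: csum_cvg => j; apply: cvgM; last exact: cvg_cst.
  apply: exprz_cvg; first by rewrite mulr0 subr0 oner_neq0.
  apply: cvgB; first exact: cvg_cst.
  apply: cvgM; first exact: cvg_cst.
  exact/cvg_at_right_filter/hline_cvg.
apply: cvg_trans H; apply: near_eq_cvg.
near=> eta; apply/esym/E.
by apply/andP; split; near: eta; [exact: nbhs_right_gt|exact: nbhs_right_lt].
Unshelve. all: by end_near. Qed.

End DoubleIntegral.

(** * Determinants with a few rows and columns replaced *)

Section ExactAlgebra.
Variable F : fieldType.

(** Sylvester's identity, from two factorisations of one block matrix. *)
Lemma det_1DmulC (m n : nat) (A : 'M[F]_(m, n)) (B : 'M[F]_(n, m)) :
  \det (1%:M + A *m B) = \det (1%:M + B *m A).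
Proof.
have E1 : block_mx 1%:M (- A) B 1%:M =
  block_mx 1%:M 0 B 1%:M *m block_mx 1%:M (- A) 0 (1%:M + B *m A).
  rewrite mulmx_block !(mul1mx, mul0mx, mulmx1, mulmx0, addr0, add0r) mulmxN.
  by rewrite addrCA addNr addr0.
have E2 : block_mx 1%:M (- A) B 1%:M =
  block_mx (1%:M + A *m B) (- A) 0 1%:M *m block_mx 1%:M 0 B 1%:M.
  rewrite mulmx_block !(mul1mx, mul0mx, mulmx1, mulmx0, addr0, add0r) mulNmx.
  by rewrite addrK.
have := congr1 determinant E1; rewrite E2 !det_mulmx.
by rewrite !det_lblock !det_ublock !det1 !mul1r !mulr1.
Qed.

Definition unit_cols (N n : nat) (h : 'I_n -> 'I_N) : 'M[F]_(N, n) :=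
  \matrix_(x, a) (x == h a)%:R.

Lemma mul_unit_cols (N n m : nat) (h : 'I_n -> 'I_N) (V : 'M[F]_(n, m)) x y :
  injective h ->
  (unit_cols h *m V) x y = if [pick a | h a == x] is Some a then V a y else 0.
Proof.
move=> hI; rewrite mxE; case: pickP => [a /eqP ha|nh].
  rewrite (bigD1 a) //= mxE -ha eqxx mul1r big1 ?addr0 // => b ba.
  by rewrite mxE (inj_eq hI) eq_sym (negbTE ba) mul0r.
by rewrite big1 // => a _; rewrite mxE eq_sym nh mul0r.
Qed.

Lemma mul_unit_colsT (N r m : nat) (t : 'I_r -> 'I_N) (V : 'M[F]_(m, r)) x y :
  injective t ->
  (V *m (unit_cols t)^T) x y = if [pick b | t b == y] is Some b then V x b else 0.
Proof.
move=> tI; rewrite -[V *m _]trmxK trmx_mul trmxK mxE mul_unit_cols //.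
by case: pickP => // b _; rewrite mxE.
Qed.

Lemma unit_colsTK (N n : nat) (h : 'I_n -> 'I_N) :
  injective h -> (unit_cols h)^T *m unit_cols h = 1%:M.
Proof.
move=> hI; apply/matrixP => a b; rewrite mxE (bigD1 (h a)) //= !mxE eqxx mul1r.
rewrite (inj_eq hI) big1 ?addr0 // => x xa.
by rewrite !mxE (negbTE xa) mul0r.
Qed.

Definition excite_mx (N n r : nat) (h : 'I_n -> 'I_N) (t : 'I_r -> 'I_N)
  (T : 'M[F]_N) (P : 'M[F]_(n, N)) (K : 'M[F]_(N, r)) (Z : 'M[F]_(n, r)) : 'M[F]_N :=
  \matrix_(x, y) match [pick a | h a == x], [pick b | t b == y] with
    | Some a, Some b => Z a b
    | Some a, None => P a y
    | None, Some b => K x b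
    | None, None => T x y end.

(** Replacing n rows and r columns of T is a perturbation of rank at most n + r,
    so Sylvester's identity applies. The unit columns of the replaced rows and
    columns, paired with the new rows and columns, give the matrix of size n + r. *)
Lemma det_excite (N n r : nat) (h : 'I_n -> 'I_N) (t : 'I_r -> 'I_N)
  (T : 'M[F]_N) (P : 'M[F]_(n, N)) (K : 'M[F]_(N, r)) (Z : 'M[F]_(n, r)) :
  injective h -> injective t -> T \in unitmx ->
  \det (excite_mx h t T P K Z) = \det T *
    \det (col_mx P (unit_cols t)^T *m invmx T *m row_mx (unit_cols h) K -
          block_mx 0 Z 0 0).
Proof.
move=> hI tI Tu; set H := unit_cols h; set t_ := unit_cols t.
(* The perturbation: Y are the increments of the rows, X those of the columns,
   and W corrects the entries changed by both. *)
pose Y := P - H^T *m T; pose X := K - T *m t_.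
pose W := Z - P *m t_ - H^T *m K + H^T *m T *m t_.
have E : excite_mx h t T P K Z = T + row_mx H (X + H *m W) *m col_mx Y t_^T.
  rewrite mul_row_col; apply/matrixP => x y; rewrite [RHS]mxE [in RHS](mxE _ _ x) mul_unit_colsT //.
  rewrite mul_unit_cols // mxE.
  have HT (m : nat) (V : 'M[F]_(N, m)) a j : (H^T *m V) a j = V (h a) j.
    rewrite mxE (bigD1 (h a)) //= !mxE eqxx mul1r big1 ?addr0 // => u ua.
    by rewrite !mxE (negbTE ua) mul0r.
  have TT (m : nat) (V : 'M[F]_(m, N)) i b : (V *m t_) i b = V i (t b).
    rewrite mxE (bigD1 (t b)) //= !mxE eqxx mulr1 big1 ?addr0 // => u ua.
    by rewrite !mxE (negbTE ua) mulr0.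
  have mD (m k : nat) (A B : 'M[F]_(m, k)) i j : (A + B) i j = A i j + B i j.
    by rewrite mxE.
  have mN (m k : nat) (A : 'M[F]_(m, k)) i j : (- A) i j = - A i j by rewrite mxE.
  case: pickP => [a /eqP ha|nh]; case: pickP => [b /eqP tb|nt].
  - rewrite (mD _ _ X) mul_unit_cols //; case: pickP => [a' /eqP ha'|]; last first.
      by move=> /(_ a); rewrite ha eqxx.
    have {a' ha'}-> : a' = a by apply: hI; rewrite ha'.
    rewrite /X /Y /W !mD !mN !TT !HT ha tb.
    by ring.
  - by rewrite /Y mD mN HT ha addr0 addrC subrK.
  - rewrite (mD _ _ X) mul_unit_cols //; case: pickP => [a'|_]; first by rewrite nh.
    by rewrite /X addr0 add0r mD mN TT tb addrC subrK.
  - by rewrite !addr0.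
have -> : excite_mx h t T P K Z =
    T *m (1%:M + (invmx T *m row_mx H (X + H *m W)) *m col_mx Y t_^T).
  by rewrite mulmxDr mulmx1 -mulmxA mulKVmx.
rewrite det_mulmx det_1DmulC; congr (_ * _).
set L := _ - block_mx 0 Z 0 0.
have -> : 1%:M + col_mx Y t_^T *m (invmx T *m row_mx H (X + H *m W)) =
    L *m block_mx 1%:M W 0 1%:M.
  have HH := unit_colsTK hI; have tt := unit_colsTK tI; rewrite -/H -/t_ in HH tt.
  rewrite [invmx T *m row_mx _ _]mul_mx_row mul_col_row.
  rewrite /L mul_col_mx mul_col_row opp_block_mx add_block_mx mulmx_block.
  rewrite scalar_mx_block add_block_mx.
  rewrite !(mulmx1, mulmx0, subr0, add0r, addr0).
  have YT : Y *m invmx T = P *m invmx T - H^T by rewrite mulmxBl mulmxK.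
  have TX : invmx T *m X = invmx T *m K - t_ by rewrite mulmxBr mulKmx.
  congr block_mx.
  - by rewrite mulmxA YT mulmxBl HH addrC subrK.
  - have -> : Y *m (invmx T *m (X + H *m W)) =
        (P *m invmx T - H^T) *m X + (P *m invmx T - H^T) *m H *m W.
      by rewrite mulmxA YT mulmxDr !mulmxA.
    have -> : (P *m invmx T - H^T) *m H = P *m invmx T *m H - 1%:M.
      by rewrite mulmxBl HH.
    have -> : (P *m invmx T - H^T) *m X =
        (P *m invmx T *m K - P *m t_) - (H^T *m K - H^T *m T *m t_).
      rewrite mulmxBl; congr (_ - _).
        by rewrite -(mulmxA P _ X) TX mulmxBr mulmxA.
      by rewrite mulmxBr mulmxA.
    rewrite mulmxBl mul1mx [in X in _ + (_ - X) = _]/W.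
    move: (P *m invmx T *m K) (P *m t_) (H^T *m K) (H^T *m T *m t_)
       (P *m invmx T *m H *m W) => m1 m2 m3 m4 m5.
    by apply/matrixP => i j; rewrite !mxE; ring.
  - by rewrite mulmxA.
  - have -> : invmx T *m (X + H *m W) = (invmx T *m K - t_) + invmx T *m H *m W.
      by rewrite (mulmxDr (invmx T) X) TX mulmxA.
    rewrite mulmxDr mulmxBr tt !mulmxA.
    move: (t_^T *m invmx T *m K) (t_^T *m invmx T *m H *m W) => m1 m2.
    by apply/matrixP => i j; rewrite !mxE; ring.
by rewrite det_mulmx det_ublock !det1 !mulr1.
Qed.

(** The signs of the permutations of the rows and of the columns cancel. The two
    sizes are equal only propositionally. *)
Lemma det_relabel (m n : nat) (s : 'I_m -> 'I_n) (A : 'M[F]_n) : m = n -> injective s ->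
  \det (\matrix_(i, j) A (s i) (s j)) = \det A.
Proof.
move=> mn; case: n / mn s A => s A sI.
have -> : \matrix_(i, j) A (s i) (s j) = row_perm (perm sI) (col_perm (perm sI) A).
  by apply/matrixP => i j; rewrite !mxE !permE.
rewrite row_permE col_permE !det_mulmx !det_perm odd_permV.
by rewrite mulrCA -signr_addb addbb mulr1.
Qed.

(** A common permutation of rows and columns makes the matrix block diagonal. *)
Lemma det_interleave (n n' r r' : nat)
  (A : 'M[F]_(n, n)) (B : 'M[F]_(n, r)) (C : 'M[F]_(r, n)) (D : 'M[F]_(r, r))
  (A' : 'M[F]_(n', n')) (B' : 'M[F]_(n', r')) (C' : 'M[F]_(r', n')) (D' : 'M[F]_(r', r')) :
  \det (block_mx (block_mx A 0 0 A') (block_mx B 0 0 B')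
                 (block_mx C 0 0 C') (block_mx D 0 0 D')) =
  \det (block_mx A B C D) * \det (block_mx A' B' C' D').
Proof.
rewrite -(det_ublock _ 0).
pose s (i : 'I_((n + n') + (r + r'))) : 'I_((n + r) + (n' + r')) :=
  match fintype.split i with
  | inl j => match fintype.split j with inl a => lshift _ (lshift _ a) | inr a => rshift _ (lshift _ a) end
  | inr j => match fintype.split j with inl a => lshift _ (rshift _ a) | inr a => rshift _ (rshift _ a) end
  end.
have sI : injective s.
  move=> i j; rewrite /s -{2}(splitK i) -{2}(splitK j).
  case: (fintype.split i) => i1; case: (fintype.split j) => j1;
  rewrite -{2}(splitK i1) -{2}(splitK j1);
  case: (fintype.split i1) => i2; case: (fintype.split j1) => j2 /=;
  move=> /eqP; rewrite ?(eq_lshift, eq_rshift, eq_lrshift, eq_rlshift) // => /eqP -> //.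
have mn : ((n + n') + (r + r') = (n + r) + (n' + r'))%N by lia.
rewrite -(det_relabel _ mn sI); congr (\det _); apply/matrixP => i j.
rewrite [RHS]mxE /s -{1}(splitK i) -{1}(splitK j).
case: (fintype.split i) => i1; case: (fintype.split j) => j1;
  rewrite -{1}(splitK i1) -{1}(splitK j1);
  case: (fintype.split i1) => i2; case: (fintype.split j1) => j2 /=;
  by rewrite ?(block_mxEul, block_mxEur, block_mxEdl, block_mxEdr) ?mxE.
Qed.

End ExactAlgebra.

(** * Geometrically small sequences *)

Section Tiny.
Variable R : realType.
Implicit Types (u v : nat -> R[i]) (l k : R[i]).

Variant tiny u : Prop :=
  Tiny (c q : R) (N0 : nat) of 0 <= c & 0 <= q & q < 1 &
    forall N, (N0 <= N)%N -> cn (u N) <= c * q ^+ N.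

Variant approx u l : Prop := Approx of tiny (fun N => u N - l).

Lemma tiny_ext u v (N0 : nat) : (forall N, (N0 <= N)%N -> u N = v N) -> tiny u -> tiny v.
Proof.
move=> uv [c q N1 c0 q0 q1 H]; exists c q (maxn N0 N1) => // N.
by rewrite geq_max => /andP[h1 h2]; rewrite -uv // H.
Qed.

Lemma tiny0 : tiny (fun=> 0).
Proof. by exists 0 0 0%N => // N _; rewrite cn0 mul0r. Qed.

Lemma tiny_le u v (c : R) (N0 : nat) : 0 <= c ->
  (forall N, (N0 <= N)%N -> cn (v N) <= c * cn (u N)) -> tiny u -> tiny v.
Proof.
move=> c0 vu [c1 q N1 c10 q0 q1 H]; exists (c * c1) q (maxn N0 N1) => //.
  exact: mulr_ge0.
move=> N; rewrite geq_max => /andP[h1 h2]; apply: le_trans (vu _ h1) _.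
by rewrite -mulrA ler_wpM2l // H.
Qed.

Lemma tinyD u v : tiny u -> tiny v -> tiny (fun N => u N + v N).
Proof.
move=> [c1 q1 N1 c10 q10 q11 H1] [c2 q2 N2 c20 q20 q21 H2].
exists (c1 + c2) (Num.max q1 q2) (maxn N1 N2); rewrite ?addr_ge0 //.
- by rewrite le_max q10.
- by rewrite gt_max q11.
move=> N; rewrite geq_max => /andP[h1 h2]; apply: le_trans (cnD _ _) _.
rewrite mulrDl; apply: lerD.
  apply: le_trans (H1 _ h1) _; rewrite ler_wpM2l // lerXn2r ?nnegrE ?le_max ?q10 ?lexx //.
apply: le_trans (H2 _ h2) _.
by rewrite ler_wpM2l // lerXn2r ?nnegrE ?le_max ?q10 ?lexx ?orbT.
Qed.

Lemma tinyMl u l : tiny u -> tiny (fun N => l * u N).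
Proof.
move=> tu; apply: (@tiny_le u _ (cn l) 0%N) tu; first exact: cn_ge0.
by move=> N _; rewrite cnM.
Qed.

Lemma tinyM u v : tiny u -> tiny v -> tiny (fun N => u N * v N).
Proof.
move=> tu [c q N0 c0 q0 q1 H]; apply: (@tiny_le u _ c N0) tu => // N h.
rewrite cnM mulrC ler_wpM2r ?cn_ge0 //; apply: le_trans (H _ h) _.
by rewrite ler_piMr // exprn_ile1 // ltW.
Qed.

Lemma approx_ext u v l (N0 : nat) : (forall N, (N0 <= N)%N -> u N = v N) ->
  approx u l -> approx v l.
Proof. by move=> uv [tu]; split; apply: (tiny_ext (N0 := N0)) tu => N h; rewrite uv. Qed.

Lemma approx_cst l : approx (fun=> l) l.
Proof. by split; apply: (tiny_ext (N0 := 0%N)) tiny0 => N _; rewrite subrr. Qed.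

Lemma approxD u v l k : approx u l -> approx v k -> approx (fun N => u N + v N) (l + k).
Proof.
move=> [tu] [tv]; split; apply: (tiny_ext (N0 := 0%N)) (tinyD tu tv) => N _.
by rewrite opprD addrACA.
Qed.

Lemma approxM u v l k : approx u l -> approx v k -> approx (fun N => u N * v N) (l * k).
Proof.
move=> [tu] [tv]; split.
apply: (tiny_ext (N0 := 0%N)) (tinyD (tinyD (tinyMl k tu) (tinyMl l tv)) (tinyM tu tv)) => N _.
by ring.
Qed.

Lemma approx_sum (I : Type) (r : seq I) (u : I -> nat -> R[i]) (l : I -> R[i]) :
  (forall i, approx (u i) (l i)) -> approx (fun N => \sum_(i <- r) u i N) (\sum_(i <- r) l i).
Proof.
move=> H; elim: r => [|i r IH].
  by rewrite big_nil; apply: (approx_ext (N0 := 0%N)) (approx_cst 0) => N _; rewrite big_nil.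
by rewrite big_cons; apply: (approx_ext (N0 := 0%N)) (approxD (H i) IH) => N _; rewrite big_cons.
Qed.

Lemma approx_prod (I : Type) (r : seq I) (u : I -> nat -> R[i]) (l : I -> R[i]) :
  (forall i, approx (u i) (l i)) -> approx (fun N => \prod_(i <- r) u i N) (\prod_(i <- r) l i).
Proof.
move=> H; elim: r => [|i r IH].
  by rewrite big_nil; apply: (approx_ext (N0 := 0%N)) (approx_cst 1) => N _; rewrite big_nil.
by rewrite big_cons; apply: (approx_ext (N0 := 0%N)) (approxM (H i) IH) => N _; rewrite big_cons.
Qed.

Lemma approx_det (m : nat) (A : nat -> 'M[R[i]]_m) (L : 'M[R[i]]_m) :
  (forall i j, approx (fun N => A N i j) (L i j)) -> approx (fun N => \det (A N)) (\det L).
Proof.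
move=> H; apply: approx_sum => s; apply: approxM; first exact: approx_cst.
by apply: approx_prod => i; exact: H.
Qed.

End Tiny.

(** * Wiener-Hopf solutions at one end of a Toeplitz matrix *)

Section Edge.
Variable R : realType.
Implicit Types (p : nat -> R[i]).

(** The Wiener-Hopf data seen from one end of the matrix: ef are the Fourier
    coefficients of a symbol f = phi_+ phi_-, ea and eai the coefficients of
    phi_+ and of its inverse along the powers of z, eb and ebi those of phi_- and
    of its inverse along the powers of 1/z. *)
Record edge := Edge {
  ef : int -> R[i];
  ea : nat -> R[i]; eai : nat -> R[i];
  eb : nat -> R[i]; ebi : nat -> R[i] }.

(** Numbering the rows and columns of the Toeplitz matrix backwards exchanges z
    and 1/z, hence the two factors. *)
Definition mirror (E : edge) : edge :=
  Edge (fun u => ef E (- u)) (eb E) (ebi E) (ea E) (eai E).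

(** The power series with coefficients p and q are inverse to each other. *)
Definition inv_seq (p q : nat -> R[i]) : Prop :=
  forall n : nat, \sum_(i < n.+1) p (n - i)%N * q i = (n == 0%N)%:R.

(** The last two fields express f / phi_+ = phi_- and f / phi_- = phi_+, with the
    convolutions truncated at M. *)
Record edge_ok (E : edge) (B r : R) : Prop := EdgeOk {
  eo_B : 0 <= B; eo_r0 : 0 < r; eo_r1 : r < 1;
  eo_f : forall u, cn (ef E u) <= B;
  eo_a : forall n, cn (ea E n) <= B;
  eo_b : forall n, cn (eb E n) <= B;
  eo_ai : forall n, cn (eai E n) <= B * r ^+ n;
  eo_bi : forall n, cn (ebi E n) <= B * r ^+ n;
  eo_aai : inv_seq (ea E) (eai E);
  eo_bbi : inv_seq (eb E) (ebi E);
  eo_fai : forall u (M : nat),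
    cn (ext (eb E) (- u) - \sum_(i < M) eai E i * ef E (u - i%:Z)) <= B * r ^+ M;
  eo_fbi : forall u (M : nat),
    cn (ext (ea E) u - \sum_(i < M) ebi E i * ef E (u + i%:Z)) <= B * r ^+ M }.

Lemma mirror_ok E B r : edge_ok E B r -> edge_ok (mirror E) B r.
Proof.
case=> B0 r0 r1 hf ha hb hai hbi haai hbbi hfai hfbi; split => //= u M.
  rewrite (eq_bigr (fun i : 'I_M => ebi E i * ef E (- u + i%:Z))); first exact: hfbi.
  by move=> i _; congr (_ * ef _ _); lia.
rewrite (eq_bigr (fun i : 'I_M => eai E i * ef E (- u - i%:Z))); last first.
  by move=> i _; congr (_ * ef _ _); lia.
by rewrite -{1}(opprK u); exact: hfai.
Qed.

Lemma inv_seqC p q : inv_seq p q -> inv_seq q p.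
Proof.
move=> H n; rewrite -H (reindex_inj rev_ord_inj) /=; apply: eq_bigr => i _.
by rewrite mulrC; congr (p _ * q _); rewrite subSS ?subKn // -ltnS.
Qed.

Lemma inv_seq_shift p q (h : nat) (u : nat) : inv_seq p q ->
  \sum_(i < h.+1) p (h - i)%N * ext q (i%:Z - u%:Z) = (u == h)%:R.
Proof.
move=> H; have [uh|hu] := leqP u h; last first.
  rewrite big1 ?(gtn_eqF hu) // => i _.
  have : (i < u)%N by apply: leq_ltn_trans hu; rewrite -ltnS.
  move=> iu; rewrite (_ : ext q _ = 0) ?mulr0 //.
  by have -> : i%:Z - u%:Z = Negz (u - i).-1 by lia.
pose F i := p (h - i)%N * ext q (i%:Z - u%:Z).
rewrite -(big_mkord predT F) (big_cat_nat (leq0n u)) /=; last by lia.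
rewrite big_nat_cond big1 ?add0r; last first.
  move=> i /andP[/andP[_ iu] _]; rewrite /F (_ : ext q _ = 0) ?mulr0 //.
  by have -> : i%:Z - u%:Z = Negz (u - i).-1 by lia.
rewrite -{1}[u]add0n big_addn big_mkord subSn //.
rewrite (_ : (u == h) = (h - u == 0)%N); last by lia.
rewrite -H; apply: eq_bigr => i _; rewrite /F.
rewrite (_ : (i + u)%N%:Z - u%:Z = i%:Z); last by lia.
by congr (p _ * _); lia.
Qed.

Variables (E : edge) (B r : R).
Hypothesis ok : edge_ok E B r.

(** Columns indexed by x, counted from the end. The half-infinite Toeplitz matrix
    of f has the inverse T(1/phi_+) T(1/phi_-), a lower triangular matrix times an
    upper triangular one, whose column h is hole_sol h; part_sol k is this inverse
    applied to the coefficients ef (x + 1 + k) of a particle located k + 1 places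
    before the first index. *)
Definition hole_sol (h : nat) (x : int) : R[i] :=
  \sum_(i < h.+1) ebi E (h - i)%N * ext (eai E) (x - i%:Z).
Definition part_sol (k : nat) (x : nat) : R[i] :=
  - \sum_(i < k.+1) ea E (k - i)%N * eai E (x + 1 + i)%N.

Let B0 : 0 <= B. Proof. exact: eo_B ok. Qed.
Let r0 : 0 < r. Proof. exact: eo_r0 ok. Qed.
Let r1 : r < 1. Proof. exact: eo_r1 ok. Qed.
Let rle (n m : nat) : (m <= n)%N -> r ^+ n <= r ^+ m.
Proof. by move=> mn; rewrite -(subnK mn) exprD ler_piMl ?exprn_ge0 ?exprn_ile1 ?(ltW r0) ?(ltW r1). Qed.

Lemma ext_le (p : nat -> R[i]) (C : R) (x : int) : 0 <= C ->
  (forall n, cn (p n) <= C) -> cn (ext p x) <= C.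
Proof. by move=> C0 H; case: x => n; [exact: H|rewrite (_ : ext p _ = 0) ?cn0]. Qed.

Lemma eai_le n : cn (eai E n) <= B.
Proof. by apply: le_trans (eo_ai ok n) _; rewrite ler_piMr // exprn_ile1 // ltW. Qed.
Lemma ebi_le n : cn (ebi E n) <= B.
Proof. by apply: le_trans (eo_bi ok n) _; rewrite ler_piMr // exprn_ile1 // ltW. Qed.

Lemma sum_ord_le (h : nat) (F : nat -> R[i]) (C : R) :
  (forall i, (i <= h)%N -> cn (F i) <= C) -> cn (\sum_(i < h.+1) F i) <= h.+1%:R * C.
Proof.
move=> H; apply: le_trans (cn_sum _ _ _) _.
apply: (@le_trans _ _ (\sum_(i < h.+1) C)).
  by apply: ler_sum => i _; apply: H; rewrite -ltnS.
by rewrite sumr_const card_ord mulr_natl.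
Qed.

Lemma hole_sol_le h x : cn (hole_sol h x) <= h.+1%:R * (B * B).
Proof.
apply: (sum_ord_le (F := fun i => ebi E (h - i)%N * ext (eai E) (x - i%:Z))) => i _.
rewrite cnM; apply: ler_pM; rewrite ?cn_ge0 ?ebi_le //.
by apply: ext_le => // n; exact: eai_le.
Qed.

(** Convolution with 1/phi_+ turns f into phi_-; the terms beyond the last row
    cost r^(N - h). *)
Lemma hole_sol_eq (u : int) (h N : nat) : (h < N)%N ->
  cn (\sum_(x < N) ef E (u - x%:Z) * hole_sol h x%:Z -
      \sum_(i < h.+1) ebi E (h - i)%N * ext (eb E) (i%:Z - u)) <=
  h.+1%:R * (B * (B * r ^+ (N - h))).
Proof.
move=> hN.
pose T (i : nat) := \sum_(y < (N - i)%N) eai E y * ef E (u - i%:Z - y%:Z).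
have inner (i : nat) : (i <= h)%N ->
    \sum_(x < N) ef E (u - x%:Z) * ext (eai E) (x%:Z - i%:Z) = T i.
  move=> ih; have iN : (i <= N)%N by apply: leq_trans ih (ltnW hN).
  pose F x := ef E (u - x%:Z) * ext (eai E) (x%:Z - i%:Z).
  rewrite -(big_mkord predT F) (big_cat_nat (leq0n i) iN) /=.
  rewrite big_nat_cond big1 ?add0r; last first.
    move=> x /andP[/andP[_ xi] _]; rewrite /F (_ : ext _ _ = 0) ?mulr0 //.
    by have -> : x%:Z - i%:Z = Negz (i - x).-1 by lia.
  rewrite -{1}(add0n i) big_addn big_mkord; apply: eq_bigr => y _; rewrite /F mulrC.
  have -> : (y + i)%N%:Z - i%:Z = y%:Z by lia.
  by congr (_ * ef _ _); lia.
have -> : \sum_(x < N) ef E (u - x%:Z) * hole_sol h x%:Z =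
    \sum_(i < h.+1) ebi E (h - i)%N * T i.
  rewrite (eq_bigr (fun x : 'I_N => \sum_(i < h.+1)
     ebi E (h - i)%N * (ef E (u - x%:Z) * ext (eai E) (x%:Z - i%:Z)))); last first.
    by move=> x _; rewrite /hole_sol mulr_sumr; apply: eq_bigr => i _; rewrite mulrCA.
  rewrite exchange_big /=; apply: eq_bigr => i _.
  by rewrite -mulr_sumr inner // -ltnS.
rewrite cnBC -sumrB; apply: (sum_ord_le (F := fun i =>
  ebi E (h - i)%N * ext (eb E) (i%:Z - u) - ebi E (h - i)%N * T i)) => i ih.
rewrite -mulrBr cnM; apply: ler_pM; rewrite ?cn_ge0 ?ebi_le //.
have := eo_fai ok (u - i%:Z) (N - i); rewrite opprB => H.
by apply: le_trans H _; rewrite ler_wpM2l // rle // leq_sub2l.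
Qed.

Lemma part_sol_le k x : cn (part_sol k x) <= k.+1%:R * (B * (B * r ^+ x)).
Proof.
rewrite /part_sol cnN; apply: (sum_ord_le (F := fun i => ea E (k - i)%N * eai E (x + 1 + i)%N)) => i _.
rewrite cnM; apply: ler_pM; rewrite ?cn_ge0 ?(eo_a ok) //.
by apply: le_trans (eo_ai ok _) _; rewrite ler_wpM2l // rle //; lia.
Qed.

(** The sequence eai enters through its terms of index greater than i. Completing
    the convolution of 1/phi_+ with f yields phi_-; the completing terms,
    convolved with phi_+, yield the column of the particle. *)
Lemma part_sol_eq (u : int) (k N : nat) :
  cn (\sum_(x < N) ef E (u - x%:Z) * part_sol k x -
      (ef E (u + 1 + k%:Z) - \sum_(i < k.+1) ea E (k - i)%N * ext (eb E) (- u - 1 - i%:Z))) <=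
  k.+1%:R * (B * (B * r ^+ N)).
Proof.
pose T (i : nat) := \sum_(y < N + i.+1) eai E y * ef E (u + 1 + i%:Z - y%:Z).
pose L (i : nat) := \sum_(y < i.+1) eai E y * ef E (u + 1 + i%:Z - y%:Z).
have inner (i : nat) : \sum_(x < N) ef E (u - x%:Z) * eai E (x + 1 + i)%N = T i - L i.
  pose F y := eai E y * ef E (u + 1 + i%:Z - y%:Z).
  apply/esym/eqP; rewrite subr_eq /T /L -(big_mkord predT F) -(big_mkord predT F).
  rewrite (big_cat_nat (leq0n i.+1)) /=; last by lia.
  rewrite addrC; apply/eqP; congr (_ + _).
  rewrite -{1}[i.+1]add0n big_addn big_mkord addnK; apply: eq_bigr => x _.
  by rewrite /F mulrC; congr (ef _ _ * eai _ _); lia.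
(* The convolution of phi_+ with its inverse collapses to the last term. *)
have LE : \sum_(i < k.+1) ea E (k - i)%N * L i = ef E (u + 1 + k%:Z).
  have Li (i : 'I_k.+1) : L i = \sum_(m < k.+1) ext (eai E) (i%:Z - m%:Z) * ef E (u + 1 + m%:Z).
    pose F m := ext (eai E) (i%:Z - m%:Z) * ef E (u + 1 + m%:Z).
    rewrite -(big_mkord predT F) (big_cat_nat (leq0n i.+1) (ltn_ord i)) /=.
    rewrite [X in _ = _ + X]big_nat_cond [X in _ = _ + X]big1 ?addr0; last first.
      move=> m /andP[/andP[im _] _]; rewrite /F (_ : ext _ _ = 0) ?mul0r //.
      by have -> : i%:Z - m%:Z = Negz (m - i).-1 by lia.
    rewrite big_mkord /L (reindex_inj rev_ord_inj) /=; apply: eq_bigr => m _.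
    have mi : (m <= i)%N by rewrite -ltnS.
    rewrite /F subSS (_ : i%:Z - m%:Z = (i - m)%N%:Z); last by lia.
    by congr (_ * ef _ _); lia.
  rewrite (eq_bigr (fun i : 'I_k.+1 => \sum_(m < k.+1)
     ef E (u + 1 + m%:Z) * (ea E (k - i)%N * ext (eai E) (i%:Z - m%:Z)))); last first.
    by move=> i _; rewrite Li mulr_sumr; apply: eq_bigr => m _; ring.
  rewrite exchange_big /=.
  rewrite (eq_bigr (fun m : 'I_k.+1 => ef E (u + 1 + m%:Z) * (m == k :> nat)%:R)); last first.
    by move=> m _; rewrite -mulr_sumr (inv_seq_shift _ _ (eo_aai ok)).
  rewrite (bigD1 ord_max) //= eqxx mulr1 big1 ?addr0 // => m mk.
  by rewrite -(inj_eq val_inj) /= in mk; rewrite (negbTE mk) mulr0.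
have -> : \sum_(x < N) ef E (u - x%:Z) * part_sol k x =
    - \sum_(i < k.+1) ea E (k - i)%N * (T i - L i).
  rewrite (eq_bigr (fun x : 'I_N => - \sum_(i < k.+1)
     ea E (k - i)%N * (ef E (u - x%:Z) * eai E (x + 1 + i)%N))); last first.
    by move=> x _; rewrite /part_sol mulrN mulr_sumr; congr (- _); apply: eq_bigr => i _; ring.
  rewrite sumrN exchange_big /=; congr (- _); apply: eq_bigr => i _.
  by rewrite -mulr_sumr inner.
rewrite -LE -sumrB -sumrN -sumrB; apply: (sum_ord_le (F := fun i =>
  - (ea E (k - i)%N * (T i - L i)) - (ea E (k - i)%N * L i -
   ea E (k - i)%N * ext (eb E) (- u - 1 - i%:Z)))) => i _.
have -> : - (ea E (k - i)%N * (T i - L i)) - (ea E (k - i)%N * L i -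
   ea E (k - i)%N * ext (eb E) (- u - 1 - i%:Z)) =
   ea E (k - i)%N * (ext (eb E) (- u - 1 - i%:Z) - T i) by ring.
rewrite cnM; apply: ler_pM; rewrite ?cn_ge0 ?(eo_a ok) //.
have := eo_fai ok (u + 1 + i%:Z) (N + i.+1); rewrite (_ : - (u + 1 + i%:Z) = - u - 1 - i%:Z); last by lia.
by move=> /le_trans; apply; rewrite ler_wpM2l // rle // leq_addr.
Qed.

(** Limits, at one end, of the four kinds of entries of the reduced matrix. Rows
    belong to the particles p and to the holes t of the two index families,
    columns to the holes h and to the particles k. *)
Definition end_ph (p h : nat) : R[i] := \sum_(i < h.+1) ebi E (h - i)%N * eb E (p + 1 + i)%N.
Definition end_pp (p k : nat) : R[i] :=
  \sum_(i < k.+1) ea E (k - i)%N * ext (eb E) (p%:Z - i%:Z).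
Definition end_hh (t h : nat) : R[i] := hole_sol h t%:Z.
Definition end_hp (t k : nat) : R[i] := part_sol k t.

Lemma hole_sol_eq_in (u h N : nat) : (h < N)%N ->
  cn (\sum_(x < N) ef E (u%:Z - x%:Z) * hole_sol h x%:Z - (u == h)%:R) <=
  h.+1%:R * (B * (B * r ^+ (N - h))).
Proof.
move=> hN; rewrite -(inv_seq_shift h u (inv_seqC (eo_bbi ok))); exact: hole_sol_eq.
Qed.

Lemma hole_sol_eq_out (p h N : nat) : (h < N)%N ->
  cn (\sum_(x < N) ef E (- p.+1%:Z - x%:Z) * hole_sol h x%:Z - end_ph p h) <=
  h.+1%:R * (B * (B * r ^+ (N - h))).
Proof.
move=> hN; have := hole_sol_eq (- p.+1%:Z) hN.
rewrite (_ : \sum_(i < h.+1) _ = end_ph p h) //; apply: eq_bigr => i _.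
by rewrite (_ : i%:Z - - p.+1%:Z = (p + 1 + i)%N%:Z) //; lia.
Qed.

Lemma part_sol_eq_in (u k N : nat) :
  cn (\sum_(x < N) ef E (u%:Z - x%:Z) * part_sol k x - ef E (u%:Z + 1 + k%:Z)) <=
  k.+1%:R * (B * (B * r ^+ N)).
Proof.
have := part_sol_eq u%:Z k N; rewrite [X in _ - (_ - X)]big1 ?subr0 // => i _.
rewrite (_ : ext _ _ = 0) ?mulr0 //.
by have -> : - u%:Z - 1 - i%:Z = Negz (u + i) by lia.
Qed.

Lemma part_sol_eq_out (p k N : nat) :
  cn (\sum_(x < N) ef E (- p.+1%:Z - x%:Z) * part_sol k x - (ef E (k%:Z - p%:Z) - end_pp p k)) <=
  k.+1%:R * (B * (B * r ^+ N)).
Proof.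
have := part_sol_eq (- p.+1%:Z) k N.
rewrite (_ : - p.+1%:Z + 1 + k%:Z = k%:Z - p%:Z); last by lia.
rewrite (_ : \sum_(i < k.+1) _ = end_pp p k) //; apply: eq_bigr => i _.
by congr (_ * ext _ _); lia.
Qed.

End Edge.

(** * Invertibility of large Toeplitz matrices *)

Section InverseBound.
Variable R : realType.

Lemma geo_small (K q e : R) : 0 <= q -> q < 1 -> 0 < e ->
  exists N0 : nat, forall N, (N0 <= N)%N -> K * q ^+ N < e.
Proof.
move=> q0 q1 e0; have q1' : `|q| < 1 by rewrite ger0_norm.
have c : (fun M : nat => K * q ^+ M) @ \oo --> K * 0.
  by apply: cvgM; [exact: cvg_cst|exact: cvg_expr].
rewrite mulr0 in c; move/cvgrPdist_lt: c => /(_ e e0) [N0 _ H].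
exists N0 => N h; have := H N h; rewrite /= sub0r normrN.
exact: le_lt_trans (ler_norm _).
Qed.

Lemma tiny_poly (u : nat -> R[i]) (c r : R) (k m N0 : nat) : 0 <= c -> 0 < r -> r < 1 ->
  (forall N, (N0 <= N)%N -> cn (u N) <= c * (N%:R ^+ k * r ^+ (N - m))) -> tiny u.
Proof.
move=> c0 r0 r1 H; pose q := (r + 1) / 2.
have rq : r < q by rewrite /q; lra.
have q1 : q < 1 by rewrite /q; lra.
have q0 : 0 < q by exact: lt_trans rq.
have [K K0 HK] := poly_geo k (ltW r0) rq.
exists (c / r ^+ m * K) q (maxn N0 m); rewrite ?(ltW q0) //.
  by rewrite mulr_ge0 // divr_ge0 // exprn_ge0 // ltW.
move=> N; rewrite geq_max => /andP[h1 h2]; apply: le_trans (H _ h1) _.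
have -> : r ^+ (N - m) = r ^+ N / r ^+ m by rewrite expfB_cond ?gt_eqF.
have -> : c * (N%:R ^+ k * (r ^+ N / r ^+ m)) = c / r ^+ m * (N%:R ^+ k * r ^+ N) by ring.
by rewrite -(mulrA (c / r ^+ m) K) ler_wpM2l // divr_ge0 // exprn_ge0 // ltW.
Qed.

Lemma mulmx_le (m n p : nat) (A : 'M[R[i]]_(m, n)) (B : 'M[R[i]]_(n, p)) (x y : R) i j :
  (forall k, cn (A i k) <= x) -> (forall k, cn (B k j) <= y) ->
  cn ((A *m B) i j) <= n%:R * (x * y).
Proof.
move=> Ax By; rewrite mxE; apply: le_trans (cn_sum _ _ _) _.
apply: (@le_trans _ _ (\sum_(k < n) x * y)); last first.
  by rewrite sumr_const card_ord mulr_natl.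
by apply: ler_sum => k _; rewrite cnM; apply: ler_pM; rewrite ?cn_ge0.
Qed.

Lemma max_entry (n p : nat) (A : 'M[R[i]]_(n, p)) (i0 : 'I_n) (j0 : 'I_p) :
  exists i j, forall i' j', cn (A i' j') <= cn (A i j).
Proof.
have [[i j] _ H] := @arg_maxP _ _ _ (i0, j0) xpredT (fun ij => cn (A ij.1 ij.2)) isT.
by exists i, j => i' j'; exact: (H (i', j') isT).
Qed.

(** A Neumann-type argument at an entry of maximal modulus: a vector killed by
    1 + D would be bounded by half of itself, and in the same way an entry of the
    inverse is bounded by s plus half of itself. *)
Lemma approx_inverse (N : nat) (T S D : 'M[R[i]]_N) (e s : R) :
  T *m S = 1%:M + D -> (forall x y, cn (D x y) <= e) -> N%:R * e <= 1 / 2 ->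
  (forall x y, cn (S x y) <= s) ->
  T \in unitmx /\ forall x y, cn (invmx T x y) <= 2 * s.
Proof.
move=> TS De Ne Ss.
have Du : 1%:M + D \in unitmx.
  rewrite unitmxE unitfE; apply/negP => /det0P[v v0 vD].
  have vE : v = - (v *m D).
    by apply/eqP; rewrite -subr_eq0 opprK -[X in X + _]mulmx1 -mulmxDr vD.
  case: N T S D e s TS De Ne Ss v v0 vD vE => [|N] T S D e s TS De Ne Ss v v0 vD vE.
    by rewrite thinmx0 eqxx in v0.
  have [i [j H]] := max_entry v ord0 ord0.
  have : cn (v i j) <= N.+1%:R * (cn (v i j) * e).
    rewrite {1}vE mxE cnN; apply: mulmx_le => k; [by rewrite (ord1 i) -(ord1 i) H|exact: De].
  have : cn (v i j) * (N.+1%:R * e) <= cn (v i j) * (1 / 2).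
    by rewrite ler_wpM2l ?cn_ge0.
  rewrite (mulrCA N.+1%:R) => h1 h2.
  have vij : cn (v i j) <= 0 by have := cn_ge0 (v i j); lra.
  case/negP: v0; apply/eqP/matrixP => i' j'; rewrite [RHS]mxE; apply/eqP.
  by rewrite -cn_eq0 eq_le cn_ge0 andbT (le_trans (H i' j')).
have Tu : T \in unitmx by move: Du; rewrite -TS unitmx_mul => /andP[].
split=> // x y.
have [i [j H]] := max_entry (invmx T) x y; apply: le_trans (H x y) _.
have iE : invmx T = S - invmx T *m D.
  have : invmx T *m (T *m S) = S by rewrite mulKmx.
  by rewrite TS mulmxDr mulmx1 => <-; rewrite addrK.
have h1 : cn (invmx T i j) <= s + N%:R * (cn (invmx T i j) * e).
  rewrite {1}iE mxE [X in S i j + X]mxE; apply: le_trans (cnB _ _) _.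
  by apply: lerD => //; apply: mulmx_le.
have : cn (invmx T i j) * (N%:R * e) <= cn (invmx T i j) * (1 / 2).
  by rewrite ler_wpM2l ?cn_ge0.
by rewrite mulrCA => h2; lra.
Qed.

End InverseBound.

Section Flip.
Variable R : realType.
Variable E : edge R.

(** The boolean is true at the first end of the matrix, where positions are
    counted from 0, and false at the last one, where they are counted
    backwards from N - 1. *)
Definition sided (s : bool) : edge R := if s then E else mirror E.
Definition flip (s : bool) (N : nat) (u : int) : int := if s then u else N%:Z - 1 - u.
Definition flipn (s : bool) (N x : nat) : nat := if s then x else (N.-1 - x)%N.

Lemma flipK s N : involutive (flip s N).
Proof. by case: s => u //=; rewrite /flip; lia. Qed.

Lemma flipnE s N x : (x < N)%N -> (flipn s N x)%:Z = flip s N x%:Z.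
Proof. by case: s => // xN; rewrite /flip /flipn; lia. Qed.

Lemma flipn_lt s N x : (x < N)%N -> (flipn s N x < N)%N.
Proof. by case: s => // xN; rewrite /flipn; lia. Qed.

Lemma flipn_eq s N x y : (x < N)%N -> (y < N)%N ->
  (flipn s N x == flipn s N y) = (x == y).
Proof. by case: s => // xN yN; rewrite /flipn; apply/eqP/eqP; lia. Qed.

Lemma ef_flip s N (u v : int) : ef E (u - v) = ef (sided s) (flip s N u - flip s N v).
Proof. by case: s => //=; congr (ef _ _); lia. Qed.

Lemma rowsum s N (u : int) (w : nat -> R[i]) :
  \sum_(x < N) ef E (u - x%:Z) * w (flipn s N x) =
  \sum_(y < N) ef (sided s) (flip s N u - y%:Z) * w y.
Proof.
case: s => //; rewrite (reindex_inj rev_ord_inj) /=; apply: eq_bigr => y _.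
have yN := ltn_ord y.
by congr (ef _ _ * w _); rewrite ?/flipn; lia.
Qed.

Definition toep N : 'M[R[i]]_N := \matrix_(x, y) ef E (x%:Z - y%:Z).

End Flip.

Section ToeplitzInverse.
Variable R : realType.
Variables (E : edge R) (B r : R).
Hypothesis ok : edge_ok E B r.

Let B0 : 0 <= B. Proof. exact: eo_B ok. Qed.
Let r0 : 0 < r. Proof. exact: eo_r0 ok. Qed.
Let r1 : r < 1. Proof. exact: eo_r1 ok. Qed.

Lemma sided_ok s : edge_ok (sided E s) B r.
Proof. by case: s => //; exact: mirror_ok. Qed.

Let side N h : bool := (h.*2 < N)%N.
(** Each column is solved from the end to which its index is closer, so that the
    truncation error is at most of order r^(N/2). *)
Definition approx_inv N : 'M[R[i]]_N :=
  \matrix_(x, h) hole_sol (sided E (side N h)) (flipn (side N h) N h) (flipn (side N h) N x)%:Z.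

Lemma toep_approx_inv N u h :
  cn ((toep E N *m approx_inv N - 1%:M) u h) <= N%:R * (B * (B * Num.sqrt r ^+ N)).
Proof.
have hN := ltn_ord h; have uN := ltn_ord u.
rewrite !mxE; set s := side N h; set h' := flipn s N h.
have h'N : (h' < N)%N by exact: flipn_lt.
(* The distance to the nearer end is at most N / 2. *)
have h2 : (h'.*2 <= N)%N.
  by rewrite /h' /flipn /s /side; case: ltnP => //; [move=> /ltnW|]; lia.
rewrite (eq_bigr (fun x : 'I_N => ef E (u%:Z - x%:Z) *
   hole_sol (sided E s) h' (flipn s N x)%:Z)); last by move=> x _; rewrite !mxE.
rewrite (rowsum E s N u%:Z (fun x => hole_sol (sided E s) h' x%:Z)) -flipnE //.
have -> : (u == h)%:R = (flipn s N u == h')%:R :> R[i].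
  by rewrite /h' flipn_eq // -val_eqE.
apply: le_trans (hole_sol_eq_in (sided_ok s) _ h'N) _.
apply: ler_pM => //.
- by rewrite !mulr_ge0 // exprn_ge0 // ltW.
- by rewrite ler_nat.
- apply: ler_wpM2l => //; apply: ler_wpM2l => //.
  rewrite -{1}(sqr_sqrtr (ltW r0)) -exprM.
  have q1 : Num.sqrt r <= 1 by rewrite -sqrtr1 ler_sqrt // ltW.
  have -> : (2 * (N - h') = N + (N - h'.*2))%N by lia.
  by rewrite exprD ler_piMr ?exprn_ge0 ?exprn_ile1 ?sqrtr_ge0.
Qed.

Lemma toep_inverse : exists N0 : nat, forall N, (N0 <= N)%N ->
  toep E N \in unitmx /\ forall x y, cn (invmx (toep E N) x y) <= 2 * (N%:R * (B * B)).
Proof.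
pose q := Num.sqrt r; have q0 : 0 <= q by exact: sqrtr_ge0.
have q1 : q < 1 by rewrite /q -sqrtr1 ltr_sqrt.
pose q2 := (q + 1) / 2; have qq2 : q < q2 by rewrite /q2; lra.
have q21 : q2 < 1 by rewrite /q2; lra.
have q20 : 0 <= q2 by rewrite /q2; lra.
have [K K0 HK] := poly_geo 2 q0 qq2.
have h0 : 0 < 1 / 2 :> R by lra.
have [N0 HN] := geo_small (B * B * K) q20 q21 h0.
exists N0 => N NN.
apply: (approx_inverse (S := approx_inv N) (D := toep E N *m approx_inv N - 1%:M)
  (e := N%:R * (B * (B * q ^+ N)))).
- by rewrite addrC subrK.
- exact: toep_approx_inv.
- apply: ltW; apply: le_lt_trans (HN N NN).
  have -> : N%:R * (N%:R * (B * (B * q ^+ N))) = B * B * (N%:R ^+ 2 * q ^+ N) by ring.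
  by rewrite -(mulrA (B * B)) ler_wpM2l ?mulr_ge0.
move=> x h; rewrite mxE; apply: le_trans (hole_sol_le (sided_ok _) _ _) _.
apply: ler_wpM2r; first exact: mulr_ge0.
by rewrite ler_nat; exact: flipn_lt.
Qed.

End ToeplitzInverse.

(** * Limit of the reduced determinant *)

Section ExcitedLimit.
Variable R : realType.
Variables (E : edge R) (B r : R).
Hypothesis ok : edge_ok E B r.

Let B0 : 0 <= B. Proof. exact: eo_B ok. Qed.
Let r0 : 0 < r. Proof. exact: eo_r0 ok. Qed.
Let r1 : r < 1. Proof. exact: eo_r1 ok. Qed.
Let rle (n m : nat) : (m <= n)%N -> r ^+ n <= r ^+ m.
Proof. by move=> mn; rewrite -(subnK mn) exprD ler_piMl ?exprn_ge0 ?exprn_ile1 ?(ltW r0) ?(ltW r1). Qed.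

Lemma approx_bound (u : nat -> R[i]) (l : R[i]) (c : R) (m N0 : nat) : 0 <= c ->
  (forall N, (N0 <= N)%N -> cn (u N - l) <= c * r ^+ (N - m)) -> approx u l.
Proof.
move=> c0 H; split; apply: (tiny_poly (c := c) (r := r) (k := 0) (m := m) (N0 := N0)) => // N h.
by rewrite expr0 mul1r; exact: H.
Qed.

Lemma hole_sol_small s (h x : nat) :
  cn (hole_sol (sided E s) h x%:Z) <= h.+1%:R * (B * (B * r ^+ (x - h))).
Proof.
have okS := sided_ok ok s.
apply: (sum_ord_le (F := fun i => ebi (sided E s) (h - i)%N * ext (eai (sided E s)) (x%:Z - i%:Z))) => i ih.
rewrite cnM; apply: ler_pM; rewrite ?cn_ge0 ?(ebi_le okS) //.
have [ix|xi] := leqP i x.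
  have -> : x%:Z - i%:Z = (x - i)%N%:Z by lia.
  by apply: le_trans (eo_ai okS _) _; rewrite ler_wpM2l // rle // leq_sub2l.
have -> : x%:Z - i%:Z = Negz (i - x).-1 by lia.
by rewrite (_ : ext _ _ = 0) // cn0 mulr_ge0 // exprn_ge0 // ltW.
Qed.

(** Positions are recorded by the end of the matrix to which they are attached
    and by their distance to it, inside the matrix for holes and outside for
    particles. *)
Definition posH N (h : bool * nat) : int := flip h.1 N h.2%:Z.
Definition posP N (p : bool * nat) : int := flip p.1 N (- p.2.+1%:Z).

Let cst (k : nat) : R := k.+1%:R * (B * B).
Let cst0 k : 0 <= cst k. Proof. by rewrite !mulr_ge0. Qed.

Lemma posP_other s (p : bool * nat) N : p.1 != s -> flip s N (posP N p) = (N + p.2)%N%:Z.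
Proof. by case: p => [b p] /=; rewrite /posP /flip /=; case: s; case: b => // _; lia. Qed.

Definition hole_sol_at N (h : bool * nat) (x : nat) : R[i] :=
  hole_sol (sided E h.1) h.2 (flipn h.1 N x)%:Z.
Definition part_sol_at N (k : bool * nat) (x : nat) : R[i] :=
  part_sol (sided E k.1) k.2 (flipn k.1 N x).

Lemma row_hole N (h : bool * nat) (u : int) :
  \sum_(x < N) ef E (u - x%:Z) * hole_sol_at N h x =
  \sum_(x < N) ef (sided E h.1) (flip h.1 N u - x%:Z) * hole_sol (sided E h.1) h.2 x%:Z.
Proof. exact: (rowsum E h.1 N u (fun x => hole_sol (sided E h.1) h.2 x%:Z)). Qed.

Lemma row_part N (k : bool * nat) (u : int) :
  \sum_(x < N) ef E (u - x%:Z) * part_sol_at N k x =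
  \sum_(x < N) ef (sided E k.1) (flip k.1 N u - x%:Z) * part_sol (sided E k.1) k.2 x.
Proof. exact: (rowsum E k.1 N u (fun x => part_sol (sided E k.1) k.2 x)). Qed.

Lemma defect_hole N (h : bool * nat) (u : nat) : (h.2 < N)%N -> (u < N)%N ->
  cn (\sum_(x < N) ef E (u%:Z - x%:Z) * hole_sol_at N h x - (u%:Z == posH N h)%:R) <=
  cst h.2 * r ^+ (N - h.2).
Proof.
move=> hN uN; rewrite row_hole -flipnE //.
have -> : (u%:Z == posH N h) = (flipn h.1 N u == h.2).
  rewrite /posH -(inv_eq (flipK h.1 N)) -flipnE //.
apply: le_trans (hole_sol_eq_in (sided_ok ok _) _ hN) _.
by rewrite /cst !mulrA.
Qed.

Lemma ef_posP N (k : bool * nat) (u : int) :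
  ef E (u - posP N k) = ef (sided E k.1) (flip k.1 N u + 1 + k.2%:Z).
Proof. by rewrite (ef_flip E k.1 N) /posP flipK; congr (ef _ _); lia. Qed.

Lemma defect_part N (k : bool * nat) (u : nat) : (u < N)%N ->
  cn (\sum_(x < N) ef E (u%:Z - x%:Z) * part_sol_at N k x - ef E (u%:Z - posP N k)) <=
  cst k.2 * r ^+ N.
Proof.
move=> uN; rewrite row_part ef_posP -flipnE //.
apply: le_trans (part_sol_eq_in (sided_ok ok _) _ _ _) _.
by rewrite /cst !mulrA.
Qed.

(** Members attached to opposite ends do not interact in the limit. *)
Definition lim_ph (p h : bool * nat) : R[i] :=
  if p.1 == h.1 then end_ph (sided E h.1) p.2 h.2 else 0.
Definition lim_pp (p k : bool * nat) : R[i] :=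
  if p.1 == k.1 then end_pp (sided E k.1) p.2 k.2 else 0.
Definition lim_hh (t h : bool * nat) : R[i] :=
  if t.1 == h.1 then end_hh (sided E h.1) t.2 h.2 else 0.
Definition lim_hp (t k : bool * nat) : R[i] :=
  if t.1 == k.1 then end_hp (sided E k.1) t.2 k.2 else 0.

(** A particle beyond the opposite end lies in a row of index at least N, where
    the hole equation still holds, with right-hand side 0. *)
Lemma approx_lim_ph p h :
  approx (fun N => \sum_(x < N) ef E (posP N p - x%:Z) * hole_sol_at N h x) (lim_ph p h).
Proof.
apply: (@approx_bound _ _ (cst h.2) h.2 h.2.+1) => // N hN.
rewrite row_hole /lim_ph; have [ph|ph] := eqVneq p.1 h.1.
  rewrite /posP ph flipK; apply: le_trans (hole_sol_eq_out (sided_ok ok _) _ hN) _.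
  by rewrite /cst !mulrA.
rewrite posP_other //; have := hole_sol_eq_in (sided_ok ok h.1) (N + p.2) hN.
have -> : (N + p.2 == h.2)%N = false by lia.
by move=> /le_trans; apply; rewrite /cst !mulrA.
Qed.

Lemma approx_lim_pp p k :
  approx (fun N => \sum_(x < N) ef E (posP N p - x%:Z) * part_sol_at N k x - ef E (posP N p - posP N k))
  (- lim_pp p k).
Proof.
apply: (@approx_bound _ _ (cst k.2) 0 0) => // N _; rewrite subn0.
rewrite row_part ef_posP /lim_pp; have [pk|pk] := eqVneq p.1 k.1.
  rewrite /posP pk flipK; have := part_sol_eq_out (sided_ok ok k.1) p.2 k.2 N.
  have -> : - p.2.+1%:Z + 1 + k.2%:Z = k.2%:Z - p.2%:Z by lia.
  by rewrite opprK opprB addrA addrAC => /le_trans; apply; rewrite /cst !mulrA.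
rewrite posP_other // oppr0 subr0.
by apply: le_trans (part_sol_eq_in (sided_ok ok _) _ _ _) _; rewrite /cst !mulrA.
Qed.

Lemma sum_delta N (t : bool * nat) (w : nat -> R[i]) : (t.2 < N)%N ->
  \sum_(x < N) (x%:Z == posH N t)%:R * w x = w (flipn t.1 N t.2).
Proof.
move=> tN; have fN := flipn_lt t.1 tN.
rewrite (bigD1 (Ordinal fN)) //= /posH -flipnE // eqxx mul1r big1 ?addr0 // => x.
by rewrite -val_eqE /= eqz_nat => /negbTE ->; rewrite mul0r.
Qed.

Lemma flipn_same s N x : (x < N)%N -> flipn s N (flipn s N x) = x.
Proof. by case: s => // xN; rewrite /flipn; lia. Qed.

Lemma flipn_other s s' N x : (x < N)%N -> s != s' -> flipn s N (flipn s' N x) = (N.-1 - x)%N.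
Proof. by case: s; case: s' => // xN _; rewrite /flipn; lia. Qed.

Lemma approx_lim_hh t h :
  approx (fun N => \sum_(x < N) (x%:Z == posH N t)%:R * hole_sol_at N h x) (lim_hh t h).
Proof.
apply: (@approx_bound _ _ (cst h.2) (t.2 + h.2).+1 t.2.+1) => // N tN.
rewrite sum_delta // /hole_sol_at /lim_hh; have [th|th] := eqVneq t.1 h.1.
  by rewrite th flipn_same // subrr cn0 mulr_ge0 // exprn_ge0 // ltW.
rewrite subr0 flipn_other //; last by rewrite eq_sym.
apply: le_trans (hole_sol_small _ _ _) _; rewrite /cst -!mulrA ler_wpM2l // ler_wpM2l // ler_wpM2l //.
by rewrite (_ : (N.-1 - t.2 - h.2 = N - (t.2 + h.2).+1)%N) //; lia.
Qed.

Lemma approx_lim_hp t k :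
  approx (fun N => \sum_(x < N) (x%:Z == posH N t)%:R * part_sol_at N k x) (lim_hp t k).
Proof.
apply: (@approx_bound _ _ (cst k.2) t.2.+1 t.2.+1) => // N tN.
rewrite sum_delta // /part_sol_at /lim_hp; have [tk|tk] := eqVneq t.1 k.1.
  by rewrite tk flipn_same // subrr cn0 mulr_ge0 // exprn_ge0 // ltW.
rewrite subr0 flipn_other //; last by rewrite eq_sym.
apply: le_trans (part_sol_le (sided_ok ok _) _ _) _.
rewrite /cst -!mulrA ler_wpM2l // ler_wpM2l // ler_wpM2l //.
by rewrite (_ : (N.-1 - t.2 = N - t.2.+1)%N) //; lia.
Qed.

Variables (n q : nat) (P H : 'I_n -> bool * nat) (K T : 'I_q -> bool * nat).

Definition rowsP N : 'M[R[i]]_(n, N) := \matrix_(a, x) ef E (posP N (P a) - x%:Z).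
Definition rowsT N : 'M[R[i]]_(q, N) := \matrix_(b, x) (x%:Z == posH N (T b))%:R.
Definition colsH N : 'M[R[i]]_(N, n) := \matrix_(x, a) (x%:Z == posH N (H a))%:R.
Definition colsK N : 'M[R[i]]_(N, q) := \matrix_(x, b) ef E (x%:Z - posP N (K b)).
Definition cornPK N : 'M[R[i]]_(n, q) := \matrix_(a, b) ef E (posP N (P a) - posP N (K b)).
(** The small matrix of det_excite; excited_lim is its limit. *)
Definition excited N : 'M[R[i]]_(n + q) :=
  col_mx (rowsP N) (rowsT N) *m invmx (toep E N) *m row_mx (colsH N) (colsK N) -
  block_mx 0 (cornPK N) 0 0.
Definition excited_lim : 'M[R[i]]_(n + q) :=
  block_mx (\matrix_(a, b) lim_ph (P a) (H b)) (\matrix_(a, b) - lim_pp (P a) (K b))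
           (\matrix_(a, b) lim_hh (T a) (H b)) (\matrix_(a, b) lim_hp (T a) (K b)).

Let wH N : 'M[R[i]]_(N, n) := \matrix_(x, a) hole_sol_at N (H a) x.
Let wK N : 'M[R[i]]_(N, q) := \matrix_(x, b) part_sol_at N (K b) x.
Let Y N := col_mx (rowsP N) (rowsT N).
Let X N := row_mx (colsH N) (colsK N).
Let W N := row_mx (wH N) (wK N).

Let limYW i j :
  approx (fun N => (Y N *m W N - block_mx 0 (cornPK N) 0 0) i j) (excited_lim i j).
Proof.
rewrite /excited_lim; case: (split_ordP i) => a ->; case: (split_ordP j) => b ->.
- rewrite block_mxEul mxE; apply: (approx_ext (N0 := 0%N)) (approx_lim_ph (P a) (H b)) => N _.
  rewrite /Y /W mul_col_row opp_block_mx add_block_mx block_mxEul oppr0 addr0 mxE.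
  by apply: eq_bigr => x _; rewrite !mxE.
- rewrite block_mxEur mxE; apply: (approx_ext (N0 := 0%N)) (approx_lim_pp (P a) (K b)) => N _.
  rewrite /Y /W mul_col_row opp_block_mx add_block_mx block_mxEur !mxE; congr (_ - _).
  by apply: eq_bigr => x _; rewrite !mxE.
- rewrite block_mxEdl mxE; apply: (approx_ext (N0 := 0%N)) (approx_lim_hh (T a) (H b)) => N _.
  rewrite /Y /W mul_col_row opp_block_mx add_block_mx block_mxEdl oppr0 addr0 mxE.
  by apply: eq_bigr => x _; rewrite !mxE.
- rewrite block_mxEdr mxE; apply: (approx_ext (N0 := 0%N)) (approx_lim_hp (T a) (K b)) => N _.
  rewrite /Y /W mul_col_row opp_block_mx add_block_mx block_mxEdr oppr0 addr0 mxE.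
  by apply: eq_bigr => x _; rewrite !mxE.
Qed.

Let defect j : exists c m N0, 0 <= c /\ forall N, (N0 <= N)%N -> forall x,
  cn ((toep E N *m W N - X N) x j) <= c * r ^+ (N - m).
Proof.
case: (split_ordP j) => b ->.
  exists (cst (H b).2), (H b).2, (H b).2.+1; split=> // N hN x.
  rewrite /W /X mul_mx_row opp_row_mx add_row_mx row_mxEl !mxE.
  apply: le_trans (defect_hole hN (ltn_ord x)); rewrite le_eqVlt; apply/orP; left; apply/eqP.
  by congr (cn (_ - _)); apply: eq_bigr => y _; rewrite !mxE.
exists (cst (K b).2), 0%N, 0%N; split=> // N _ x; rewrite subn0.
rewrite /W /X mul_mx_row opp_row_mx add_row_mx row_mxEr !mxE.
apply: le_trans (defect_part (K b) (ltn_ord x)); rewrite le_eqVlt; apply/orP; left; apply/eqP.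
by congr (cn (_ - _)); apply: eq_bigr => y _; rewrite !mxE.
Qed.

Let Y_le N i x : cn (Y N i x) <= B + 1.
Proof.
rewrite /Y; case: (split_ordP i) => a ->; rewrite ?col_mxEu ?col_mxEd mxE.
  by apply: le_trans (eo_f ok _) _; rewrite lerDl.
case: eqP => _; rewrite ?cn1 ?cn0; first by rewrite lerDr.
by rewrite addr_ge0.
Qed.

(** With W the explicit columns, Y T^-1 X = Y W + Y T^-1 (X - T W): the entries of
    T^-1 grow at most linearly whereas X - T W is geometrically small. *)
Lemma approx_excited : approx (fun N => \det (excited N)) (\det excited_lim).
Proof.
have [N1 HN1] := toep_inverse ok.
apply: approx_det => i j.
have [c [m [N0 [c0 Hd]]]] := defect j.
suff td : tiny (fun N => (Y N *m invmx (toep E N) *m (X N - toep E N *m W N)) i j).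
  have a0 : approx (fun N => (Y N *m invmx (toep E N) *m (X N - toep E N *m W N)) i j) 0.
    by split; apply: (tiny_ext (N0 := 0%N)) td => N _; rewrite subr0.
  have := approxD (limYW i j) a0; rewrite addr0; apply: (approx_ext (N0 := N1)) => N NN.
  have [Tu _] := HN1 N NN.
  transitivity ((Y N *m W N - block_mx 0 (cornPK N) 0 0 +
     Y N *m invmx (toep E N) *m (X N - toep E N *m W N)) i j); first by rewrite [RHS]mxE.
  congr (fun_of_matrix _ i j); rewrite /excited -/(Y N) -/(X N) mulmxBr.
  have -> : Y N *m invmx (toep E N) *m (toep E N *m W N) = Y N *m W N.
    by rewrite mulmxA mulmxKV.
  by rewrite addrAC addrCA subrr addr0.
apply: (tiny_poly (c := (B + 1) * (2 * (B * B)) * c) (r := r) (k := 3) (m := m)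
   (N0 := maxn N0 N1)) => //.
  by rewrite !mulr_ge0 // addr_ge0.
move=> N; rewrite geq_max => /andP[h0 h1]; have [_ Ti] := HN1 N h1.
have b1 k : cn ((Y N *m invmx (toep E N)) i k) <= N%:R * ((B + 1) * (2 * (N%:R * (B * B)))).
  by apply: mulmx_le => l; [exact: Y_le|exact: Ti].
have b2 k : cn ((X N - toep E N *m W N) k j) <= c * r ^+ (N - m).
  by apply: le_trans (Hd N h0 k); rewrite -opprB mxE cnN.
apply: le_trans (mulmx_le b1 b2) _.
by rewrite le_eqVlt; apply/orP; left; apply/eqP; ring.
Qed.

End ExcitedLimit.

(** * Overlapping families of holes *)

Section Overlap.
Variable F : fieldType.
Variables (n r c : nat).
Hypotheses (cn_ : (c <= n)%N) (cr_ : (c <= r)%N).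

(** The partial identity identifying the first c indices of both families. *)
Definition overlap_mx : 'M[F]_(n, r) := \matrix_(a, b) ((a == b :> nat) && (a < c)%N)%:R.
Local Notation Dl := overlap_mx.

Lemma overlap_mulE m (M : 'M[F]_(r, m)) (a : 'I_n) (a' : 'I_r) j :
  a = a' :> nat -> (Dl *m M) a j = if (a < c)%N then M a' j else 0.
Proof.
move=> aa; rewrite mxE (bigD1 a') //= mxE aa eqxx /= big1 ?addr0.
  by case: ifP; rewrite ?mul1r ?mul0r.
move=> b ba; rewrite mxE aa (_ : (a' == b :> nat) = false) ?mul0r //.
by apply: contraNF ba => /eqP/val_inj ->.
Qed.

Lemma overlap_mul0 m (M : 'M[F]_(r, m)) (a : 'I_n) j : (c <= a)%N -> (Dl *m M) a j = 0.
Proof.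
by move=> ca; rewrite mxE big1 // => b _; rewrite mxE ltnNge ca andbF mul0r.
Qed.

Lemma mul_overlapT m (M : 'M[F]_(m, r)) i (b : 'I_n) (b' : 'I_r) :
  b = b' :> nat -> (M *m Dl^T) i b = if (b < c)%N then M i b' else 0.
Proof.
move=> bb; rewrite -[M *m _]trmxK trmx_mul trmxK mxE (overlap_mulE _ _ bb) mxE.
by [].
Qed.

Lemma mul_overlapT0 m (M : 'M[F]_(m, r)) i (b : 'I_n) : (c <= b)%N -> (M *m Dl^T) i b = 0.
Proof. by move=> cb; rewrite -[M *m _]trmxK trmx_mul trmxK mxE overlap_mul0. Qed.

End Overlap.

Section OverlapDet.
Variable F : fieldType.

Lemma overlap_tr (n r c : nat) : (overlap_mx F n r c)^T = overlap_mx F r n c.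
Proof.
by apply/matrixP => a b; rewrite !mxE eq_sym; case: eqP => //= ->.
Qed.

Lemma mul_overlap (n r c m : nat) (M : 'M[F]_(m, n)) i (b : 'I_r) (b' : 'I_n) :
  b = b' :> nat -> (M *m overlap_mx F n r c) i b = if (b < c)%N then M i b' else 0.
Proof. by move=> bb; rewrite -(overlap_tr r n) (mul_overlapT _ _ _ bb). Qed.

Lemma mul_overlap0 (n r c m : nat) (M : 'M[F]_(m, n)) i (b : 'I_r) :
  (c <= b)%N -> (M *m overlap_mx F n r c) i b = 0.
Proof. by move=> cb; rewrite -(overlap_tr r n) mul_overlapT0. Qed.

(** The two matrices differ by the addition of rows to c others and by the
    exchange, up to a sign, of c pairs of columns. The latter is the product Pi of
    three unipotent matrices. *)
Lemma det_overlap (n r c : nat) (B M11 : 'M[F]_n) (A M12 : 'M[F]_(n, r))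
  (D M21 : 'M[F]_(r, n)) (C M22 : 'M[F]_r) : (c <= n)%N -> (c <= r)%N ->
  let Dl := overlap_mx F n r c in
  (forall a (b : 'I_n) (b' : 'I_r), b = b' :> nat -> (b < c)%N ->
     M11 a b = (A + Dl *m C) a b') ->
  (forall a (b : 'I_n), (c <= b)%N -> M11 a b = (B - Dl *m D) a b) ->
  (forall a (b : 'I_r) (b' : 'I_n), b = b' :> nat -> (b < c)%N ->
     M12 a b = - (B - Dl *m D) a b') ->
  (forall a (b : 'I_r), (c <= b)%N -> M12 a b = (A + Dl *m C) a b) ->
  (forall a (b : 'I_n) (b' : 'I_r), b = b' :> nat -> (b < c)%N -> M21 a b = C a b') ->
  (forall a (b : 'I_n), (c <= b)%N -> M21 a b = - D a b) ->
  (forall a (b : 'I_r) (b' : 'I_n), b = b' :> nat -> (b < c)%N -> M22 a b = D a b') ->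
  (forall a (b : 'I_r), (c <= b)%N -> M22 a b = C a b) ->
  \det (block_mx M11 M12 M21 M22) = \det (block_mx B A (- D) C).
Proof.
move=> cn cr Dl h1 h2 h3 h4 h5 h6 h7 h8.
pose Pi : 'M[F]_(n + r) := block_mx (1%:M - Dl *m Dl^T) (- Dl) Dl^T (1%:M - Dl^T *m Dl).
have dd (m : nat) (M : 'M[F]_(m, n)) i (b : 'I_n) :
    (M *m (Dl *m Dl^T)) i b = if (b < c)%N then M i b else 0.
  rewrite mulmxA; case: ltnP => bc; last by rewrite mul_overlapT0.
  have br := leq_trans bc cr.
  rewrite (@mul_overlapT _ _ _ _ _ _ i b (Ordinal br)) // bc.
  by rewrite (@mul_overlap _ _ _ _ _ i (Ordinal br) b) //= bc.
have dd' (m : nat) (M : 'M[F]_(m, r)) i (b : 'I_r) :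
    (M *m (Dl^T *m Dl)) i b = if (b < c)%N then M i b else 0.
  rewrite mulmxA; case: ltnP => bc; last by rewrite mul_overlap0.
  have bn := leq_trans bc cn.
  rewrite (@mul_overlap _ _ _ _ _ i b (Ordinal bn)) // bc.
  by rewrite (@mul_overlapT _ _ _ _ _ _ i (Ordinal bn) b) //= bc.
have E : block_mx M11 M12 M21 M22 =
    block_mx 1%:M Dl 0 1%:M *m block_mx B A (- D) C *m Pi.
  rewrite mulmx_block !(mul1mx, mul0mx, add0r) mulmxN mulmx_block.
  have mD (m k : nat) (U V : 'M[F]_(m, k)) i j : (U + V) i j = U i j + V i j.
    by rewrite mxE.
  have mN (m k : nat) (U : 'M[F]_(m, k)) i j : (- U) i j = - U i j by rewrite mxE.
  move: h1 h2 h3 h4; move: (A + Dl *m C) (B - Dl *m D) => At Bt h1 h2 h3 h4.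
  congr block_mx; apply/matrixP => a b.
  - rewrite mulmxBr mulmx1 (mD _ _ (Bt - _)) (mD _ _ Bt) mN dd.
    have [bc|cb] := ltnP b c.
      have br := leq_trans bc cr.
      rewrite subrr add0r (@mul_overlapT _ _ _ _ _ _ a b (Ordinal br)) // bc.
      exact: h1.
    by rewrite subr0 mul_overlapT0 // addr0 h2.
  - rewrite mulmxBr mulmx1 mulmxN (mD _ _ (- _)) (mD _ _ At) !mN dd'.
    have [bc|cb] := ltnP b c.
      have bn := leq_trans bc cn.
      rewrite subrr addr0 (@mul_overlap _ _ _ _ _ a b (Ordinal bn)) // bc.
      exact: h3.
    by rewrite subr0 mul_overlap0 // oppr0 add0r h4.
  - rewrite mulmxBr mulmx1 mulNmx opprK (mD _ _ (- D + _)) (mD _ _ (- D)) mN dd.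
    have [bc|cb] := ltnP b c.
      have br := leq_trans bc cr.
      rewrite addNr add0r (@mul_overlapT _ _ _ _ _ _ a b (Ordinal br)) // bc.
      exact: h5.
    by rewrite addr0 mul_overlapT0 // addr0 h6.
  - rewrite mulmxBr mulmx1 mulmxN mulNmx opprK (mD _ _ (D *m _)) (mD _ _ C) mN dd'.
    have [bc|cb] := ltnP b c.
      have bn := leq_trans bc cn.
      rewrite subrr addr0 (@mul_overlap _ _ _ _ _ a b (Ordinal bn)) // bc.
      exact: h7.
    by rewrite subr0 mul_overlap0 // add0r h8.
have PiE : Pi = block_mx 1%:M (- Dl) 0 1%:M *m block_mx 1%:M 0 Dl^T 1%:M *m
    block_mx 1%:M (- Dl) 0 1%:M.
  rewrite !mulmx_block !(mul1mx, mul0mx, mulmx1, mulmx0, addr0, add0r) mulNmx.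
  congr block_mx; last by rewrite mulmxN addrC.
  rewrite mulmxBl mul1mx -mulmxA.
  suff -> : Dl *m (Dl^T *m - Dl) = - Dl by rewrite opprK addNr add0r.
  rewrite mulmxN mulmxN; congr (- _); apply/matrixP => a b; rewrite dd'.
  by rewrite mxE; case: eqP => [->|]; case: ltnP.
rewrite E !det_mulmx PiE !det_mulmx !det_ublock !det_lblock !det1.
by rewrite !(mul1r, mulr1).
Qed.

End OverlapDet.

(** * The matrices of regularised integrals *)

Section EdgeDeterminant.
Variable R : realType.

(** One-sided coefficients make the sum over a large range finite, of a length
    independent of the range. *)
Lemma sum_ext_trunc (u : nat -> R[i]) (h J : nat) (F : nat -> R[i]) : (h < J)%N ->
  \sum_(j < J) ext u (h%:Z - j%:Z) * F j = \sum_(j < h.+1) u (h - j)%N * F j.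
Proof.
move=> hJ; pose G j := ext u (h%:Z - j%:Z) * F j.
rewrite -(big_mkord predT G) (big_cat_nat (leq0n h.+1) hJ) /= big_mkord.
rewrite [X in _ + X]big_nat_cond [X in _ + X]big1 ?addr0; last first.
  move=> j /andP[/andP[hj _] _]; rewrite /G.
  by rewrite (_ : h%:Z - j%:Z = Negz (j - h).-1) ?mul0r //; lia.
apply: eq_bigr => j _; rewrite /G.
by rewrite (_ : h%:Z - j%:Z = (h - j)%N%:Z) //; have := ltn_ord j; lia.
Qed.

Lemma det_block_signs (n r : nat) (B : 'M[R[i]]_n) (A : 'M[R[i]]_(n, r))
  (D : 'M[R[i]]_(r, n)) (C : 'M[R[i]]_r) :
  \det (block_mx B A (- D) C) = \det (block_mx B (- A) D C).
Proof.
(* Conjugation by a diagonal matrix of signs. *)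
pose S : 'M[R[i]]_(n + r) := block_mx 1%:M 0 0 (- 1%:M).
have SS : \det S * \det S = 1.
  rewrite -det_mulmx /S mulmx_block !(mul1mx, mul0mx, mulmx1, mulmx0, addr0, add0r).
  by rewrite mulNmx mul1mx opprK -scalar_mx_block det1.
have -> : block_mx B A (- D) C = S *m block_mx B (- A) D C *m S.
  rewrite /S !mulmx_block !(mul1mx, mul0mx, mulmx1, mulmx0, addr0, add0r).
  by rewrite !mulNmx !mulmxN !mul1mx !mulmx1 !opprK.
by rewrite !det_mulmx mulrAC SS mul1r.
Qed.

Let sum_I3 (F : 'I_3 -> R[i]) : \sum_i F i = F ord0 + F (lift ord0 ord0) + F ord_max.
Proof.
rewrite !big_ord_recl big_ord0 addr0 addrA; congr (_ + F _); exact: val_inj.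
Qed.

Let quot_regroup (m : int) (a b A B v w : R[i]) : a ^ m = A -> b ^ m = B ->
  (a / b) ^ m * v * w = A * w * (B^-1 * v).
Proof. by move=> <- <-; rewrite expfzMl exprz_inv -invr_expz; ring. Qed.

Let gather11 (k1 k2 k3 q1 q2 q3 v1 v2 v3 w1 w2 w3 g1 g2 g3 : R[i]) :
  q1 * v1 * w1 = g1 -> q2 * v2 * w2 = g2 -> q3 * v3 * w3 = g3 ->
  k1 * q1 * v1 * w1 + k2 * q2 * v2 * w2 - k3 * q3 * v3 * w3 = k1 * g1 + k2 * g2 + - k3 * g3.
Proof. by move=> <- <- <-; ring. Qed.

Let gather12 (k1 k2 k3 q1 q2 q3 v1 v2 v3 w1 w2 w3 g1 g2 g3 : R[i]) :
  q1 * v1 * w1 = g1 -> q2 * v2 * w2 = g2 -> q3 * v3 * w3 = g3 ->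
  k3 * q3 * v3 * w3 + k1 * q1 * v1 * w1 - k2 * q2 * v2 * w2 = k1 * g1 + - k2 * g2 + k3 * g3.
Proof. by move=> <- <- <-; ring. Qed.

Let gather21 (k1 k3 q1 q3 v w1 w3 g1 g2 g3 : R[i]) :
  q1 * v * w1 = g1 -> q3 * v * w3 = g3 ->
  v * (k1 * q1 * w1 - k3 * q3 * w3) = k1 * g1 + 0 * g2 + - k3 * g3.
Proof. by move=> <- <-; ring. Qed.

Let gather22 (k1 k3 q1 q3 v w1 w3 g1 g2 g3 : R[i]) :
  q1 * v * w1 = g1 -> q3 * v * w3 = g3 ->
  v * (k3 * q3 * w3 + k1 * q1 * w1) = k1 * g1 + 0 * g2 + k3 * g3.
Proof. by move=> <- <-; ring. Qed.

Variables (f : int -> R[i]) (lf : R[i] -> R[i]) (e : int).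
Variables (xs xs' ys ys' : nat -> R[i]) (X X' Y Y' : R[i] -> R[i]).
Hypotheses (ee : e = 1 \/ e = -1)
  (cX : ccirc X) (cX' : ccirc X') (cY : ccirc Y) (cY' : ccirc Y')
  (aX : forall x, alpha_bv lf (- e) (circ x) ^ e = X (circ x))
  (aY : forall x, alpha_bv lf e (circ x) ^ e = Y' (circ x))
  (XX : forall x, X' (circ x) = (X (circ x))^-1)
  (YY : forall x, Y (circ x) = (Y' (circ x))^-1)
  (fX : forall m, fourier X m = ext xs (- (e * m)))
  (fX' : forall m, fourier X' m = ext xs' (- (e * m)))
  (fY : forall m, fourier Y m = ext ys (e * m))
  (fY' : forall m, fourier Y' m = ext ys' (e * m))
  (inv : inv_seq xs xs').

Let Ed := Edge f xs xs' ys ys'.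

(** For e = 1 the positions in the families start from 1, for e = -1 from 0. *)
Definition edge_shift : int := if e == 1 then 1 else 0.
Local Notation d := edge_shift.

Let gX k z := X z * z ^ (e * k - 1).
Let gY' h z := Y' z * z ^ (- e * h).
Let hX' h s := X' s * s ^ (e * h - 1).
Let hY p s := Y s * s ^ (- e * p).

Let cgX k : ccirc (gX k). Proof. exact: ccircM cX (@ccirc_exprz R _). Qed.
Let cgY' h : ccirc (gY' h). Proof. exact: ccircM cY' (@ccirc_exprz R _). Qed.
Let chX' h : ccirc (hX' h). Proof. exact: ccircM cX' (@ccirc_exprz R _). Qed.
Let chY p : ccirc (hY p). Proof. exact: ccircM cY (@ccirc_exprz R _). Qed.

Let fgX k j : fourier (gX k) (-1 - kernel_exp e j) = ext xs (j%:Z + (k - d) + 1).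
Proof.
rewrite /gX fourier_shift // fX /kernel_exp /edge_shift.
by case: ee => -> /=; congr (ext _ _); lia.
Qed.
Let fgXN k j : fourier (gX k) (-1 - kernel_exp (- e) j) = ext xs ((k - d) - j%:Z).
Proof.
rewrite /gX fourier_shift // fX /kernel_exp /edge_shift.
by case: ee => -> /=; congr (ext _ _); lia.
Qed.
Let fgY' h j : fourier (gY' h) (-1 - kernel_exp e j) = ext ys' ((h - d) - j%:Z).
Proof.
rewrite /gY' fourier_shift // fY' /kernel_exp /edge_shift.
by case: ee => -> /=; congr (ext _ _); lia.
Qed.
Let fhX' h j : fourier (hX' h) (kernel_exp e j) = ext xs' ((h - d) - j%:Z).
Proof.
rewrite /hX' fourier_shift // fX' /kernel_exp /edge_shift.
by case: ee => -> /=; congr (ext _ _); lia.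
Qed.
Let fhY p j : fourier (hY p) (kernel_exp e j) = ext ys (j%:Z + (p - d) + 1).
Proof.
rewrite /hY fourier_shift // fY /kernel_exp /edge_shift.
by case: ee => -> /=; congr (ext _ _); lia.
Qed.
Let fhYN p j : fourier (hY p) (kernel_exp (- e) j) = ext ys ((p - d) - j%:Z).
Proof.
rewrite /hY fourier_shift // fY /kernel_exp /edge_shift.
by case: ee => -> /=; congr (ext _ _); lia.
Qed.

Variables (n r : nat) (p h : 'I_n -> int) (k t : 'I_r -> int) (c : nat).
Variables (pn hn : 'I_n -> nat) (kn tn : 'I_r -> nat).
Hypotheses (pE : forall a, p a = (pn a)%:Z + d) (hE : forall a, h a = (hn a)%:Z + d)
  (kE : forall b, k b = (kn b)%:Z + d) (tE : forall b, t b = (tn b)%:Z + d).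
Hypotheses (cn_ : (c <= n)%N) (cr_ : (c <= r)%N)
  (ht : forall (a : 'I_n) (b : 'I_r), a = b :> nat -> (a < c)%N -> h a = t b).

Let J : nat := (\sum_a hn a + \sum_b kn b + \sum_b tn b).+1.
Let hJ a : (hn a < J)%N.
Proof. by rewrite /J ltnS -!addnA (bigD1 a) //= -!addnA leq_addr. Qed.
Let kJ b : (kn b < J)%N.
Proof. by rewrite /J ltnS (bigD1 (P := predT) (F := kn) b) //= addnAC addnCA -addnA leq_addr. Qed.
Let tJ b : (tn b < J)%N.
Proof. by rewrite /J ltnS (bigD1 (P := predT) (F := tn) b) //= addnCA leq_addr. Qed.

Let vC (hh : nat) (kk : int) := \sum_(j < J) ext xs (j%:Z + kk + 1) * ext xs' (hh%:Z - j%:Z).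
Let vB (pp hh : nat) := \sum_(j < J) ext ys' (hh%:Z - j%:Z) * ext ys (j%:Z + pp%:Z + 1).
Let vD (ha hb : nat) := \sum_(j < J) ext ys' (hb%:Z - j%:Z) * ext xs' (ha%:Z - j%:Z).
Let vA (pp kk : nat) := \sum_(j < J) ext xs (kk%:Z - j%:Z) * ext ys (pp%:Z - j%:Z).

Let ext_neg (u : nat -> R[i]) (hh j : nat) : (hh < j)%N -> ext u (hh%:Z - j%:Z) = 0.
Proof. by move=> hj; rewrite (_ : hh%:Z - j%:Z = Negz (j - hh).-1) //; lia. Qed.

Let vB_end pp hh : (hh < J)%N -> vB pp hh = end_ph Ed pp hh.
Proof.
move=> hhJ; rewrite /vB /end_ph (sum_ext_trunc _ (fun j => ext ys (j%:Z + pp%:Z + 1)) hhJ).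
apply: eq_bigr => j _; congr (_ * _).
by rewrite (_ : j%:Z + pp%:Z + 1 = (pp + 1 + j)%N%:Z) //; lia.
Qed.

Let vA_end pp kk : (kk < J)%N -> vA pp kk = end_pp Ed pp kk.
Proof.
by move=> kkJ; rewrite /vA /end_pp (sum_ext_trunc _ (fun j => ext ys (pp%:Z - j%:Z)) kkJ).
Qed.

Let vD_end ha hb : (hb < J)%N -> vD ha hb = end_hh Ed ha hb.
Proof.
by move=> hbJ; rewrite /vD /end_hh /hole_sol (sum_ext_trunc _ (fun j => ext xs' (ha%:Z - j%:Z)) hbJ).
Qed.

(** The sum over j and the sum defining part_sol are complementary parts of the
    convolution of xs and its inverse, which vanishes at a positive index. *)
Let vC_end hh kk : (hh < J)%N -> vC hh kk%:Z = end_hp Ed hh kk.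
Proof.
move=> hhJ; rewrite /vC /end_hp /part_sol.
under eq_bigr => j _ do rewrite mulrC.
rewrite (sum_ext_trunc _ (fun j => ext xs (j%:Z + kk%:Z + 1)) hhJ) /=.
apply/eqP; rewrite -addr_eq0; apply/eqP.
pose G i := xs (hh + kk.+1 - i)%N * xs' i.
have := inv (hh + kk.+1)%N; rewrite (_ : (hh + kk.+1 == 0)%N = false); last by lia.
move=> I0; apply: etrans I0.
rewrite -[RHS](big_mkord predT G) (big_cat_nat (n := hh.+1) (leq0n hh.+1)) /=; last by lia.
congr (_ + _).
  rewrite big_mkord (reindex_inj rev_ord_inj) /=; apply: eq_bigr => j _.
  have := ltn_ord j => jh; rewrite /G mulrC subSS.
  by congr (xs _ * xs' _); lia.
rewrite -{1}[hh.+1]add0n big_addn (_ : ((hh + kk.+1).+1 - hh.+1 = kk.+1)%N); last by lia.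
rewrite big_mkord; apply: eq_bigr => i _; rewrite /G.
by congr (xs _ * xs' _); lia.
Qed.

Let term1 x y kk hh : (alpha_bv lf (- e) (circ x) / alpha_bv lf (- e) (circ y)) ^ e *
  circ y ^ (e * hh - 1) * circ x ^ (e * kk - 1) = gX kk (circ x) * hX' hh (circ y).
Proof. by rewrite /gX /hX' XX; exact: quot_regroup. Qed.

Let term2 x y pp hh : (alpha_bv lf e (circ x) / alpha_bv lf e (circ y)) ^ e *
  circ y ^ (- e * pp) * circ x ^ (- e * hh) = gY' hh (circ x) * hY pp (circ y).
Proof. by rewrite /gY' /hY YY; exact: quot_regroup. Qed.

Let term3 x y ha hb : (alpha_bv lf e (circ x) / alpha_bv lf (- e) (circ y)) ^ e *
  circ y ^ (e * ha - 1) * circ x ^ (- e * hb) = gY' hb (circ x) * hX' ha (circ y).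
Proof. by rewrite /gY' /hX' XX; exact: quot_regroup. Qed.

Let term4 x y pp kk : circ y ^ (- e * pp) * circ x ^ (e * kk - 1) *
  (alpha_bv lf (- e) (circ x) / alpha_bv lf e (circ y)) ^ e = gX kk (circ x) * hY pp (circ y).
Proof. by rewrite /gX /hY YY; rewrite [LHS]mulrC [LHS]mulrA; exact: quot_regroup. Qed.

Let pick3 (T : Type) (u v w : T) (i : 'I_3) : T :=
  match val i with 0%N => u | 1%N => v | _ => w end.

(** The three kinds of terms of an integrand, each a product of a function of z and
    a function of s, with J beyond the degree of the one-sided factors. *)
Let eval3 (G : R[i] -> R[i] -> R[i]) (k1 k2 k3 : R[i]) (kk : int) (h1 h2 h3 h4 pp : nat) :
  (h1 < J)%N -> (h2 < J)%N -> (h3 < J)%N ->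
  (forall x y, G (circ x) (circ y) =
     k1 * (gX (kk + d) (circ x) * hX' (h1%:Z + d) (circ y)) +
     k2 * (gY' (h2%:Z + d) (circ x) * hY (pp%:Z + d) (circ y)) +
     k3 * (gY' (h3%:Z + d) (circ x) * hX' (h4%:Z + d) (circ y))) ->
  - e%:~R * reg_dint e G = k1 * vC h1 kk + k2 * vB pp h2 + k3 * vD h4 h3.
Proof.
move=> b1 b2 b3 GE.
rewrite (@reg_dint_eval _ e G 3 J (pick3 k1 k2 k3)
  (pick3 (gX (kk + d)) (gY' (h2%:Z + d)) (gY' (h3%:Z + d)))
  (pick3 (hX' (h1%:Z + d)) (hY (pp%:Z + d)) (hX' (h4%:Z + d)))) //.
- rewrite sum_I3 /pick3 /= /vC /vB /vD.
  congr (_ * _ + _ * _ + _ * _); apply: eq_bigr => j _.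
  + by rewrite fgX fhX' !addrK.
  + by rewrite fgY' fhY !addrK.
  + by rewrite fgY' fhX' !addrK.
- by case=> [[|[|[|]]]] //= ?; rewrite /pick3 /=.
- by case=> [[|[|[|]]]] //= ?; rewrite /pick3 /=.
- by move=> x y; rewrite GE sum_I3.
- case=> [[|[|[|]]]] //= ? j Jj; rewrite /pick3 /=.
  + by rewrite fhX' addrK ext_neg ?mulr0 //; apply: leq_trans Jj.
  + by rewrite fgY' addrK ext_neg ?mul0r //; apply: leq_trans Jj.
  + by rewrite fgY' addrK ext_neg ?mul0r //; apply: leq_trans Jj.
Qed.

Let eval4 (G : R[i] -> R[i] -> R[i]) (kk pp : nat) : (kk < J)%N ->
  (forall x y, G (circ x) (circ y) = gX (kk%:Z + d) (circ x) * hY (pp%:Z + d) (circ y)) ->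
  e%:~R * reg_dint (- e) G = vA pp kk.
Proof.
move=> b1 GE; have ee' : - e = 1 \/ - e = -1 by case: ee => ->; [right|left].
have := @reg_dint_eval _ (- e) G 1 J (fun=> 1) (fun=> gX (kk%:Z + d)) (fun=> hY (pp%:Z + d)) ee'.
rewrite mulrNz opprK => ->.
- rewrite big_ord1 mul1r; apply: eq_bigr => j _.
  by rewrite fgXN fhYN !addrK.
- by [].
- by [].
- by move=> x y; rewrite GE big_ord1 mul1r.
- by move=> _ j Jj; rewrite fgXN addrK ext_neg ?mul0r //; apply: leq_trans Jj.
Qed.

Let mB : 'M[R[i]]_n := \matrix_(a, b) end_ph Ed (pn a) (hn b).
Let mA : 'M[R[i]]_(n, r) := \matrix_(a, b) end_pp Ed (pn a) (kn b).
Let mD : 'M[R[i]]_(r, n) := \matrix_(a, b) end_hh Ed (tn a) (hn b).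
Let mC : 'M[R[i]]_r := \matrix_(a, b) end_hp Ed (tn a) (kn b).

Let fam_atE (b : nat) (b' : 'I_r) : b = b' -> fam_at k b = (kn b')%:Z + d.
Proof. by move=> ->; rewrite /fam_at valK -kE. Qed.

Let hn_tn (a : 'I_n) (a' : 'I_r) : a = a' :> nat -> (a < c)%N -> hn a = tn a'.
Proof. by move=> aa ac; have := ht aa ac; rewrite hE tE => /addIr []. Qed.

Let N11E a b : N_I_I lf e p h k t c a b =
  ((b < c)%N%:R * (a < c)%N%:R) * vC (hn a) (fam_at k b - d) +
  (c <= b)%N%:R * vB (pn a) (hn b) + - ((c <= b)%N%:R * (a < c)%N%:R) * vD (hn a) (hn b) +
  e%:~R * (b < c)%N%:R * reg_dint (- e) (fun z s =>
    s ^ (- e * p a) * z ^ (e * fam_at k b - 1) * (alpha_bv lf (- e) z / alpha_bv lf e s) ^ e).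
Proof.
rewrite mxE; congr (_ + _); apply: eval3 => // x y.
rewrite subrK -!hE -pE.
exact: gather11 (term1 x y _ _) (term2 x y _ _) (term3 x y _ _).
Qed.

Let N12E a b : N_I_II lf e p h k t c a b =
  ((c <= b)%N%:R * (a < c)%N%:R) * vC (hn a) (kn b)%:Z +
  - (b < c)%N%:R * vB (pn a) (tn b) + ((b < c)%N%:R * (a < c)%N%:R) * vD (hn a) (tn b) +
  e%:~R * (c <= b)%N%:R * reg_dint (- e) (fun z s =>
    s ^ (- e * p a) * z ^ (e * k b - 1) * (alpha_bv lf (- e) z / alpha_bv lf e s) ^ e).
Proof.
rewrite mxE; congr (_ + _); apply: eval3 => // x y.
rewrite -hE -kE -tE -pE.
exact: gather12 (term1 x y _ _) (term2 x y _ _) (term3 x y _ _).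
Qed.

Let N21E a b : N_II_I lf e p h k t c a b =
  (b < c)%N%:R * vC (tn a) (fam_at k b - d) + 0 * vB 0 0 + - (c <= b)%N%:R * vD (tn a) (hn b).
Proof.
rewrite mxE; apply: eval3 => // x y.
rewrite subrK -hE -tE.
exact: gather21 (term1 x y _ _) (term3 x y _ _).
Qed.

Let N22E a b : N_II_II lf e p h k t c a b =
  (c <= b)%N%:R * vC (tn a) (kn b)%:Z + 0 * vB 0 0 + (b < c)%N%:R * vD (tn a) (tn b).
Proof.
rewrite mxE; apply: eval3 => // x y.
rewrite -kE -!tE.
exact: gather22 (term1 x y _ _) (term3 x y _ _).
Qed.

Let eval4' a b (kk : int) : kk = (kn b)%:Z + d ->
  e%:~R * reg_dint (- e) (fun z s => s ^ (- e * p a) * z ^ (e * kk - 1) *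
    (alpha_bv lf (- e) z / alpha_bv lf e s) ^ e) = end_pp Ed (pn a) (kn b).
Proof.
by move=> ->; rewrite -vA_end //; apply: eval4 => // x y; rewrite -pE; exact: term4.
Qed.

(** Entry by entry, the regularised integrals are the limits found for one end of
    the Toeplitz matrix, combined as in det_overlap when holes are common to both
    families. *)
Lemma det_Nmx : \det (Nmx lf e p h k t c) = \det (block_mx mB (- mA) mD mC).
Proof.
have ol (m : nat) (M : 'M[R[i]]_(r, m)) (a : 'I_n) j (v : nat -> R[i]) :
    (forall a', M a' j = v (tn a')) -> (overlap_mx _ n r c *m M) a j = (a < c)%N%:R * v (hn a).
  move=> Mv; have [ac|ca] := ltnP a c; last by rewrite overlap_mul0 // mul0r.
  have ar := leq_trans ac cr_.
  by rewrite (@overlap_mulE _ _ _ _ _ _ a (Ordinal ar)) // ac Mv mul1r (@hn_tn _ (Ordinal ar)).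
rewrite -det_block_signs /Nmx; apply: (det_overlap (c := c)) => //.
- move=> a b b' bb bc; rewrite N11E bc (leqNgt c b) bc /= (fam_atE bb) addrK vC_end //.
  rewrite mulr1 (eval4' _ erefl) mxE (ol _ _ _ _ (fun x => end_hp Ed x (kn b'))) ?mxE //.
    by ring.
  by move=> a'; rewrite mxE.
- move=> a b cb; rewrite N11E cb (ltnNge b c) cb /= vB_end // vD_end //.
  rewrite !mulr0 !mul0r addr0 add0r !mul1r mxE [X in _ = _ + X]mxE.
  rewrite (ol _ _ _ _ (fun x => end_hh Ed x (hn b))) ?mxE ?mulNr //.
  by move=> a'; rewrite mxE.
- move=> a b b' bb bc; rewrite N12E bc (leqNgt c b) bc /= vB_end // vD_end //.
  have tb : tn b = hn b' by rewrite -(@hn_tn b' b) -?bb.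
  rewrite !mulr0 !mul0r addr0 add0r !mul1r mxE [X in _ = - (_ + X)]mxE.
  rewrite (ol _ _ _ _ (fun x => end_hh Ed x (hn b'))) ?mxE -?tb.
    by ring.
  by move=> a'; rewrite mxE -tb.
- move=> a b cb; rewrite N12E cb (ltnNge b c) cb /= vC_end //.
  rewrite mulr1 (eval4' _ (kE b)) mxE (ol _ _ _ _ (fun x => end_hp Ed x (kn b))) ?mxE //.
    by ring.
  by move=> a'; rewrite mxE.
- move=> a b b' bb bc; rewrite N21E bc (leqNgt c b) bc /= (fam_atE bb) addrK vC_end // mxE.
  by ring.
- move=> a b cb; rewrite N21E cb (ltnNge b c) cb /= vD_end // !mxE.
  by ring.
- move=> a b b' bb bc; rewrite N22E bc (leqNgt c b) bc /= vD_end // mxE -(@hn_tn b' b) -?bb //.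
  by ring.
- move=> a b cb; rewrite N22E cb (ltnNge b c) cb /= vC_end // mxE.
  by ring.
Qed.

End EdgeDeterminant.

(** * Wiener-Hopf factorisation of the symbol *)

Section GeometricExpansion.
Variable R : realType.
Implicit Types (g h : R[i] -> R[i]) (p q v : nat -> R[i]) (C r : R) (s : int).

(** A geometrically convergent expansion along the powers of z, for s = 1, or
    along those of 1/z, for s = -1. *)
Definition geo_expand g v s C r : Prop :=
  [/\ ccirc g, forall n, cn (v n) <= C * r ^+ n &
    forall x (M : nat), cn (g (circ x) - \sum_(i < M) v i * circ x ^ (s * i%:Z)) <= C * r ^+ M].

Lemma geo_expand_weaken g v s C r C' r' : 0 <= C -> C <= C' -> 0 < r -> r <= r' ->
  geo_expand g v s C r -> geo_expand g v s C' r'.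
Proof.
move=> C0 CC r0 rr [cg vC Ex].
have w (n : nat) : C * r ^+ n <= C' * r' ^+ n.
  apply: ler_pM => //; first by rewrite exprn_ge0 // ltW.
  by rewrite lerXn2r ?nnegrE ?(ltW r0) // (le_trans (ltW r0)).
split=> // [n|x M]; first exact: le_trans (vC n) (w n).
exact: le_trans (Ex x M) (w M).
Qed.

Lemma geo_expand_disc g (R1 B : R) : 1 < R1 -> (forall z, cn z < R1 -> exists d, cder g z d) ->
  (forall z, cn z <= 1 -> cn (g z) <= B) ->
  exists C r, [/\ 0 <= C, 0 < r < 1,
    geo_expand g (fun n => fourier g n%:Z) 1 C r &
    geo_expand (fun z => g z^-1) (fun n => fourier g n%:Z) (-1) C r].
Proof.
move=> R11 Gd GB; have [C [r [C0 r01 V Ex]]] := disc_expand R11 Gd GB.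
have cg : ccirc g by apply: cder_ccirc => y; apply: Gd; rewrite cn_circ.
exists C, r; split=> //; split=> //.
- by move=> x M; under eq_bigr => i _ do rewrite mul1r -exprnP.
- have cg' a b : ccont a b (fun x => g (circ (- x))).
    split=> y _; have [d /cder_cvg dG] : exists d, cder g (circ (- y)) d.
      by apply: Gd; rewrite cn_circ.
    apply: (cvg_comp (fun t : R => circ (- t) : (R[i])^o) (g : (R[i])^o -> (R[i])^o) _ dG).
    apply: (cvg_comp (fun t : R => - t) (fun t : R => circ t : (R[i])^o) _ (@circ_cvg R (- y))).
    by apply: cvgN; exact: cvg_id.
  split=> a b; rewrite (_ : (fun x => _) = (fun x => g (circ (- x)))) //.
  by apply/funext => x; rewrite circN.
- move=> x M; have := Ex (- x) M; rewrite circN.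
  rewrite (eq_bigr (fun i : 'I_M => fourier g i%:Z * circ x ^ (-1 * i%:Z))) // => i _.
  by rewrite exprVn mulN1r exprnN.
Qed.

Lemma fourier_geo g v s C r : 0 <= C -> 0 < r < 1 -> s * s = 1 -> geo_expand g v s C r ->
  forall m, fourier g m = ext v (s * m).
Proof. by move=> C0 /andP[r0 r1] ss [cg _ Ex]; exact: fourier_of_expand cg r0 r1 C0 ss Ex. Qed.

(** Fourier coefficients of the constant function g h = 1. *)
Lemma inv_seq_geo g h p q s C r : 0 <= C -> 0 < r < 1 -> s * s = 1 ->
  geo_expand g p s C r -> geo_expand h q s C r ->
  (forall x, g (circ x) * h (circ x) = 1) -> inv_seq p q.
Proof.
move=> C0 r01 ss eg eh gh n; have fg := fourier_geo C0 r01 ss eg.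
have [cg _ _] := eg; have [ch _ Ex] := eh; have [r0 r1] := andP r01.
have [B B0 gB] := ccirc_bounded cg.
apply/esym; apply: (cgeo_eq_ev (K := 2 * (B * C)) (r := r) (M0 := n.+1)) => //.
  by rewrite !mulr_ge0.
move=> M nM; have := fourier_mul_expand (s * n%:Z) cg ch gB (fun x => Ex x M).
rewrite (eq_fourier (h := fun=> 1)) // fourier_cst mul1r !mulrA.
rewrite (_ : (s * n%:Z == 0) = (n == 0)%N); last first.
  by rewrite mulf_eq0; case: eqP ss => [->|//]; rewrite mul0r.
congr (cn (_ - _) <= _); rewrite -(sum_ext_trunc p q nM); apply: eq_bigr => i _.
by rewrite -mulrBr fg mulrA ss mul1r mulrC.
Qed.

End GeometricExpansion.

Section WienerHopf.
Variable R : realType.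
Variables (f lf : R[i] -> R[i]) (C rho : R).
Hypotheses (C0 : 0 <= C) (rho0 : 0 < rho) (rho1 : rho < 1)
  (Hvp : forall n : nat, cn (fourier lf n%:Z) <= C * rho ^+ n)
  (Hvm : forall n : nat, cn (fourier lf (- n.+1%:Z)) <= C * rho ^+ n)
  (lfE : forall x (M : nat), cn (lf (circ x) - \sum_(n < M) (fourier lf n%:Z * circ x ^ n%:Z +
      fourier lf (- n.+1%:Z) * circ x ^ (- n.+1%:Z))) <= C * rho ^+ M)
  (cf : ccirc f) (flf : forall x, cexp (lf (circ x)) = f (circ x)).

Let Gp := gplus lf.
Let Gm c z := gminus lf c z^-1.

(** The coefficients of the Wiener-Hopf factors of f and of their inverses. *)
Definition wiener_hopf : edge R :=
  Edge (fourier f) (fun n => fourier (gplus lf 1) n%:Z) (fun n => fourier (gplus lf (-1)) n%:Z)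
    (fun n => fourier (gminus lf 1) n%:Z) (fun n => fourier (gminus lf (-1)) n%:Z).
Let E := wiener_hopf.

Let cn1' : cn (1 : R[i]) <= 1. Proof. by rewrite cn1. Qed.
Let cnN1 : cn (-1 : R[i]) <= 1. Proof. by rewrite cnN cn1. Qed.

Let factors : exists C r : R, [/\ 0 <= C, 0 < r < 1,
  geo_expand (Gp 1) (ea E) 1 C r /\ geo_expand (Gp (-1)) (eai E) 1 C r &
  geo_expand (Gm 1) (eb E) (-1) C r /\ geo_expand (Gm (-1)) (ebi E) (-1) C r].
Proof.
have R11 : 1 < rho^-1 by rewrite -invr1 ltf_pV2 ?posrE.
have hp c : cn c <= 1 -> _ := fun c1 => geo_expand_disc R11
  (@gplus_cder _ _ _ _ C0 rho0 Hvp c) (fun z => @gplus_le _ _ _ _ C0 rho0 rho1 Hvp c z c1).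
have hm c : cn c <= 1 -> _ := fun c1 => geo_expand_disc R11
  (@gminus_cder _ _ _ _ C0 rho0 Hvm c) (fun z => @gminus_le _ _ _ _ C0 rho0 rho1 Hvm c z c1).
have [C1 [r1 [C10 /andP[r10 r11] g1 _]]] := hp _ cn1'.
have [C2 [r2 [C20 /andP[r20 r21] g2 _]]] := hp _ cnN1.
have [C3 [r3 [C30 /andP[r30 r31] _ g3]]] := hm _ cn1'.
have [C4 [r4 [C40 /andP[r40 r41] _ g4]]] := hm _ cnN1.
exists (C1 + C2 + (C3 + C4)), (Num.max (Num.max r1 r2) (Num.max r3 r4)).
have H g v s C' r' : 0 <= C' -> C' <= C1 + C2 + (C3 + C4) -> 0 < r' ->
    r' <= Num.max (Num.max r1 r2) (Num.max r3 r4) -> geo_expand g v s C' r' ->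
    geo_expand g v s (C1 + C2 + (C3 + C4)) (Num.max (Num.max r1 r2) (Num.max r3 r4)).
  exact: geo_expand_weaken.
split.
- by rewrite !addr_ge0.
- by rewrite !lt_max r10 !gt_max r11 r21 r31 r41.
- split; [apply: H g1|apply: H g2] => //; rewrite ?le_max ?lexx ?orbT //; lra.
- split; [apply: H g3|apply: H g4] => //; rewrite ?le_max ?lexx ?orbT //; lra.
Qed.

Let GpV x : Gp 1 (circ x) * Gp (-1) (circ x) = 1.
Proof. by rewrite /Gp /gplus mul1r mulN1r cexpN mulfV ?cexp_neq0. Qed.
Let GmV x : Gm 1 (circ x) * Gm (-1) (circ x) = 1.
Proof. by rewrite /Gm /gminus mul1r mulN1r cexpN mulfV ?cexp_neq0. Qed.

(** The two halves of the Laurent series of lf add up to lf. *)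
Let fE x : f (circ x) = Gp 1 (circ x) * Gm 1 (circ x).
Proof.
rewrite -flf /Gp /Gm /gplus /gminus !mul1r -cexpD; congr cexp.
have z1 : cn (circ x) * rho <= rho by rewrite cn_circ mul1r.
have z2 : cn (circ x)^-1 * rho <= rho by rewrite cnV cn_circ invr1 mul1r.
have [_ Ep] := psum_cvg Hvp C0 (ltW rho0) z1 rho1.
have [_ Em] := psum_cvg Hvm C0 (ltW rho0) z2 rho1.
set P := psum _ _ in Ep *; set Q := psum _ _ in Em *.
apply: (cgeo_eq (K := C + C / (1 - rho) + C / (1 - rho)) (ltW rho0) rho1) => M.
have -> : lf (circ x) - (P + (circ x)^-1 * Q) =
   (lf (circ x) - \sum_(n < M) (fourier lf n%:Z * circ x ^ n%:Z +
      fourier lf (- n.+1%:Z) * circ x ^ (- n.+1%:Z))) -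
   (P - \sum_(i < M) fourier lf i%:Z * circ x ^+ i) -
   (circ x)^-1 * (Q - \sum_(i < M) fourier lf (- i.+1%:Z) * (circ x)^-1 ^+ i).
  have -> : \sum_(n < M) (fourier lf n%:Z * circ x ^ n%:Z +
      fourier lf (- n.+1%:Z) * circ x ^ (- n.+1%:Z)) =
      \sum_(i < M) fourier lf i%:Z * circ x ^+ i +
      (circ x)^-1 * \sum_(i < M) fourier lf (- i.+1%:Z) * (circ x)^-1 ^+ i.
    rewrite big_split mulr_sumr; congr (_ + _); apply: eq_bigr => i _.
    by rewrite mulrCA -exprS exprVn.
  by move: (lf _) (circ x)^-1 (\sum_(_ < _) _) (\sum_(_ < _) _) => a b c d; ring.
rewrite !mulrDl; apply: le_trans (cnB _ _) _; apply: lerD.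
  by apply: le_trans (cnB _ _) _; apply: lerD (Ep M); exact: lfE.
have c1 : cn (circ x)^-1 = 1 by rewrite cnV cn_circ invr1.
by rewrite (cnM (circ x)^-1) c1 mul1r; exact: Em.
Qed.

Lemma wiener_hopf_ok : exists B r : R, edge_ok E B r.
Proof.
have [C' [r [C'0 r01 [ga gai] [gb gbi]]]] := factors; have [r0 r1] := andP r01.
have [Bf Bf0 fB] := ccirc_bounded cf.
pose B := C' + 2 * Bf + 2 * (Bf * C').
have b1 : 0 <= 2 * Bf by rewrite mulr_ge0.
have b2 : 0 <= 2 * (Bf * C') by rewrite !mulr_ge0.
have CB : C' <= B by rewrite /B; lra.
have rn (n : nat) : 0 <= r ^+ n by rewrite exprn_ge0 // ltW.
have le1 v g s : geo_expand g v s C' r -> forall n, cn (v n) <= B * r ^+ n.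
  by move=> [_ V _] n; apply: le_trans (V n) _; rewrite ler_wpM2r.
have le2 v g s : geo_expand g v s C' r -> forall n, cn (v n) <= B.
  move=> gv n; apply: le_trans (le1 _ _ _ gv n) _.
  by rewrite ler_piMr ?exprn_ile1 ?(ltW r0) ?(ltW r1) //; rewrite /B; lra.
have conv g h v w s s' : s' * s' = 1 -> geo_expand g v s C' r -> geo_expand h w s' C' r ->
    (forall x, f (circ x) * g (circ x) = h (circ x)) -> forall u (M : nat),
    cn (ext w (s' * u) - \sum_(i < M) v i * fourier f (u - s * i%:Z)) <= B * r ^+ M.
  move=> ss [cg _ Eg] eh fg u M; rewrite -(fourier_geo C'0 r01 ss eh) -(eq_fourier (g := fun z => f z * g z) u fg).
  apply: le_trans (fourier_mul_expand u cf cg fB (fun x => Eg x M)) _.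
  by rewrite !mulrA ler_wpM2r // -mulrA /B; lra.
have ss1 : 1 * 1 = 1 :> int by []; have ssN : -1 * -1 = 1 :> int by [].
exists B, r; split=> //.
- by rewrite /B; lra.
- by move=> u; apply: le_trans (fourier_le u cf fB) _; rewrite /B; lra.
- exact: le2 ga.
- exact: le2 gb.
- exact: le1 gai.
- exact: le1 gbi.
- exact: inv_seq_geo C'0 r01 ss1 ga gai GpV.
- exact: inv_seq_geo C'0 r01 ssN gb gbi GmV.
- move=> u M; have fp x : f (circ x) * Gp (-1) (circ x) = Gm 1 (circ x).
    by rewrite fE mulrAC GpV mul1r.
  have := conv _ _ _ _ _ _ ssN gai gb fp u M; rewrite mulN1r.
  by under eq_bigr => i _ do rewrite mul1r.
- move=> u M; have fm x : f (circ x) * Gm (-1) (circ x) = Gp 1 (circ x).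
    by rewrite fE -mulrA GmV mulr1.
  have := conv _ _ _ _ _ _ ss1 gbi ga fm u M; rewrite mul1r.
  by under eq_bigr => i _ do rewrite mulN1r opprK.
Qed.

Let GpVN x : Gp (-1) (circ x) = (Gp 1 (circ x))^-1.
Proof. by rewrite /Gp /gplus mulN1r mul1r cexpN. Qed.
Let GmVN x : Gm (-1) (circ x) = (Gm 1 (circ x))^-1.
Proof. by rewrite /Gm /gminus mulN1r mul1r cexpN. Qed.

Let exprzN1 (z : R[i]) : z ^ (-1) = z^-1. Proof. by []. Qed.

(** For e = -1 the boundary values of alpha are those of the first end of the
    matrix, where 1/phi_+ comes from the inside and phi_- from the outside. *)
Lemma det_Nmx_minus (n r : nat) (p h : 'I_n -> int) (k t : 'I_r -> int) (c : nat)
  (pn hn : 'I_n -> nat) (kn tn : 'I_r -> nat) :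
  (forall a, p a = (pn a)%:Z) -> (forall a, h a = (hn a)%:Z) ->
  (forall b, k b = (kn b)%:Z) -> (forall b, t b = (tn b)%:Z) ->
  (c <= n)%N -> (c <= r)%N ->
  (forall (a : 'I_n) (b : 'I_r), a = b :> nat -> (a < c)%N -> h a = t b) ->
  \det (Nmx lf (-1) p h k t c) =
  \det (block_mx (\matrix_(a, b) end_ph E (pn a) (hn b)) (- (\matrix_(a, b) end_pp E (pn a) (kn b)))
                 (\matrix_(a, b) end_hh E (tn a) (hn b)) (\matrix_(a, b) end_hp E (tn a) (kn b))).
Proof.
move=> pE hE kE tE cn_ cr_ ht.
have [C' [r' [C'0 r01 [ga gai] [gb gbi]]]] := factors.
have ss1 : 1 * 1 = 1 :> int by []; have ssN : -1 * -1 = 1 :> int by [].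
have [ca _ _] := ga; have [cai _ _] := gai; have [cb _ _] := gb; have [cbi _ _] := gbi.
have bp := alpha_bv_plus C0 rho0 rho1 Hvp; have bm := alpha_bv_minus C0 rho0 rho1 Hvm.
apply: (@det_Nmx _ (fourier f) lf (-1) _ _ _ _ (Gp 1) (Gp (-1)) (Gm 1) (Gm (-1))) => //.
- by right.
- by move=> x; rewrite bp exprzN1 -[LHS]/((Gp (-1) (circ x))^-1) GpVN invrK.
- by move=> x; rewrite bm exprzN1 GmVN.
- by move=> x; rewrite GmVN invrK.
- by move=> m; apply: etrans (fourier_geo C'0 r01 ss1 ga m) _; rewrite mulN1r opprK mul1r.
- by move=> m; apply: etrans (fourier_geo C'0 r01 ss1 gai m) _; rewrite mulN1r opprK mul1r.
- by move=> m; exact: (fourier_geo C'0 r01 ssN gb m).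
- by move=> m; exact: (fourier_geo C'0 r01 ssN gbi m).
- exact: inv_seq_geo C'0 r01 ss1 ga gai GpV.
- by move=> a; rewrite pE addr0.
- by move=> a; rewrite hE addr0.
- by move=> a; rewrite kE addr0.
- by move=> a; rewrite tE addr0.
Qed.

(** For e = 1 the two factors are exchanged, as at the last end. *)
Lemma det_Nmx_plus (n r : nat) (p h : 'I_n -> int) (k t : 'I_r -> int) (c : nat)
  (pn hn : 'I_n -> nat) (kn tn : 'I_r -> nat) :
  (forall a, p a = (pn a)%:Z + 1) -> (forall a, h a = (hn a)%:Z + 1) ->
  (forall b, k b = (kn b)%:Z + 1) -> (forall b, t b = (tn b)%:Z + 1) ->
  (c <= n)%N -> (c <= r)%N ->
  (forall (a : 'I_n) (b : 'I_r), a = b :> nat -> (a < c)%N -> h a = t b) ->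
  let E' := mirror E in
  \det (Nmx lf 1 p h k t c) =
  \det (block_mx (\matrix_(a, b) end_ph E' (pn a) (hn b)) (- (\matrix_(a, b) end_pp E' (pn a) (kn b)))
                 (\matrix_(a, b) end_hh E' (tn a) (hn b)) (\matrix_(a, b) end_hp E' (tn a) (kn b))).
Proof.
move=> pE hE kE tE cn_ cr_ ht.
have [C' [r' [C'0 r01 [ga gai] [gb gbi]]]] := factors.
have ss1 : 1 * 1 = 1 :> int by []; have ssN : -1 * -1 = 1 :> int by [].
have [ca _ _] := ga; have [cai _ _] := gai; have [cb _ _] := gb; have [cbi _ _] := gbi.
have bp := alpha_bv_plus C0 rho0 rho1 Hvp; have bm := alpha_bv_minus C0 rho0 rho1 Hvm.
apply: (@det_Nmx _ (fun u => fourier f (- u)) lf 1 _ _ _ _ (Gm 1) (Gm (-1)) (Gp 1) (Gp (-1))) => //.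
- by left.
- by move=> x; rewrite GpVN invrK.
- by move=> m; apply: etrans (fourier_geo C'0 r01 ssN gb m) _; rewrite mulN1r mul1r.
- by move=> m; apply: etrans (fourier_geo C'0 r01 ssN gbi m) _; rewrite mulN1r mul1r.
- by move=> m; exact: (fourier_geo C'0 r01 ss1 ga m).
- by move=> m; exact: (fourier_geo C'0 r01 ss1 gai m).
- exact: inv_seq_geo C'0 r01 ssN gb gbi GmV.
Qed.

End WienerHopf.

(** * Excited Toeplitz determinants *)

Section ExcitedToeplitz.
Variable R : realType.
Variables (f : R[i] -> R[i]) (E : edge R).
Hypothesis efE : ef E = fourier f.

Lemma toeplitz_detE N : toeplitz_det f N id id = \det (toep E N).
Proof.
by congr (\det _); apply/matrixP => a b; rewrite !mxE efE; congr (fourier f _); lia.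
Qed.

Variables (n q : nat) (P H : 'I_n -> bool * nat) (K T : 'I_q -> bool * nat).

(** The excited entries are those of det_excite once holes are read as indices. *)
Lemma toeplitz_det_excite (N : nat) (p h : 'I_n -> int) (k t : 'I_q -> int) :
  (forall a, p a = posP N (P a) + 1) -> (forall a, h a = posH N (H a) + 1) ->
  (forall b, k b = posP N (K b) + 1) -> (forall b, t b = posH N (T b) + 1) ->
  injective h -> injective t -> (forall a, (H a).2 < N)%N -> (forall b, (T b).2 < N)%N ->
  toep E N \in unitmx ->
  toeplitz_det f N (excite p h) (excite k t) = \det (toep E N) * \det (excited E P H K T N).
Proof.
move=> pE hE kE tE hI tI HN TN Tu.
(* The holes as indices of the matrix. *)
pose ho a : 'I_N := Ordinal (flipn_lt (H a).1 (HN a)).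
pose to b : 'I_N := Ordinal (flipn_lt (T b).1 (TN b)).
have hoE a : (ho a)%:Z = posH N (H a) by rewrite flipnE.
have toE b : (to b)%:Z = posH N (T b) by rewrite flipnE.
have hoI : injective ho.
  by move=> a a' e; apply: hI; rewrite !hE -!hoE e.
have toI : injective to.
  by move=> b b' e; apply: tI; rewrite !tE -!toE e.
have hoh (x : 'I_N) a : (h a == x.+1%:Z) = (ho a == x).
  rewrite hE -hoE -val_eqE; move: (ho a) => o; apply/eqP/eqP => /= oE; lia.
have tot (x : 'I_N) b : (t b == x.+1%:Z) = (to b == x).
  rewrite tE -toE -val_eqE; move: (to b) => o; apply/eqP/eqP => /= oE; lia.
have shift1 (u v : int) : u + 1 - (v + 1) = u - v by rewrite opprD addrACA subrr addr0.
transitivity (\det (excite_mx ho to (toep E N) (rowsP E P N) (colsK E K N) (cornPK E P K N))).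
  congr (\det _); apply/matrixP => x y; rewrite !mxE /excite.
  rewrite (eq_pick (hoh x)) (eq_pick (tot y)).
  case: pickP => [a _|_]; case: pickP => [b _|_];
    by rewrite ?mxE efE ?pE ?kE ?intS ?[1 + _]addrC shift1.
have tT : (unit_cols _ to)^T = rowsT R T N.
  by apply/matrixP => b x; rewrite !mxE -toE.
have hH : unit_cols _ ho = colsH R H N.
  by apply/matrixP => x a; rewrite !mxE -hoE.
rewrite (det_excite _ _ _ hoI toI Tu).
by rewrite tT hH.
Qed.

End ExcitedToeplitz.

Definition two_ended (m n : nat) (l : 'I_m -> nat) (r : 'I_n -> nat) (a : 'I_(m + n)) : bool * nat :=
  match fintype.split a with inl i => (true, l i) | inr i => (false, r i) end.

Section TwoEnds.
Variable R : realType.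
Variables (E : edge R) (nm np rm rp : nat).
Variables (pm hm : 'I_nm -> nat) (pp hp : 'I_np -> nat).
Variables (km tm : 'I_rm -> nat) (kp tp : 'I_rp -> nat).

Lemma two_endedl m n (l : 'I_m -> nat) (r : 'I_n -> nat) i : two_ended l r (lshift n i) = (true, l i).
Proof. by rewrite /two_ended (unsplitK (inl i)). Qed.
Lemma two_endedr m n (l : 'I_m -> nat) (r : 'I_n -> nat) i : two_ended l r (rshift m i) = (false, r i).
Proof. by rewrite /two_ended (unsplitK (inr i)). Qed.

(** The entries between members attached to different ends vanish. *)
Lemma det_excited_lim :
  \det (excited_lim E (two_ended pm pp) (two_ended hm hp) (two_ended km kp) (two_ended tm tp)) =
  \det (block_mx (\matrix_(a, b) end_ph E (pm a) (hm b)) (- (\matrix_(a, b) end_pp E (pm a) (km b)))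
                 (\matrix_(a, b) end_hh E (tm a) (hm b)) (\matrix_(a, b) end_hp E (tm a) (km b))) *
  \det (block_mx (\matrix_(a, b) end_ph (mirror E) (pp a) (hp b))
                 (- (\matrix_(a, b) end_pp (mirror E) (pp a) (kp b)))
                 (\matrix_(a, b) end_hh (mirror E) (tp a) (hp b))
                 (\matrix_(a, b) end_hp (mirror E) (tp a) (kp b))).
Proof.
rewrite -det_interleave /excited_lim; congr (\det (block_mx _ _ _ _));
  apply/matrixP => i j; case: (split_ordP i) => a ->; case: (split_ordP j) => b ->;
  rewrite ?block_mxEul ?block_mxEur ?block_mxEdl ?block_mxEdr !mxE ?two_endedl ?two_endedr //.
- by rewrite /lim_pp /= oppr0.
- by rewrite /lim_pp /= oppr0.
Qed.

End TwoEnds.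

(** * The asymptotic ratio *)

Section Families.
Variables (m n : nat) (l : 'I_m -> int) (r : 'I_n -> int) (l' : 'I_m -> nat) (r' : 'I_n -> nat).
Hypotheses (lE : forall a, l a = (l' a)%:Z + 1) (rE : forall a, r a = (r' a)%:Z + 1).

Lemma particlesE N a : particles l r N a = posP N (two_ended l' r' a) + 1.
Proof. by rewrite /particles /two_ended /posP; case: fintype.split => b /=; rewrite ?lE ?rE; lia. Qed.

Lemma holesE N a : holes l r N a = posH N (two_ended l' r' a) + 1.
Proof. by rewrite /holes /two_ended /posH; case: fintype.split => b /=; rewrite ?lE ?rE; lia. Qed.

End Families.

Section Negligible.
Variable R : realType.

(** N^m q^N is bounded. *)
Lemma tiny_bigO (u : nat -> R[i]) (m : nat) : tiny u ->
  (u : nat -> (R[i])^o) =O_\oo (fun N : nat => N%:R ^- m : (R[i])^o).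
Proof.
move=> [c q N0 c0 q0 q1 uq]; pose q2 := (q + 1) / 2.
have q02 : q < q2 by rewrite /q2; lra.
have q21 : q2 < 1 by rewrite /q2; lra.
have [K K0 HK] := poly_geo m q0 q02.
apply/eqO_exP; exists (c * K + 1)%:C; first by rewrite ltcR ltr_wpDl // mulr_ge0.
exists (maxn N0 1) => // N /=; rewrite geq_max => /andP[N0N N1].
have Nm : 0 < N%:R ^+ m :> R by rewrite exprn_gt0 // ltr0n.
rewrite !cnE -rmorphM lecR cnV cnX cn_nat ler_pdivlMr //.
apply: le_trans (_ : c * q ^+ N * N%:R ^+ m <= _).
  by rewrite ler_wpM2r ?(ltW Nm) // uq.
rewrite -mulrA [q ^+ N * _]mulrC; apply: le_trans (ler_wpM2l c0 (HK N)) _.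
have q20 : 0 <= q2 by rewrite (le_trans q0) // ltW.
apply: le_trans (_ : c * K <= _); last by rewrite lerDl.
by rewrite ler_wpM2l // ler_piMr // exprn_ile1 // ltW.
Qed.

End Negligible.

Theorem theorem2p1 (R : realType) (U : set (R[i])^o) (f lf : R[i] -> R[i])
  (U_open : open U) (U_circle : @unit_circle R `<=` U)
  (f_neq0 : forall z, U z -> f z != 0)
  (f_hol : holomorphic_on U f)
  (lf_hol : holomorphic_on U lf)
  (lf_log : forall z, U z -> cexp (lf z) = f z)
  (nm np rm rp : nat)
  (pm hm : 'I_nm -> int) (pp hp : 'I_np -> int)
  (km tm : 'I_rm -> int) (kp tp : 'I_rp -> int)
  (pm_ge1 : forall a, 1 <= pm a) (hm_ge1 : forall a, 1 <= hm a)
  (pp_ge1 : forall a, 1 <= pp a) (hp_ge1 : forall a, 1 <= hp a)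
  (km_ge1 : forall a, 1 <= km a) (tm_ge1 : forall a, 1 <= tm a)
  (kp_ge1 : forall a, 1 <= kp a) (tp_ge1 : forall a, 1 <= tp a)
  (distinct : \forall N \near \oo,
     [/\ injective (particles pm pp N), injective (holes hm hp N),
         injective (particles km kp N) & injective (holes tm tp N)])
  (cp cm : nat)
  (overlap_p : well_ordered_overlap hp tp cp)
  (overlap_m : well_ordered_overlap hm tm cm) :
  let Np := Nmx lf 1 pp hp kp tp cp in
  let Nm := Nmx lf (- 1) (fun a => pm a - 1) (fun a => hm a - 1)
                         (fun a => km a - 1) (fun a => tm a - 1) cm in
  \rank Np = (np + rp)%N ->
  \rank Nm = (nm + rm)%N ->
  exists delta : nat -> (R[i])^o,
    (forall m : nat, delta =O_\oo (fun N : nat => N%:R ^- m : (R[i])^o)) /\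
    \forall N \near \oo,
      toeplitz_det f N id id != 0 /\
      toeplitz_det f N (excite (particles pm pp N) (holes hm hp N))
                       (excite (particles km kp N) (holes tm tp N))
        * (toeplitz_det f N id id)^-1
      = \det Np * \det Nm * (1 + delta N).
Proof.
move=> Np Nm rkNp rkNm.
have [x0 x00 Ux] := open_annulus U_open U_circle.
have x02 : 0 < x0 / 2 by rewrite divr_gt0.
have Uc y : U (circ y : R[i]) by apply: U_circle; rewrite /unit_circle /= cnE cn_circ.
have lfd x y : `|x| <= x0 / 2 -> 0 <= y <= 2 * pi -> exists d, cder lf (cexp (x +i* y)) d.
  move=> xx yb; apply: derivable_cder; apply: lf_hol; apply: Ux => //.
  by apply: le_lt_trans xx _; lra.
have [_ [C [rho [C0 /andP[r0 r1] Hvp Hvm lfE]]]] := annulus_expand x02 lfd.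
have cf : ccirc f by apply: cder_ccirc => y; apply: derivable_cder; apply: f_hol.
have flf y : cexp (lf (circ y)) = f (circ y) by exact: lf_log.
have [B [r ok]] := wiener_hopf_ok C0 r0 r1 Hvp Hvm lfE cf flf.
pose E := wiener_hopf f lf; rewrite -/E in ok.
(* Distances to an end are counted from 0. *)
pose sh n (x : 'I_n -> int) a := `|x a - 1|%N.
have shE n (x : 'I_n -> int) : (forall a, 1 <= x a) -> forall a, x a = (sh n x a)%:Z + 1.
  by move=> x1 a; have := x1 a; rewrite /sh; lia.
have shE0 n (x : 'I_n -> int) : (forall a, 1 <= x a) -> forall a, x a - 1 = (sh n x a)%:Z.
  by move=> x1 a; rewrite (shE _ _ x1) addrK.
have [cp_le ovp _] := overlap_p; have [cm_le ovm _] := overlap_m.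
move: cp_le cm_le; rewrite !leq_min => /andP[cpr cpn] /andP[cmr cmn].
pose P := two_ended (sh _ pm) (sh _ pp); pose H := two_ended (sh _ hm) (sh _ hp).
pose K := two_ended (sh _ km) (sh _ kp); pose T := two_ended (sh _ tm) (sh _ tp).
have DE : \det (excited_lim E P H K T) = \det Np * \det Nm.
  rewrite det_excited_lim mulrC; congr (_ * _); apply/esym.
    by apply: (det_Nmx_plus f C0 r0 r1 Hvp Hvm) => //; exact: shE.
  apply: (det_Nmx_minus f C0 r0 r1 Hvp Hvm) => //; try exact: shE0.
  by move=> a b ab ac; rewrite (ovm a b ab ac).
have D0 : \det Np * \det Nm != 0.
  have full n (A : 'M[R[i]]_n) : \rank A = n -> \det A != 0.
    by move=> rA; rewrite -unitfE -unitmxE -row_free_unit /row_free rA.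
  by rewrite mulf_neq0 // full.
have [tq] := approx_excited ok P H K T; rewrite DE in tq.
pose D := \det Np * \det Nm.
(* The relative error is defined for all N; it is the one of the ratio once the
   Toeplitz matrix is invertible. *)
exists (fun N => \det (excited E P H K T N) / D - 1); split.
  move=> m; apply: tiny_bigO; apply: tiny_ext (0%N) _ (tinyMl D^-1 tq) => N _.
  by rewrite mulrBr mulVf // mulrC.
have [N1 HN1] := toep_inverse ok.
have far n (X : 'I_n -> bool * nat) : \forall N \near \oo, forall a, ((X a).2 < N)%N.
  exists (\max_a (X a).2).+1 => // N /= XN a; apply: leq_trans XN; rewrite ltnS.
  exact: (@leq_bigmax _ (fun a => (X a).2)).
near=> N.
have Tu : toep E N \in unitmx by apply: (HN1 N _).1; near: N; exact: nbhs_infty_ge.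
have [_ hI _ tI] : [/\ injective (particles pm pp N), injective (holes hm hp N),
     injective (particles km kp N) & injective (holes tm tp N)] by near: N.
have HN : forall a, ((H a).2 < N)%N by near: N; exact: far.
have TN : forall a, ((T a).2 < N)%N by near: N; exact: far.
have dT : \det (toep E N) != 0 by rewrite -unitfE -unitmxE.
rewrite (toeplitz_detE (E := E)) //; split=> //.
rewrite (@toeplitz_det_excite _ f E erefl _ _ P H K T) //.
- by rewrite mulrAC mulfV // mul1r addrCA subrr addr0 mulrC mulfVK.
- by move=> a; apply: particlesE; exact: shE.
- by move=> a; apply: holesE; exact: shE.
- by move=> a; apply: particlesE; exact: shE.
- by move=> a; apply: holesE; exact: shE.
Unshelve. all: by end_near.
Qed.
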